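(* Let $\{\tilde S_n\}_{n\ge1}$ be the random walk with echoed steps with memory parameter $p$, spin law $X$ and echo law $\xi$, satisfying the standing hypotheses. Suppose $p\,m_1>1$. Then there exists a random variable $M_\infty^{(p,\xi)}\in L^1(\mathbb P)$ such that $$\lim_{n\to\infty}\frac{\tilde S_n}{n^{pm_1}}=M_\infty^{(p,\xi)}\quad\text{almost surely.}$$ Furthermore: (i) If $\mathbb E[\xi\log\xi]<m_1$, then this convergence also holds in $L^\gamma(\mathbb P)$ for every $\gamma\in\Lambda$; moreover $M_\infty^{(p,\xi)}$ is non-degenerate and $$\mathbb E M_\infty^{(p,\xi)}=\frac{\mathbb E X}{\Gamma(1+pm_1)}\left[1+\frac{1-p}{pm_1-1}\right].$$ (ii) If $\mathbb E[\xi\log\xi]\ge m_1$, then $M_\infty^{(p,\xi)}=0$ almost surely.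
   Context: Standing hypotheses: $p\in(0,1]$; $X$ and $\xi$ are real random variables with $\mathbb P(X=0)<1$, $\mathbb P(\xi=0)<1$, $\xi\ge0$ a.s., and $X,\xi\in L^\alpha(\mathbb P)$ for some $\alpha>1$. Random walk with echoed steps (RWES): let $\{X_n\}_{n\ge1}$ be i.i.d. copies of $X$ (the spins), $\{\varepsilon_n\}_{n\ge2}$ i.i.d. Bernoulli$(p)$, $\{\mathcal U[n]\}_{n\ge2}$ independent with $\mathcal U[n]$ uniform on $\{1,\dots,n-1\}$, $\{\xi_n\}_{n\ge2}$ i.i.d. copies of $\xi$ (the echo variables), all these families being mutually independent. Set $$\tilde X_1=X_1,\qquad \tilde X_n=(1-\varepsilon_n)X_n+\varepsilon_n\xi_n\tilde X_{\mathcal U[n]}\ (n\ge2),\qquad \tilde S_n=\tilde X_1+\cdots+\tilde X_n .$$ Notation: $m_\gamma=\mathbb E\,\xi^\gamma$ for $\gamma\in\mathbb R$; $\Lambda=\{\gamma>1:\ \mathbb E|X|^\gamma<\infty\text{ and }m_\gamma<\gamma m_1\}$; $0\log0=0$. A random variable is non-degenerate if it is not almost surely constant. *)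

(* Defs.v *)
From mathcomp Require Import all_boot all_order all_algebra.
From mathcomp Require Import all_classical all_reals all_analysis.

Set Implicit Arguments.
Unset Strict Implicit.
Unset Printing Implicit Defensive.

Import Order.TTheory GRing.Theory Num.Theory.
Import numFieldNormedType.Exports.

Local Open Scope classical_set_scope.
Local Open Scope ring_scope.

Definition Gamma_fun (R : realType) (x : R) : R :=
  \int[lebesgue_measure]_(t in `]0, +oo[) (t `^ (x - 1) * expR (- t)).

Section Probability.
Context (d : measure_display) (T : measurableType d) (R : realType).
Variable P : probability T R.

(* Quantifying over measurable sets only: a measure is a total function on
   sets, with no meaningful value at non-measurable ones. *)
Definition same_law (Y Z : {RV P >-> R}) : Prop :=
  forall A : set R, measurable A -> distribution P Y A = distribution P Z A.

Definition sigma_rv (d' : measure_display) (E : measurableType d')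
    (Y : {RV P >-> E}) : set_system T :=
  [set Y @^-1` B | B in [set B | measurable B]].

(* Mutual independence of the set systems F i, for i ranging over D: the
   product rule for every finite subfamily. *)
Definition mutually_independent (I : eqType) (D : set I)
    (F : I -> set_system T) : Prop :=
  forall (J : seq I) (A : I -> set T), uniq J ->
    (forall i, i \in J -> D i /\ F i (A i)) ->
    P (\big[setI/setT]_(i <- J) A i) = (\prod_(i <- J) P (A i))%E.

Definition nondegenerate_rv (Y : T -> R) : Prop :=
  ~ exists c : R, {ae P, forall w, Y w = c}.

Definition converges_in_Lp (gamma : R) (Y : nat -> T -> R) (Z : T -> R) : Prop :=
  [/\ forall n, Y n \in Lfun P gamma%:E,
      Z \in Lfun P gamma%:E
    & 'N[P]_(gamma%:E)[EFin \o (Y n \- Z)%R]%E @[n --> \oo] --> 0%E].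

(* m_gamma; possibly +oo. *)
Definition moment (xi : T -> R) (gamma : R) : \bar R :=
  'E_P[fun w => (xi w `^ gamma)%R]%E.

Definition mean_echo (xi : T -> R) : R := fine (moment xi 1).

(* The convention 0 log 0 = 0 is automatic, since ln 0 = 0. *)
Definition mean_xlogx (xi : T -> R) : \bar R :=
  'E_P[fun w => (xi w * ln (xi w))%R]%E.

Definition Lambda (X xi : T -> R) : set R :=
  [set gamma : R | [/\ 1 < gamma,
     ('E_P[fun w => (`|X w| `^ gamma)%R] < +oo)%E
   & (moment xi gamma < gamma%:E * moment xi 1)%E]].

End Probability.

Section RWES.
Context (d : measure_display) (T : measurableType d) (R : realType).
Variable P : probability T R.
Variables (Xs : nat -> {RV P >-> R}) (eps : nat -> {RV P >-> bool})
  (U : nat -> {RV P >-> nat}) (xis : nat -> {RV P >-> R}).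

(* Index set of the four families, tagged in the order spins, coins, uniform
   indices, echoes. *)
Definition rwes_index : eqType := ((nat + nat) + (nat + nat))%type.

(* Spins are indexed by n >= 1, the other three families by n >= 2; the
   remaining members of the sequences are unconstrained and unused. *)
Definition rwes_domain : set rwes_index := fun i =>
  match i with
  | inl (inl n) => (1 <= n)%N
  | inl (inr n) => (2 <= n)%N
  | inr (inl n) => (2 <= n)%N
  | inr (inr n) => (2 <= n)%N
  end.

Definition rwes_sigma (i : rwes_index) : set_system T :=
  match i with
  | inl (inl n) => sigma_rv (Xs n)
  | inl (inr n) => sigma_rv (eps n)
  | inr (inl n) => sigma_rv (U n)
  | inr (inr n) => sigma_rv (xis n)
  end.

Record rwes_inputs (p : R) (X xi : {RV P >-> R}) : Prop := RWESInputs {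
  spins_law : forall n, (1 <= n)%N -> same_law (Xs n) X ;
  coins_law : forall n, (2 <= n)%N -> P [set w | eps n w = true] = p%:E ;
  indices_law : forall n k, (2 <= n)%N -> (1 <= k < n)%N ->
    P [set w | U n w = k] = (n.-1%:R^-1)%:E ;
  echoes_law : forall n, (2 <= n)%N -> same_law (xis n) xi ;
  inputs_independent : mutually_independent P rwes_domain rwes_sigma
}.

(* The list of the first n echoed steps; the step of index k sits at
   position k.-1. *)
Fixpoint echoed_steps (n : nat) (w : T) : seq R :=
  match n with
  | 0 => [::]
  | 1 => [:: Xs 1%N w]
  | m.+1 =>
      let s := echoed_steps m w in
      rcons s ((1 - (eps m.+1 w)%:R) * Xs m.+1 w
               + (eps m.+1 w)%:R * xis m.+1 w * nth 0 s (U m.+1 w).-1)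
  end.

Definition echoed_step (n : nat) (w : T) : R := nth 0 (echoed_steps n w) n.-1.

Definition rwes (n : nat) (w : T) : R :=
  \sum_(1 <= k < n.+1) echoed_step k w.

Lemma echoed_stepsSS n w : echoed_steps n.+2 w =
  rcons (echoed_steps n.+1 w) ((1 - (eps n.+2 w)%:R) * Xs n.+2 w
    + (eps n.+2 w)%:R * xis n.+2 w
      * nth 0 (echoed_steps n.+1 w) (U n.+2 w).-1).
Proof. by []. Qed.

Lemma size_echoed_steps n w : size (echoed_steps n w) = n.
Proof. by elim: n => [//|[//|n] IH]; rewrite echoed_stepsSS size_rcons IH. Qed.

Lemma nth_echoed_steps n k w :
  (1 <= k <= n)%N -> nth 0 (echoed_steps n w) k.-1 = echoed_step k w.
Proof.
elim: n => [|n IH]; first by case: k.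
move=> /andP[k1]; rewrite leq_eqVlt => /predU1P[->//|]; rewrite ltnS => kn.
rewrite -IH ?k1//; case: n kn {IH} => [|n] kn; first by case: k k1 kn.
by rewrite echoed_stepsSS nth_rcons size_echoed_steps prednK// kn.
Qed.

(* The recursion defining the echoed steps; the range condition on U n holds
   almost surely under rwes_inputs. *)
Lemma echoed_step1 w : echoed_step 1 w = Xs 1%N w.
Proof. by []. Qed.

Lemma echoed_stepE n w : (2 <= n)%N -> (1 <= U n w < n)%N ->
  echoed_step n w = (1 - (eps n w)%:R) * Xs n w
    + (eps n w)%:R * xis n w * echoed_step (U n w) w.
Proof.
case: n => [//|[//|n]] _ Un.
rewrite [LHS]/echoed_step echoed_stepsSS nth_rcons size_echoed_steps ltnn eqxx.
by rewrite nth_echoed_steps.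
Qed.

End RWES.

(* Main.v *)
(** Write [x_k] for the echoed steps, [S_n] for their sum, [rho = p m_1] and
    [a_n = prod_(1 <= k < n) (1 + rho / k)]. Conditioning on the first [n] steps
    shows that [M_n = S_n / a_n - (1 - p) E X sum_(2 <= k <= n) 1 / a_k] is a
    martingale, the sum telescopes to a limit [1 / (rho - 1)], and tangent
    inequalities under the Gamma integral give [a_n / n^rho -> 1 / Gamma(1 + rho)].

    If [E(xi log xi) < m_1], expanding [m_gamma] to second order at [gamma = 1]
    yields [gamma > 1] with [m_gamma < gamma m_1]. For such [gamma] the moment
    [E sum |x_k|^gamma] grows more slowly than [a_n^gamma]; together with a first
    order expansion of [|a + b|^gamma] this makes [M_n] Cauchy in [L^gamma], and a
    maximal inequality gives almost sure convergence. Were the limit constant,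
    every [M_n] would be, so that [x_1 = c], [x_2 = m_1 c] and
    [x_3 = m_1 c = m_1^2 c] with [m_1 > 1], whence [c = 0] and [X = 0].

    If [E(xi log xi) >= m_1], the normalised sum [Z_n] of the [|x_k|] plus a
    deterministic tail is a nonnegative martingale; stop it at a level [L]. The
    potential [sum phi(|x_k| / a_n)], [phi(u) = u (D - log u) - u^(1 + delta)], is
    nonnegative below [L] and, since [m_(1 + delta) > (1 + delta) m_1], it loses in
    mean a multiple of [n^-1 E sum (|x_k| / a_n)^(1 + delta)] at step [n], up to a
    summable error. As the harmonic series diverges, the stopped mass is
    arbitrarily small at arbitrarily late times, and the maximal inequality for
    nonnegative supermartingales gives [Z_n -> 0] almost surely. *)

(* No conditional expectation is ever formed. Conditioning on the first steps means integrating
   against an arbitrary function that is measurable for the sigma-algebra generated by finitely many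
   inputs; martingale identities, maximal inequalities and the closure of the martingale by its
   limit are all stated in this tested form.

   Second moments may be infinite, so only an exponent [r > 1] is available. The error of a plain
   first order expansion is of order [1/n], which does not sum. A splitting parameter [e] decreasing
   like a small power of [1/n] makes that error summable; the price [e^(-r)] is paid by the surplus
   by which [a_n^r] outgrows the moment sum.

   In the critical regime [u] is exactly harmonic for one step followed by rescaling, and
   [- u log u] drifts by a multiple of [m_1 - E(xi log xi)], up to order [n^-2]. At equality this
   gain vanishes, so the power [u^(1 + delta)] must supply the strict loss. Its cost is that the
   potential is negative for large [u]: a new step may jump there, hence the potential is capped,
   and the cap is paid by the moment of order [1 + 2 delta] with a factor that a large [D] makes
   small. *)
Require Import Defs.
From mathcomp Require Import all_boot all_order all_algebra.
From mathcomp Require Import all_classical all_reals all_analysis.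
From mathcomp Require Import measurable_realfun zify ring lra.

Set Implicit Arguments.
Unset Strict Implicit.
Unset Printing Implicit Defensive.

Import Order.TTheory GRing.Theory Num.Theory.
Import numFieldNormedType.Exports.

Local Open Scope classical_set_scope.
Local Open Scope ring_scope.

(** * Expectations of real functions *)

Section RealExpectation.
Context (d : measure_display) (T : measurableType d) (R : realType).
Variable P : probability T R.
Implicit Types (f g h : T -> R) (A B : set T).

Definition intg f := P.-integrable setT (EFin \o f).
(** Real valued so that expectations can be handled by [lra] and [ring]. The value is meaningful
    only together with [intg f], which is why the two are propagated side by side. *)
Definition Ex f : R := \int[P]_w f w.

Lemma intg_meas f : intg f -> measurable_fun setT f.
Proof. by move=> /measurable_int /measurable_EFinP. Qed.

Lemma eq_intg f g : f =1 g -> intg f -> intg g.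
Proof. by move=> fg; apply: eq_integrable => // w _; rewrite /= fg. Qed.

Lemma intgD f g : intg f -> intg g -> intg (fun w => f w + g w).
Proof. by move=> fi gi; apply: eq_integrable (integrableD _ fi gi). Qed.

Lemma intgZ c f : intg f -> intg (fun w => c * f w).
Proof. by move=> fi; apply: eq_integrable (integrableZl _ c fi). Qed.

Lemma intgN f : intg f -> intg (fun w => - f w).
Proof. by move=> /(intgZ (-1)); apply: eq_intg => w; rewrite mulN1r. Qed.

Lemma intgB f g : intg f -> intg g -> intg (fun w => f w - g w).
Proof. by move=> fi /intgN; apply: intgD. Qed.

Lemma intg_cst c : intg (fun=> c).
Proof. exact: finite_measure_integrable_cst. Qed.

Lemma intg_sum (I : Type) (s : seq I) (F : I -> T -> R) :
  (forall i, intg (F i)) -> intg (fun w => \sum_(i <- s) F i w).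
Proof.
move=> Fi; elim: s => [|i s IH].
  by apply: eq_intg (intg_cst 0) => w; rewrite big_nil.
by apply: eq_intg (intgD (Fi i) IH) => w; rewrite big_cons.
Qed.

Lemma intg_le g f : measurable_fun setT f -> intg g ->
  (forall w, `|f w| <= g w) -> intg f.
Proof.
move=> mf gi fg; apply: le_integrable gi => //; first exact/measurable_EFinP.
by move=> w _; rewrite /= lee_fin (le_trans (fg w))// ler_norm.
Qed.

Lemma intg_norm f : intg f -> intg (fun w => `|f w|).
Proof. exact: integrable_norm. Qed.

Lemma intg_normP f : measurable_fun setT f -> intg (fun w => `|f w|) -> intg f.
Proof. by move=> mf fi; apply: intg_le mf fi _. Qed.

Lemma intgMb f h c : intg f -> measurable_fun setT h ->
  (forall w, `|h w| <= c) -> intg (fun w => h w * f w).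
Proof.
move=> fi mh hc.
apply: (intg_le (g := fun w => c * `|f w|)); last first.
- by move=> w; rewrite normrM ler_wpM2r.
- exact/intgZ/intg_norm.
- by apply: measurable_funM => //; exact: intg_meas.
Qed.

Lemma intg_indic A : measurable A -> intg (\1_A).
Proof.
move=> mA; apply: (intg_le (g := fun=> 1)); [|exact: intg_cst|].
- exact: measurable_indic.
- by move=> w; rewrite indicE; case: (_ \in _); rewrite ?normr1 ?normr0.
Qed.

Lemma ExE f : intg f -> (\int[P]_w (f w)%:E)%E = (Ex f)%:E.
Proof. by move=> fi; rewrite /Ex /Rintegral fineK//; exact: integrable_fin_num. Qed.

Lemma eq_Ex f g : f =1 g -> Ex f = Ex g.
Proof. by move=> fg; apply: eq_Rintegral => w _. Qed.

Lemma ExD f g : intg f -> intg g -> Ex (fun w => f w + g w) = Ex f + Ex g.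
Proof. by move=> fi gi; rewrite /Ex RintegralD. Qed.

Lemma ExZ c f : intg f -> Ex (fun w => c * f w) = c * Ex f.
Proof. by move=> fi; rewrite /Ex RintegralZl. Qed.

Lemma ExN f : intg f -> Ex (fun w => - f w) = - Ex f.
Proof.
move=> fi; rewrite -mulN1r -ExZ//; apply: eq_Ex => w; by rewrite mulN1r.
Qed.

Lemma ExB f g : intg f -> intg g -> Ex (fun w => f w - g w) = Ex f - Ex g.
Proof. by move=> fi gi; rewrite ExD ?ExN//; exact: intgN. Qed.

Lemma Ex_cst c : Ex (fun=> c) = c.
Proof.
rewrite /Ex Rintegral_cst//.
by have -> : fine (P setT) = 1 :> R; [rewrite probability_setT|rewrite mulr1].
Qed.

Lemma Ex_sum (I : Type) (s : seq I) (F : I -> T -> R) :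
  (forall i, intg (F i)) ->
  Ex (fun w => \sum_(i <- s) F i w) = \sum_(i <- s) Ex (F i).
Proof.
move=> Fi; elim: s => [|i s IH].
  by rewrite big_nil -[RHS](Ex_cst 0); apply: eq_Ex => w; rewrite big_nil.
rewrite big_cons -IH -ExD//; last exact: intg_sum.
by apply: eq_Ex => w; rewrite big_cons.
Qed.

Lemma Ex_le f g : intg f -> intg g -> (forall w, f w <= g w) -> Ex f <= Ex g.
Proof. by move=> fi gi fg; apply: le_Rintegral. Qed.

Lemma Ex_ge0 f : (forall w, 0 <= f w) -> 0 <= Ex f.
Proof. by move=> f0; apply: Rintegral_ge0. Qed.

Lemma Ex_norm f : intg f -> `|Ex f| <= Ex (fun w => `|f w|).
Proof. by move=> fi; apply: le_normr_Rintegral. Qed.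

Lemma Ex_indic A : measurable A -> (Ex (\1_A))%:E = P A.
Proof.
move=> mA; rewrite -ExE; last exact: intg_indic.
by rewrite integral_indic// setIT.
Qed.

Lemma ae_eq_Ex f g : measurable_fun setT f -> measurable_fun setT g ->
  {ae P, forall w, f w = g w} -> Ex f = Ex g.
Proof.
move=> mf mg fg; rewrite /Ex /Rintegral; congr fine.
apply: ae_eq_integral => //; [exact/measurable_EFinP|exact/measurable_EFinP|].
by apply: filterS fg => w /= -> .
Qed.

Lemma ge0_intg f : measurable_fun setT f -> (forall w, 0 <= f w) ->
  (\int[P]_w (f w)%:E < +oo)%E -> intg f.
Proof.
move=> mf f0 ff; apply/integrableP; split; first exact/measurable_EFinP.
rewrite (eq_integral (fun w => (f w)%:E))// => w _ /=.
by rewrite ger0_norm.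
Qed.

Lemma Ex_markov f c : intg f -> (forall w, 0 <= f w) -> 0 < c ->
  c * fine (P [set w | c <= f w]) <= Ex f.
Proof.
move=> fi f0 c0.
have mA : measurable [set w | c <= f w].
  rewrite -[X in measurable X]setTI.
  by apply: (measurable_fun_le measurableT (measurable_cst c) (intg_meas fi)).
rewrite -Ex_indic//= -ExZ; last exact: intg_indic.
apply: Ex_le => //; first exact/intgZ/intg_indic.
move=> w; rewrite indicE; have [cf|cf] := boolP (c <= f w).
- by rewrite mem_set ?mulr1.
- by rewrite memNset ?mulr0//= => cf'; rewrite cf' in cf.
Qed.

End RealExpectation.

(** * Independence from a finite past *)

Section IndependentProducts.
Context (d : measure_display) (T : measurableType d) (R : realType).
Variable P : probability T R.
Implicit Types (W Z : T -> R).

Definition indep_pair W Z := forall A B : set R, measurable A -> measurable B ->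
  P (W @^-1` A `&` Z @^-1` B) = (P (W @^-1` A) * P (Z @^-1` B))%E.

(** On rectangles the joint law of the pair agrees with the product of the marginal laws, hence it
    is the product measure, and Tonelli separates the two integrals. *)
Lemma ge0_indep_integralM (W Z : {mfun T >-> R}) :
  (forall w, 0 <= W w) -> (forall w, 0 <= Z w) -> indep_pair W Z ->
  (\int[P]_w (W w * Z w)%:E = \int[P]_w (W w)%:E * \int[P]_w (Z w)%:E)%E.
Proof.
move=> W0 Z0 WZ.
pose J w := (W w, Z w).
have mJ : measurable_fun setT J by exact: measurable_fun_pair.
pose J' : {mfun T >-> (R * R)%type} := mfun_Sub (mem_set mJ).
(* The absolute values make the integrand nonnegative on the whole plane; on the range of [J] they
   change nothing. *)
pose f (x : R * R) := (`|x.1| * `|x.2|)%:E : \bar R.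
have mf : measurable_fun setT f.
  apply/measurable_EFinP; apply: measurable_funM; apply: measurableT_comp => //.
have f0 x : (0 <= f x)%E by rewrite lee_fin mulr_ge0.
have -> : (\int[P]_w (W w * Z w)%:E = \int[distribution P J']_x f x)%E.
  rewrite ge0_integral_distribution//; apply: eq_integral => w _.
  by rewrite /f /= !ger0_norm.
rewrite (eq_measure_integral (distribution P W \x distribution P Z)%E); last first.
  move=> A mA _; apply/esym/product_measure_unique => //.
rewrite fubini_tonelli1//.
have nE (V : {mfun T >-> R}) : (forall w, 0 <= V w) ->
    (\int[distribution P V]_y `|y|%:E = \int[P]_w (V w)%:E)%E.
  move=> V0; rewrite ge0_integral_distribution//; last exact/measurable_EFinP.
  by apply: eq_integral => w _; rewrite /= ger0_norm.
rewrite /fubini_F -(nE W)// -(nE Z)//.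
transitivity (\int[distribution P W]_x (`|x|%:E * (\int[distribution P Z]_y `|y|%:E)))%E.
  apply: eq_integral => x _ /=; rewrite -ge0_integralZl//.
  exact/measurable_EFinP.
by rewrite ge0_integralZr//; [exact/measurable_EFinP|exact: integral_ge0].
Qed.

Lemma indep_pair_comp (W Z : T -> R) (f g : R -> R) :
  measurable_fun setT f -> measurable_fun setT g ->
  indep_pair W Z -> indep_pair (f \o W) (g \o Z).
Proof.
move=> mf mg WZ A B mA mB; apply: (WZ (f @^-1` A) (g @^-1` B)).
- by rewrite -[X in measurable X]setTI; exact: mf.
- by rewrite -[X in measurable X]setTI; exact: mg.
Qed.

Lemma ge0_indep_ExM W Z : intg P W -> intg P Z -> (forall w, 0 <= W w) ->
  (forall w, 0 <= Z w) -> indep_pair W Z ->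
  intg P (fun w => W w * Z w) /\ Ex P (fun w => W w * Z w) = Ex P W * Ex P Z.
Proof.
move=> Wi Zi W0 Z0 WZ.
have mW := intg_meas Wi; have mZ := intg_meas Zi.
have := @ge0_indep_integralM (mfun_Sub (mem_set mW)) (mfun_Sub (mem_set mZ)) W0 Z0 WZ.
rewrite /= (ExE Wi) (ExE Zi) => E.
have WZi : intg P (fun w => W w * Z w).
  apply: ge0_intg; [exact: measurable_funM|by move=> w; exact: mulr_ge0|].
  by rewrite E ltry.
by split => //; move: E; rewrite (ExE WZi) => -[].
Qed.

(** Positive and negative parts are functions of one variable each, so independence passes to the
    four products into which [W Z] splits. *)
Lemma indep_ExM W Z : intg P W -> intg P Z -> indep_pair W Z ->
  intg P (fun w => W w * Z w) /\ Ex P (fun w => W w * Z w) = Ex P W * Ex P Z.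
Proof.
move=> Wi Zi WZ.
pose pos (x : R) := Num.max x 0; pose neg (x : R) := Num.max (- x) 0.
have posneg x : x = pos x - neg x.
  rewrite /pos /neg; case: (leP x 0) => x0; case: (leP (- x) 0) => x0' //; lra.
have mpos : measurable_fun setT pos by exact: measurable_maxr.
have mneg : measurable_fun setT neg by apply: measurable_maxr => //; exact: oppr_measurable.
have pos0 x : 0 <= pos x by rewrite /pos le_max lexx orbT.
have neg0 x : 0 <= neg x by rewrite /neg le_max lexx orbT.
have posle x : pos x <= `|x| by rewrite /pos ge_max ler_norm normr_ge0.
have negle x : neg x <= `|x| by rewrite /neg ge_max -normrN ler_norm normr_ge0.
have posi f : intg P f -> intg P (pos \o f).
  move=> fi; apply: intg_le (intg_norm fi) _ => [|w].
    by apply: measurableT_comp => //; exact: intg_meas fi.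
  by rewrite /= ger0_norm.
have negi f : intg P f -> intg P (neg \o f).
  move=> fi; apply: intg_le (intg_norm fi) _ => [|w].
    by apply: measurableT_comp => //; exact: intg_meas fi.
  by rewrite /= ger0_norm.
have [pp ppE] := ge0_indep_ExM (posi _ Wi) (posi _ Zi) (fun w => pos0 _) (fun w => pos0 _) (indep_pair_comp mpos mpos WZ).
have [pn pnE] := ge0_indep_ExM (posi _ Wi) (negi _ Zi) (fun w => pos0 _) (fun w => neg0 _) (indep_pair_comp mpos mneg WZ).
have [np npE] := ge0_indep_ExM (negi _ Wi) (posi _ Zi) (fun w => neg0 _) (fun w => pos0 _) (indep_pair_comp mneg mpos WZ).
have [nn nnE] := ge0_indep_ExM (negi _ Wi) (negi _ Zi) (fun w => neg0 _) (fun w => neg0 _) (indep_pair_comp mneg mneg WZ).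
have E : (fun w => W w * Z w) =1 (fun w => (((pos \o W) w * (pos \o Z) w
   - (pos \o W) w * (neg \o Z) w) - (neg \o W) w * (pos \o Z) w)
   + (neg \o W) w * (neg \o Z) w).
  by move=> w; rewrite {1}(posneg (W w)) {1}(posneg (Z w)) /=; ring.
have i1 := intgB pp pn; have i2 := intgB i1 np; have i3 := intgD i2 nn.
split; first exact: eq_intg (fsym E) i3.
rewrite (eq_Ex P E) ExD// ExB// ExB// ppE pnE npE nnE.
have WE : Ex P W = Ex P (pos \o W) - Ex P (neg \o W).
  by rewrite -ExB; [exact: eq_Ex|exact: posi|exact: negi].
have ZE : Ex P Z = Ex P (pos \o Z) - Ex P (neg \o Z).
  by rewrite -ExB; [exact: eq_Ex|exact: posi|exact: negi].
by rewrite WE ZE; ring.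
Qed.

End IndependentProducts.

(* [bigcap_seq] for index types without choice. *)
Lemma bigcap_eqseq (I : eqType) (T : Type) (s : seq I) (C : I -> set T) :
  \bigcap_(i in [set` s]) C i = \big[setI/setT]_(i <- s) C i.
Proof.
elim: s => [|j s IH]; first by rewrite big_nil; apply/seteqP; split.
rewrite big_cons -IH; apply/seteqP; split => [w Cw|w [Cj Cw] i /=].
  split; first by apply: Cw; rewrite /= mem_head.
  by move=> i /= si; apply: Cw; rewrite /= inE si orbT.
by rewrite inE => /predU1P[->//|]; exact: Cw.
Qed.

(** * Sigma-algebras generated by finitely many inputs *)

Section GeneratedPast.
Context (d : measure_display) (T : measurableType d) (R : realType).
Variable P : probability T R.
Variables (I : eqType) (D : set I) (F : I -> set_system T).
Hypothesis F_measurable : forall i, F i `<=` measurable.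
Hypothesis F_setT : forall i, F i setT.
Hypothesis F_setI : forall i, setI_closed (F i).

(** The cylinder events. They form a pi-system, and they are the sets on which the product rule of
    mutual independence speaks directly. *)
Definition past_pi (J : seq I) : set_system T :=
  [set A | exists2 B : I -> set T, (forall i, i \in J -> F i (B i)) &
     A = \bigcap_(i in [set` J]) B i].

(** The sample space itself, re-equipped with the smaller sigma-algebra: being determined by the
    inputs of [J] becomes ordinary measurability, and every closure property of measurable functions
    applies. *)
Definition past (J : seq I) : Type := g_sigma_algebraType (past_pi J).

Lemma past_pi_setI J : setI_closed (past_pi J).
Proof.
move=> _ _ [B FB ->] [C FC ->]; exists (fun i => B i `&` C i).
  by move=> i iJ; apply: F_setI; [exact: FB|exact: FC].
by rewrite bigcapI.
Qed.

Lemma past_pi_setT J : past_pi J setT.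
Proof.
by exists (fun=> setT) => //; rewrite bigcapT.
Qed.

Lemma past_pi_measurable J : past_pi J `<=` measurable.
Proof.
move=> _ [B FB ->]; apply: fin_bigcap_measurable => //.
by move=> i /= iJ; apply: F_measurable; apply: FB.
Qed.

Lemma sub_past_pi J J' : {subset J <= J'} -> past_pi J `<=` past_pi J'.
Proof.
move=> JJ' _ [B FB ->]; exists (fun i => if i \in J then B i else setT).
  by move=> i _; case: ifPn => // iJ; exact: FB.
apply/seteqP; split => w Hw i /= iJ.
  by case: ifPn => // iJ'; exact: Hw.
by have := Hw i (JJ' _ iJ); rewrite /= iJ.
Qed.

Lemma past_measurable J (A : set T) : <<s past_pi J >> A -> measurable A.
Proof.
apply: (smallest_sub (sigma_algebra_measurable T)).
exact: past_pi_measurable.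
Qed.

Lemma sub_past J J' (A : set T) : {subset J <= J'} ->
  <<s past_pi J >> A -> <<s past_pi J' >> A.
Proof.
move=> JJ'; apply: (sub_smallest2r (smallest_sigma_algebra setT _)).
exact: sub_past_pi.
Qed.

Lemma past_gen J i (A : set T) : i \in J -> F i A -> <<s past_pi J >> A.
Proof.
move=> iJ FA; apply: sub_sigma_algebra.
exists (fun j => if j == i then A else setT).
  by move=> j _; case: eqP => [->|].
apply/seteqP; split => [w Aw j /= _|w]; first by case: eqP.
by move=> /(_ i iJ); rewrite eqxx.
Qed.

Lemma past_meas (d' : measure_display) (E : measurableType d') J (f : T -> E) :
  measurable_fun (setT : set (past J)) f -> measurable_fun setT f.
Proof.
move=> mf _ A mA; apply: (@past_measurable J).
exact: (mf measurableT A mA).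
Qed.

Lemma past_measS (d' : measure_display) (E : measurableType d') J J' (f : T -> E) :
  {subset J <= J'} -> measurable_fun (setT : set (past J)) f ->
  measurable_fun (setT : set (past J')) f.
Proof.
move=> JJ' mf _ A mA; apply: (sub_past JJ').
exact: (mf measurableT A mA).
Qed.

(** Uniqueness of measures on a pi-system: [A |-> P (A]&[B)] and [A |-> P B * P A] are finite
    measures that agree on cylinders, hence on the sigma-algebra that these generate. *)
Lemma past_indep J i (A B : set T) : mutually_independent P D F ->
  uniq (i :: J) -> (forall j, j \in i :: J -> D j) ->
  <<s past_pi J >> A -> F i B -> P (A `&` B) = (P A * P B)%E.
Proof.
move=> indep /= /andP[iJ uJ] DJ pA FB.
have mB := F_measurable FB.
have PBfin : P B \is a fin_num by exact: fin_num_measure.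
(* A measure can be scaled by a nonnegative real, so [P B] is first brought into that form. *)
have [b bE] : exists b : {nonneg R}, P B = b%:num%:E.
  have b0 : 0 <= fine (P B) by exact: fine_ge0.
  by exists (NngNum b0); rewrite /= fineK.
rewrite bE muleC.
have := @g_sigma_algebra_measure_unique _ R T (past_pi J) (@past_pi_measurable J)
  (fun=> setT) (fun=> past_pi_setT J) _ (mrestr P mB) (mscale b P)
  (@past_pi_setI J) _ _ A pA.
apply.
- by rewrite bigcup_const.
- move=> _ [C FC ->]; rewrite /= /mscale -[mrestr _ _ _]/(P (_ `&` B)).
  rewrite -bE.
  (* The event [B] is inserted at the index [i], which is not in [J]; the product rule is then used
     twice, on [i :: J] and on [J]. *)
  pose C' j := if j == i then B else C j.
  have C'i : C' i = B by rewrite /C' eqxx.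
  have C'J j : j \in J -> C' j = C j.
    by move=> jJ; rewrite /C'; case: eqP => // ji; rewrite -ji jJ in iJ.
  have := indep (i :: J) C'; rewrite /= iJ uJ => /(_ isT).
  rewrite !big_cons C'i (eq_big_seq _ C'J).
  rewrite (eq_big_seq (fun j => P (C j))) => [|j jJ]; last by rewrite C'J.
  move=> /(_ _)/wrap[j|]; last first.
    rewrite bigcap_eqseq setIC => ->; congr (_ * _)%E.
    apply/esym/indep => // j jJ; split; last exact: FC.
    by apply: DJ; rewrite inE jJ orbT.
  rewrite inE => jiJ; split; first by apply: DJ; rewrite inE.
  by rewrite /C'; case: eqP jiJ => [->//|_ /= jJ]; exact: FC.
- move=> _; apply: (@le_lt_trans _ _ 1%E); last exact: ltry.
  exact: (@probability_le1 _ _ _ P (setT `&` B) (measurableI _ _ measurableT mB)).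
Qed.

End GeneratedPast.

(** * One step of the walk *)

Section OneStep.
Context (d : measure_display) (T : measurableType d) (R : realType).
Variable P : probability T R.

Lemma same_law_Ex (Y Z : {RV P >-> R}) (h : R -> R) : same_law Y Z ->
  measurable_fun setT h -> intg P (h \o Z) ->
  intg P (h \o Y) /\ Ex P (h \o Y) = Ex P (h \o Z).
Proof.
move=> YZ mh hZ.
have nE : (\int[P]_w `|(h (Y w))%:E| = \int[P]_w `|(h (Z w))%:E|)%E.
  rewrite -(@ge0_integral_distribution _ _ _ _ _ P Y (fun y => `|(h y)%:E|%E))//; last first.
    by apply/measurableT_comp => //; exact/measurable_EFinP.
  rewrite -(@ge0_integral_distribution _ _ _ _ _ P Z (fun y => `|(h y)%:E|%E))//; last first.
    by apply/measurableT_comp => //; exact/measurable_EFinP.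
  by apply: eq_measure_integral => A mA _; exact: YZ.
have hY : intg P (h \o Y).
  apply/integrableP; split; first exact/measurable_EFinP/measurableT_comp.
  by rewrite /= nE; have [] := integrableP _ _ _ hZ.
split => //; rewrite /Ex /Rintegral; congr fine.
rewrite -(@integral_distribution _ _ _ _ _ P Y (fun y => (h y)%:E))//; last exact/measurable_EFinP.
rewrite -(@integral_distribution _ _ _ _ _ P Z (fun y => (h y)%:E))//; last exact/measurable_EFinP.
by apply: eq_measure_integral => A mA _; exact: YZ.
Qed.

Variables (p : R) (X xi : {RV P >-> R}).
Variables (Xs : nat -> {RV P >-> R}) (eps : nat -> {RV P >-> bool})
  (U : nat -> {RV P >-> nat}) (xis : nat -> {RV P >-> R}).
Hypothesis inputs : rwes_inputs Xs eps U xis p X xi.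

Local Notation sig := (rwes_sigma Xs eps U xis).
Local Notation x := (echoed_step Xs eps U xis).

Lemma rwes_sigma_measurable i : sig i `<=` measurable.
Proof.
by case: i => [[n|n]|[n|n]] _ [B mB <-] /=; exact: measurable_funPTI.
Qed.

Lemma rwes_sigma_setT i : sig i setT.
Proof. by case: i => [[n|n]|[n|n]]; exists setT => //; exact: measurableT. Qed.

Lemma rwes_sigma_setI i : setI_closed (sig i).
Proof.
by case: i => [[n|n]|[n|n]] _ _ [B mB <-] [C mC <-]; exists (B `&` C) => //; exact: measurableI.
Qed.

Definition index_rank (i : rwes_index) : nat :=
  match i with inl (inl n) => n | inl (inr n) => n
             | inr (inl n) => n | inr (inr n) => n end.

(** The inputs that determine the first [n] steps. The list [iota 2 n.-1] is [2, ..., n]: the first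
    step uses a spin only. *)
Definition history (n : nat) : seq rwes_index :=
  [seq inl (inl k) | k <- iota 1 n] ++ [seq inl (inr k) | k <- iota 2 n.-1]
  ++ [seq inr (inl k) | k <- iota 2 n.-1] ++ [seq inr (inr k) | k <- iota 2 n.-1].

Lemma mem_history n i : i \in history n -> rwes_domain i /\ (index_rank i <= n)%N.
Proof.
rewrite !mem_cat => /or4P[] /mapP[k]; rewrite mem_iota => /andP[k1 kn] -> /=;
  by split; lia.
Qed.

Lemma history_uniq n : uniq (history n).
Proof.
have inj (f : nat -> rwes_index) m q : injective f -> uniq [seq f k | k <- iota m q].
  by move=> fi; rewrite map_inj_uniq// iota_uniq.
rewrite /history !cat_uniq !inj//=; try by move=> ? ? [].
rewrite !has_cat !negb_or.
by do ! (apply/andP; split => //); apply/hasPn => _ /mapP[k _ ->];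
  apply/negP => /mapP[].
Qed.

Lemma historyS n : {subset history n <= history n.+1}.
Proof.
move=> i; rewrite !mem_cat => /or4P[] /mapP[k]; rewrite mem_iota => /andP[k1 kn] ->.
- by apply/or4P; apply: Or41; apply/map_f; rewrite mem_iota k1 ltnS ltnW.
- apply/or4P; apply: Or42; apply/map_f; rewrite mem_iota k1 /= (leq_trans kn)//.
  by rewrite leq_add2l leq_pred.
- apply/or4P; apply: Or43; apply/map_f; rewrite mem_iota k1 /= (leq_trans kn)//.
  by rewrite leq_add2l leq_pred.
- apply/or4P; apply: Or44; apply/map_f; rewrite mem_iota k1 /= (leq_trans kn)//.
  by rewrite leq_add2l leq_pred.
Qed.

Lemma history_le m n : (m <= n)%N -> {subset history m <= history n}.
Proof.
elim: n => [|n IH]; first by rewrite leqn0 => /eqP ->.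
rewrite leq_eqVlt => /predU1P[->//|]; rewrite ltnS => /IH mn i /mn.
exact: historyS.
Qed.

Definition known (J : seq rwes_index) (f : T -> R) : Prop :=
  measurable_fun (setT : set (past sig J)) f.

Lemma known_meas J f : known J f -> measurable_fun setT f.
Proof. exact: (past_meas rwes_sigma_measurable). Qed.

Lemma known_cst J c : known J (fun=> c).
Proof. exact: measurable_cst. Qed.

Lemma knownD J f g : known J f -> known J g -> known J (fun w => f w + g w).
Proof. by move=> kf kg; exact: measurable_funD. Qed.

Lemma knownB J f g : known J f -> known J g -> known J (fun w => f w - g w).
Proof. by move=> kf kg; exact: measurable_funB. Qed.

Lemma knownM J f g : known J f -> known J g -> known J (fun w => f w * g w).
Proof. by move=> kf kg; exact: measurable_funM. Qed.

Lemma known_comp J (h : R -> R) f : measurable_fun setT h -> known J f ->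
  known J (fun w => h (f w)).
Proof. by move=> mh kf; exact: (measurableT_comp mh). Qed.

Lemma known_sub J J' f : {subset J <= J'} -> known J f -> known J' f.
Proof. exact: (past_measS rwes_sigma_setT). Qed.

(** A fresh input factors out of an expectation. Every appeal to independence in the sequel goes
    through this statement. *)
Lemma known_ExM J i (W Z : T -> R) : uniq (i :: J) ->
  (forall j, j \in i :: J -> rwes_domain j) -> known J W ->
  (forall B : set R, measurable B -> sig i (Z @^-1` B)) ->
  intg P W -> intg P Z ->
  intg P (fun w => W w * Z w) /\ Ex P (fun w => W w * Z w) = Ex P W * Ex P Z.
Proof.
move=> uJ DJ mW mZ Wi Zi; apply: indep_ExM => // A B mA mB.
apply: (past_indep rwes_sigma_measurable rwes_sigma_setT rwes_sigma_setI
  (inputs_independent inputs) uJ DJ) => //; last exact: mZ.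
by have := mW measurableT A mA; rewrite setTI.
Qed.

Lemma known_rv J i (f : T -> R) : i \in J ->
  (forall B : set R, measurable B -> sig i (f @^-1` B)) -> known J f.
Proof.
move=> iJ sf _ B mB; rewrite setTI.
exact: (past_gen rwes_sigma_setT iJ (sf _ mB)).
Qed.

Lemma spin_sig n (g : R -> R) : measurable_fun setT g ->
  forall B : set R, measurable B -> sig (inl (inl n)) ((g \o Xs n) @^-1` B).
Proof.
move=> mg B mB; exists (g @^-1` B) => //=.
by rewrite -[X in measurable X]setTI; exact: mg.
Qed.

Lemma coin_sig n (g : bool -> R) :
  forall B : set R, measurable B -> sig (inl (inr n)) ((g \o eps n) @^-1` B).
Proof. by move=> B mB; exists (g @^-1` B). Qed.

Lemma index_sig n (g : nat -> R) :
  forall B : set R, measurable B -> sig (inr (inl n)) ((g \o U n) @^-1` B).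
Proof. by move=> B mB; exists (g @^-1` B). Qed.

Lemma echo_sig n (g : R -> R) : measurable_fun setT g ->
  forall B : set R, measurable B -> sig (inr (inr n)) ((g \o xis n) @^-1` B).
Proof.
move=> mg B mB; exists (g @^-1` B) => //=.
by rewrite -[X in measurable X]setTI; exact: mg.
Qed.

(** Compares list positions, exactly as the lookup in [echoed_steps] does. As a consequence the
    value 0 of [U n] is read as 1, an event that [parent_Ex] shows to be null. *)
Definition parent n k (w : T) : R := ((U n w).-1 == k.-1)%:R.

(** Valid at every sample point, with no exceptional set. The condition [h 0 = 0] matches the
    default value 0 of the lookup when the index is out of range. *)
Lemma echoed_stepS (h : R -> R) n w : h 0 = 0 ->
  h (x n.+2 w) = (1 - (eps n.+2 w)%:R) * h (Xs n.+2 w) +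
    \sum_(1 <= k < n.+2) (eps n.+2 w)%:R * (parent n.+2 k w * h (xis n.+2 w * x k w)).
Proof.
move=> h0; rewrite /echoed_step echoed_stepsSS nth_rcons size_echoed_steps ltnn eqxx /parent.
case: (eps n.+2 w); last first.
  rewrite subr0 !mul1r !mul0r addr0 big1 ?addr0// => k _.
  by rewrite mul0r.
rewrite subrr !mul0r !add0r mul1r.
set u := (U n.+2 w).-1.
(* Beyond the end of the list the lookup returns 0, and at the same time no [k] of the sum matches
   the index. *)
have [un|un] := ltnP u n.+1; last first.
  rewrite nth_default ?size_echoed_steps// mulr0 h0 big_nat big1// => k /andP[k1 kn].
  rewrite gtn_eqF ?mul0r ?mulr0//; apply: leq_trans un; by case: k k1 kn.
rewrite (bigD1_seq u.+1); [|by rewrite mem_index_iota|exact: iota_uniq].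
have -> : (u == u.+1.-1) = true by exact: eqxx.
rewrite big_nat_cond [X in _ = _ + X]big1 => [|k /andP[/andP[k1 kn] ku]]; last first.
  rewrite (_ : (u == k.-1) = false) ?mul0r ?mulr0//.
  by apply/negbTE; apply: contra ku => /eqP ->; rewrite prednK.
by rewrite addr0 !mul1r -[in LHS](succnK u) nth_echoed_steps.
Qed.

Lemma known_parent J n k : inr (inl n) \in J -> known J (parent n k).
Proof.
move=> nJ; apply: (known_rv nJ) => B mB.
exact: (@index_sig n (fun u => (u.-1 == k.-1)%:R) B mB).
Qed.

Lemma known_coin J n : inl (inr n) \in J -> known J (fun w => (eps n w)%:R).
Proof. by move=> nJ; apply: (known_rv nJ) => B mB; exact: (@coin_sig n (fun b => b%:R) B mB). Qed.

Lemma known_spin J n : inl (inl n) \in J -> known J (Xs n).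
Proof. by move=> nJ; apply: (known_rv nJ) => B mB; exact: (@spin_sig n id (@measurable_id _ _ _) B mB). Qed.

Lemma known_echo J n : inr (inr n) \in J -> known J (xis n).
Proof. by move=> nJ; apply: (known_rv nJ) => B mB; exact: (@echo_sig n id (@measurable_id _ _ _) B mB). Qed.

Lemma history_new n : (2 <= n)%N ->
  [/\ inl (inl n) \in history n, inl (inr n) \in history n,
      inr (inl n) \in history n & inr (inr n) \in history n].
Proof.
move=> n2; rewrite !mem_cat.
have m2 : n \in iota 2 n.-1 by rewrite mem_iota n2/= -subn1 addnBA ?addnK ?leqnn//; case: n n2.
have m1 : n \in iota 1 n by rewrite mem_iota; case: n n2 {m2} => //= n _; rewrite add1n ltnS leqnn.
by rewrite !map_f ?orbT.
Qed.

Lemma known_sum J (s : seq nat) (F : nat -> T -> R) :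
  (forall k, k \in s -> known J (F k)) -> known J (fun w => \sum_(k <- s) F k w).
Proof.
elim: s => [|k s IH] FJ.
  rewrite (_ : (fun _ => _) = cst 0) ?/known//.
  by apply/funext => w; rewrite big_nil.
rewrite (_ : (fun _ => _) = (fun w => F k w + \sum_(k <- s) F k w)); last first.
  by apply/funext => w; rewrite big_cons.
apply: measurable_funD; first by apply: FJ; rewrite mem_head.
by apply: IH => j js; apply: FJ; rewrite inE js orbT.
Qed.

Lemma known_step n k : (1 <= k <= n)%N -> known (history n) (x k).
Proof.
elim/ltn_ind: k n => -[//|[|k]] IH n /andP[_ kn].
  apply: (@known_spin _ 1%N); rewrite mem_cat; apply/orP; left.
  by apply: map_f; rewrite mem_iota /=; case: n kn.
have [h1 h2 h3 h4] := @history_new k.+2 isT.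
have sub := history_le kn.
rewrite (_ : x k.+2 = fun w => (1 - (eps k.+2 w)%:R) * Xs k.+2 w +
    \sum_(1 <= j < k.+2) (eps k.+2 w)%:R * (parent k.+2 j w * (xis k.+2 w * x j w))); last first.
  by apply/funext => w; rewrite (@echoed_stepS id).
apply: knownD.
  apply: knownM; last by apply: (@known_spin _ k.+2); exact: sub.
  by apply: knownB; [exact: known_cst|apply: (@known_coin _ k.+2); exact: sub].
apply: known_sum => j; rewrite mem_index_iota => /andP[j1 jk].
apply: knownM; first by apply: (@known_coin _ k.+2); exact: sub.
apply: knownM; first by apply: (@known_parent _ k.+2); exact: sub.
apply: knownM; first by apply: (@known_echo _ k.+2); exact: sub.
by apply: IH => //; rewrite j1 (leq_trans _ kn)// ltnW.
Qed.

Lemma meas_step k : (1 <= k)%N -> measurable_fun setT (x k).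
Proof. by move=> k1; apply: (@known_meas (history k)); apply: known_step; rewrite k1 leqnn. Qed.

Lemma coin_Ex n : (2 <= n)%N ->
  intg P (fun w => (eps n w)%:R) /\ Ex P (fun w => (eps n w)%:R) = p.
Proof.
move=> n2; have mE : measurable [set w | eps n w = true].
  exact: (@measurable_funPTI _ _ _ _ (eps n) [set true]).
have E : (fun w => (eps n w)%:R) =1 (\1_[set w | eps n w = true] : T -> R).
  move=> w; rewrite indicE; have [e|/negP e] := boolP (eps n w).
    by rewrite (mem_set (e : [set w | eps n w = true] w)).
  by rewrite (memNset (e : ~ [set w | eps n w = true] w)).
split; first by apply: eq_intg (fsym E) _; exact: intg_indic.
have := Ex_indic P mE; rewrite -(eq_Ex P E) (coins_law inputs n2).
by move=> [].
Qed.

(** The prescribed probabilities of the values [1, ..., n.+1] already add up to 1, so the value 0,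
    which is counted with [k = 1], has probability zero. *)
Lemma parent_Ex n k : (1 <= k < n.+2)%N ->
  intg P (parent n.+2 k) /\ Ex P (parent n.+2 k) = n.+1%:R^-1.
Proof.
move=> /andP[k1 kn].
pose V := U n.+2; pose one j w : R := (V w == j)%:R.
have oneE j : one j =1 (\1_[set w | V w = j] : T -> R).
  move=> w; rewrite indicE /one; case: eqP => Vj; first by rewrite mem_set.
  by rewrite memNset.
have mV j : measurable [set w | V w = j].
  exact: (@measurable_funPTI _ _ _ _ V [set j]).
have onei j : intg P (one j) by apply: eq_intg (fsym (oneE j)) _; exact: intg_indic.
have oneEx j : (1 <= j < n.+2)%N -> Ex P (one j) = n.+1%:R^-1.
  move=> jn; have := Ex_indic P (mV j).
  by rewrite -(eq_Ex P (oneE j)) (indices_law inputs)// => -[].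
have one0 : Ex P (one 0%N) = 0.
  apply/eqP; rewrite eq_le; apply/andP; split; last by apply: Ex_ge0 => w; exact: ler0n.
  have : Ex P (fun w => one 0%N w + \sum_(1 <= j < n.+2) one j w) <= Ex P (fun=> 1).
    apply: Ex_le; [apply: intgD => //; exact: intg_sum|exact: intg_cst|].
    move=> w; rewrite /one.
    have -> : (V w == 0%N)%:R + \sum_(1 <= j < n.+2) (V w == j)%:R =
      \sum_(0 <= j < n.+2) (V w == j)%:R :> R by rewrite [RHS]big_ltn.
    have [Vn|Vn] := ltnP (V w) n.+2.
      rewrite (bigD1_seq (V w)) ?mem_index_iota ?iota_uniq//= eqxx big1 ?addr0//.
      by move=> j /negbTE jV; rewrite eq_sym jV.
    rewrite big_nat big1// => j /andP[_ jn].
    by rewrite gtn_eqF// (leq_trans jn).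
  rewrite ExD//; last exact: intg_sum.
  rewrite Ex_sum// Ex_cst big_nat (eq_bigr (fun=> n.+1%:R^-1)) => [|j jn]; last exact: oneEx.
  rewrite -big_nat sumr_const_nat subn1 /= -[_ *+ n.+1]mulr_natl divff ?pnatr_eq0//.
  lra.
have parE : parent n.+2 k =1 fun w => one k w + (k == 1%N)%:R * one 0%N w.
  move=> w; rewrite /parent /one -/V; case: (V w) => [|v] /=.
    case: k k1 kn => //= -[|k] _ _; by rewrite ?mulr1 ?add0r ?mul0r ?addr0.
  by case: k k1 kn => //= k _ _; rewrite eqSS mulr0 addr0.
split; first by apply: eq_intg (fsym parE) _; apply: intgD => //; exact: intgZ.
rewrite (eq_Ex P parE) ExD//; last exact: intgZ.
by rewrite ExZ// one0 mulr0 addr0 oneEx// k1.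
Qed.

(** Conditioning on the first [n.+1] steps, tested against [W]. The function [h] need not be
    multiplicative, so the echoed terms are kept as they are and their integrability is a
    hypothesis; this generality is needed for [constant_step] and for the capped barrier. *)
Lemma one_step_Ex n (W : T -> R) (h : R -> R) :
  measurable_fun setT h -> h 0 = 0 -> known (history n.+1) W ->
  intg P W -> intg P (h \o X) ->
  (forall k, (1 <= k < n.+2)%N -> intg P (fun w => W w * h (xis n.+2 w * x k w))) ->
  intg P (fun w => W w * h (x n.+2 w)) /\
  Ex P (fun w => W w * h (x n.+2 w)) = (1 - p) * Ex P W * Ex P (h \o X) +
    p / n.+1%:R * \sum_(1 <= k < n.+2) Ex P (fun w => W w * h (xis n.+2 w * x k w)).
Proof.
move=> mh h0 kW Wi hXi Wki.
have n2 : (2 <= n.+2)%N by [].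
have Xfresh J (i : rwes_index) : (forall j, j \in J -> rwes_domain j /\ (index_rank j < index_rank i)%N \/
    (j != i /\ rwes_domain j)) -> uniq J -> rwes_domain i ->
    uniq (i :: J) /\ (forall j, j \in i :: J -> rwes_domain j).
  move=> HJ uJ Di; split => [|j].
    rewrite /= uJ andbT; apply/negP => /HJ[[_]|[]]; by rewrite ?ltnn ?eqxx.
  by rewrite inE => /predU1P[->//|/HJ[[]|[]]].
have hist j : j \in history n.+1 -> rwes_domain j /\ (index_rank j < n.+2)%N.
  by move=> /mem_history.
have [coini coinE] := coin_Ex n2.
have [hXsi hXsE] := same_law_Ex (spins_law inputs (isT : (1 <= n.+2)%N)) mh hXi.
have ncoini : intg P (fun w => 1 - (eps n.+2 w)%:R) by apply: intgB => //; exact: intg_cst.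
have ncoinE : Ex P (fun w => 1 - (eps n.+2 w)%:R) = 1 - p.
  by rewrite ExB ?Ex_cst ?coinE//; exact: intg_cst.
have kn0 : known (inl (inl n.+2) :: history n.+1) (fun w => W w * h (Xs n.+2 w)).
  apply: knownM.
    by apply: known_sub kW => j jJ; rewrite inE jJ orbT.
  by apply: (known_rv (mem_head _ _)) => B mB; exact: (@spin_sig n.+2 h mh B mB).
(* Inputs of step [n.+2] are adjoined to the history one at a time, so that each is independent of
   all those before it: spin then coin for the first term, echo then index then coin for the
   others. *)
have [u1 d1] := @Xfresh (history n.+1) (inl (inl n.+2)) (fun j jJ => or_introl (hist j jJ))
  (history_uniq _) isT.
have [t1i t1E] := known_ExM u1 d1 kW (@spin_sig n.+2 h mh) Wi hXsi.
have [u2 d2] : uniq ((inl (inr n.+2)) :: inl (inl n.+2) :: history n.+1) /\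
    (forall j, j \in (inl (inr n.+2)) :: inl (inl n.+2) :: history n.+1 -> rwes_domain j).
  apply: Xfresh => // j; rewrite inE => /predU1P[->|/hist ?]; [right|left] => //.
have [t2i t2E] := known_ExM u2 d2 kn0 (@coin_sig n.+2 (fun b => 1 - b%:R)) t1i ncoini.
have [u3 d3] := @Xfresh (history n.+1) (inr (inr n.+2)) (fun j jJ => or_introl (hist j jJ))
  (history_uniq _) isT.
have [u4 d4] : uniq ((inr (inl n.+2)) :: inr (inr n.+2) :: history n.+1) /\
    (forall j, j \in (inr (inl n.+2)) :: inr (inr n.+2) :: history n.+1 -> rwes_domain j).
  apply: Xfresh => // j; rewrite inE => /predU1P[->|/hist ?]; [right|left] => //.
have [u5 d5] : uniq ((inl (inr n.+2)) :: inr (inl n.+2) :: inr (inr n.+2) :: history n.+1) /\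
    (forall j, j \in (inl (inr n.+2)) :: inr (inl n.+2) :: inr (inr n.+2) :: history n.+1 -> rwes_domain j).
  apply: Xfresh => // j; rewrite !inE => /or3P[/eqP->|/eqP->|/hist ?]; [right|right|left] => //.
have kW1 k : (1 <= k < n.+2)%N ->
    known (inr (inr n.+2) :: history n.+1) (fun w => W w * h (xis n.+2 w * x k w)).
  move=> kn; have s : {subset history n.+1 <= inr (inr n.+2) :: history n.+1}.
    by move=> j jJ; rewrite inE jJ orbT.
  apply: knownM; first exact: known_sub kW.
  apply: known_comp => //; apply: knownM; first by apply: (@known_echo _ n.+2); exact: mem_head.
  by apply: (known_sub s); apply: known_step.
have kW2 k : (1 <= k < n.+2)%N -> known (inr (inl n.+2) :: inr (inr n.+2) :: history n.+1)
    (fun w => W w * h (xis n.+2 w * x k w) * parent n.+2 k w).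
  move=> kn; apply: knownM; last by apply: (@known_parent _ n.+2); exact: mem_head.
  by apply: known_sub (kW1 _ kn) => j jJ; rewrite inE jJ orbT.
have term k : (1 <= k < n.+2)%N ->
   intg P (fun w => W w * h (xis n.+2 w * x k w) * parent n.+2 k w * (eps n.+2 w)%:R) /\
   Ex P (fun w => W w * h (xis n.+2 w * x k w) * parent n.+2 k w * (eps n.+2 w)%:R) =
   p / n.+1%:R * Ex P (fun w => W w * h (xis n.+2 w * x k w)).
  move=> kn; have [pari parE] := parent_Ex kn.
  have [ai aE] := known_ExM u4 d4 (kW1 _ kn) (@index_sig n.+2 (fun u => (u.-1 == k.-1)%:R))
    (Wki _ kn) pari.
  have [bi bE] := known_ExM u5 d5 (kW2 _ kn) (@coin_sig n.+2 (fun b => b%:R)) ai coini.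
  split => //; rewrite bE aE coinE parE.
  by ring.
(* Extended by zero outside the range of summation, since [intg_sum] asks for integrability at every
   index. *)
pose G k w := if (1 <= k < n.+2)%N then W w * h (xis n.+2 w * x k w) * parent n.+2 k w * (eps n.+2 w)%:R else 0.
have Gi k : intg P (G k).
  have [kn|kn] := boolP (1 <= k < n.+2)%N.
    by have [t _] := term k kn; apply: eq_intg t => w; rewrite /G kn.
  by apply: eq_intg (intg_cst P 0) => w; rewrite /G (negbTE kn).
have E : (fun w => W w * h (x n.+2 w)) =1 (fun w => W w * h (Xs n.+2 w) * (1 - (eps n.+2 w)%:R)
    + \sum_(1 <= k < n.+2) G k w).
  move=> w; rewrite echoed_stepS// mulrDr; congr (_ + _); first by ring.
  rewrite mulr_sumr big_nat [RHS]big_nat; apply: eq_bigr => k kn; rewrite /G kn.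
  by ring.
have Si : intg P (fun w => \sum_(1 <= k < n.+2) G k w) by exact: intg_sum.
split; first by apply: eq_intg (fsym E) _; exact: intgD.
rewrite (eq_Ex P E) ExD// t2E t1E hXsE ncoinE Ex_sum//; congr (_ + _).
  by ring.
rewrite mulr_sumr big_nat [RHS]big_nat; apply: eq_bigr => k kn.
by have [_ <-] := term _ kn; rewrite /G kn.
Qed.

End OneStep.

(** * Power inequalities *)

Section PowerInequalities.
Context (R : realType).
Implicit Types (a b c r s u v x y z : R).

(** Young's inequality for the product [u * 1] with conjugate exponents [r] and [r / (r - 1)],
    rearranged. *)
Lemma bernoulli_ge1 r u : 1 <= r -> 0 <= u -> 1 + r * (u - 1) <= u `^ r.
Proof.
rewrite le_eqVlt => /predU1P[<-|r1] u0; first by rewrite powRr1//; lra.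
have r0 : 0 < r by lra.
have q0 : 0 < r / (r - 1) by rewrite divr_gt0//; lra.
have := @conjugate_powR R u 1 r (r / (r - 1)) u0 ler01 r0 q0.
rewrite powR1 mulr1 invf_div => /(_ _)/wrap[|H]; first by field; lra.
have -> : 1 + r * (u - 1) = r * (u - (r - 1) / r) by field; lra.
rewrite mulrC -ler_pdivlMr// lerBlDr; move: H; by rewrite mul1r.
Qed.

(** From [u^r = exp (r ln u) >= 1 + r ln u] and [ln u <= u - 1], the sign of [r] reversing the
    second inequality. *)
Lemma bernoulli_le0 r u : r <= 0 -> 0 < u -> 1 + r * (u - 1) <= u `^ r.
Proof.
move=> r0 u0; rewrite /powR gt_eqF//.
apply: le_trans (expR_ge1Dx _); rewrite lerD2l.
have : ln u <= u - 1.
  by have := @le_ln1Dx R (u - 1); rewrite addrCA subrr addr0; apply; lra.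
nra.
Qed.

Lemma powR_inv r u : 0 <= u -> u^-1 `^ r = (u `^ r)^-1.
Proof. by move=> u0; rewrite -powR_inv1// -powRrM mulN1r powRN. Qed.

(** Convexity of the power function, obtained by scaling Bernoulli's inequality at [x / y]. *)
Lemma powR_tangent r x y : 1 <= r -> 0 <= x -> 0 < y ->
  y `^ r + r * y `^ (r - 1) * (x - y) <= x `^ r.
Proof.
move=> r1 x0 y0.
have := @bernoulli_ge1 r (x / y) r1 (divr_ge0 x0 (ltW y0)).
have yr : 0 < y `^ r by exact: powR_gt0.
have -> : x `^ r = y `^ r * (x / y) `^ r.
  by rewrite -powRM ?divr_ge0 ?x0 ?(ltW y0)// mulrCA divff ?mulr1// gt_eqF.
rewrite -(ler_pM2l yr); apply: le_trans; rewrite le_eqVlt; apply/orP; left; apply/eqP.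
rewrite -(mulr_powRB1 (ltW y0))//; last lra.
by field; rewrite gt_eqF.
Qed.

Lemma powR_tangent_neg r x y : r <= 0 -> 0 < x -> 0 < y ->
  y `^ r + r * y `^ (r - 1) * (x - y) <= x `^ r.
Proof.
move=> r0 x0 y0.
have := @bernoulli_le0 r (x / y) r0 (divr_gt0 x0 y0).
have yr : 0 < y `^ r by exact: powR_gt0.
have -> : x `^ r = y `^ r * (x / y) `^ r.
  by rewrite -powRM ?divr_ge0 ?(ltW x0) ?(ltW y0)// mulrCA divff ?mulr1// gt_eqF.
rewrite -(ler_pM2l yr); apply: le_trans; rewrite le_eqVlt; apply/orP; left; apply/eqP.
have -> : y `^ r = y `^ (r - 1) * y.
  rewrite -[X in _ = _ * X](powRr1 (ltW y0)) -powRD ?subrK//.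
  by rewrite (gt_eqF y0) implybT.
by field; rewrite gt_eqF.
Qed.

(** Bernoulli's inequality with exponent [- s], at [u] when [u >= 1] and at [1/u] otherwise. The
    summand [2^s] of the constant serves the first case, the summand 2 the second. *)
Lemma powR_near1 s u : 0 < s -> 2^-1 <= u <= 2 ->
  `|u `^ s - 1| <= s * (2 `^ s + 2) * `|u - 1|.
Proof.
move=> s0 /andP[u1 u2]; have u0 : 0 < u by lra.
have us : 0 < u `^ s by exact: powR_gt0.
have [u1'|u1'] := leP 1 u.
  have us1 : 1 <= u `^ s by rewrite -[leLHS](powRr0 u); apply: ler_powR => //; exact: ltW.
  rewrite !ger0_norm ?subr_ge0//.
  have := @bernoulli_le0 (- s) u _ u0; rewrite oppr_le0 (ltW s0) powRN => /(_ isT).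
  rewrite -(ler_pM2l us) divff ?gt_eqF// => H.
  have u2s : u `^ s <= 2 `^ s by apply: ge0_ler_powR; rewrite ?nnegrE//; lra.
  have : u `^ s * (u - 1) <= (2 `^ s + 2) * (u - 1) by rewrite ler_wpM2r; lra.
  nra.
have us1 : u `^ s <= 1.
  by rewrite -[leRHS](powRr0 u); apply: ger_powR; [lra|exact: ltW].
rewrite ler0_norm ?subr_le0// ler0_norm; last by rewrite subr_le0 ltW.
have := @bernoulli_le0 (- s) u^-1 _ _.
rewrite oppr_le0 (ltW s0) invr_gt0 u0 => /(_ isT isT).
rewrite powRN powR_inv ?(ltW u0)// invrK => H.
have H2 : u^-1 - 1 <= 2 * (1 - u).
  have -> : u^-1 - 1 = (1 - u) * u^-1 by rewrite mulrBl mul1r divff ?gt_eqF.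
  have uV2 : u^-1 <= 2 by rewrite -[leRHS]invrK lef_pV2 ?posrE ?invr_gt0.
  by rewrite [leRHS]mulrC ler_wpM2l// subr_ge0 ltW.
have p2 : 0 <= 2 `^ s by exact: powR_ge0.
have : s * (u^-1 - 1) <= s * (2 * (1 - u)) by rewrite ler_wpM2l// ltW.
have : 0 <= s * (2 `^ s * (1 - u)) by rewrite !mulr_ge0 ?subr_ge0 ?ltW// powR_gt0.
lra.
Qed.

(** The signed power; [r * sgpow (r - 1) a] is the derivative of [|a|^r]. *)
Definition sgpow r a := Num.sg a * `|a| `^ r.

Lemma norm_sgpow r a : 0 < r -> `|sgpow r a| = `|a| `^ r.
Proof.
move=> r0; rewrite /sgpow normrM normr_sg.
case: eqP => [->|_]; rewrite ?mul1r ?(ger0_norm (powR_ge0 _ _))//.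
by rewrite normr0 powR0 ?mul0r ?gt_eqF.
Qed.

(** The first summand comes from the regime [|b| <= e |a|], through the Lipschitz constant of
    [u^(r - 1)] on [[1/2, 2]]; the other two come from the regime [|b| > e |a|]. *)
Definition power_expansion_const r :=
  r * ((r - 1) * (2 `^ (r - 1) + 2)) + 2 `^ r + r.

(* Splitting at |b| = e |a| replaces the second order Taylor term, so that one
   estimate serves all exponents r > 1. *)
Lemma power_expansion r a b e : 1 < r -> 0 < e <= 2^-1 ->
  `|a + b| `^ r <= `|a| `^ r + r * sgpow (r - 1) a * b
    + power_expansion_const r * e * (`|a| `^ (r - 1) * `|b|)
    + power_expansion_const r * e `^ (- r) * `|b| `^ r.
Proof.
move=> r1 /andP[e0 e2].
set K := (r - 1) * (2 `^ (r - 1) + 2).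
have K0 : 0 <= K by apply: mulr_ge0; [lra|rewrite addr_ge0 ?powR_ge0].
have p2 : 0 <= 2 `^ r by exact: powR_ge0.
set C := power_expansion_const r.
have CE : C = r * K + 2 `^ r + r by [].
have rK : 0 <= r * K by rewrite mulr_ge0//; lra.
have C0 : 0 <= C by rewrite CE; lra.
have er0 : 0 <= e `^ (- r) by exact: powR_ge0.
have br0 : 0 <= `|b| `^ r by exact: powR_ge0.
have ar0 : 0 <= `|a| `^ (r - 1) * `|b| by rewrite mulr_ge0 ?powR_ge0.
have [bea|bea] := leP `|b| (e * `|a|).
  have [a0|a0] := eqVneq a 0.
    have b0 : b = 0.
      by apply/eqP; rewrite -normr_le0 (le_trans bea)// a0 normr0 mulr0.
    by rewrite a0 b0 addr0 normr0 !powR0 ?mulr0 ?addr0//; lra.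
  have na : 0 < `|a| by rewrite normr_gt0.
  pose u := 1 + b / a.
  have u1 : `|u - 1| = `|b| / `|a| by rewrite /u addrAC subrr add0r normrM normfV.
  have ue : `|u - 1| <= e by rewrite u1 ler_pdivrMr.
  have uint : 2^-1 <= u <= 2.
    move: ue; rewrite ler_norml => /andP[? ?]; apply/andP; split; lra.
  have u0 : 0 < u by case/andP: uint => ? ?; lra.
  have -> : `|a + b| `^ r = `|a| `^ r * u `^ r.
    have -> : a + b = a * u by rewrite /u mulrDr mulr1 mulrCA divff// mulr1.
    by rewrite normrM powRM// (ger0_norm (ltW u0)).
  (* The tangent at [u], evaluated at 1, bounds [u^r] from above; the slope at [u] is then compared
     with the slope at 1. *)
  have T1 : u `^ r <= 1 + r * u `^ (r - 1) * (u - 1).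
    have := @powR_tangent r 1 u (ltW r1) ler01 u0; rewrite powR1; lra.
  have r10 : 0 < r - 1 by lra.
  have T2 := powR_near1 r10 uint.
  have T3 : (u `^ (r - 1) - 1) * (u - 1) <= K * e * `|u - 1|.
    apply: le_trans (ler_norm _) _; rewrite normrM ler_wpM2r//.
    by apply: le_trans T2 _; rewrite ler_wpM2l.
  have T4 : u `^ r <= 1 + r * (u - 1) + r * (K * e * `|u - 1|).
    apply: le_trans T1 _.
    have : r * ((u `^ (r - 1) - 1) * (u - 1)) <= r * (K * e * `|u - 1|).
      by rewrite ler_wpM2l//; lra.
    lra.
  have ar : `|a| `^ r = `|a| `^ (r - 1) * `|a|.
    by rewrite mulrC mulr_powRB1//; lra.
  have T5 : `|a| `^ r * u `^ r <= `|a| `^ r * (1 + r * (u - 1) + r * (K * e * `|u - 1|)).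
    by rewrite ler_wpM2l ?powR_ge0.
  apply: le_trans T5 _.
  have E1 : `|a| `^ r * (u - 1) = sgpow (r - 1) a * b.
    have sga : `|a| * (b / a) = Num.sg a * b.
      by rewrite normrEsg -mulrA (mulrCA a) divff// mulr1.
    by rewrite ar /u addrAC subrr add0r /sgpow -mulrA sga; ring.
  have E2 : `|a| `^ r * `|u - 1| = `|a| `^ (r - 1) * `|b|.
    by rewrite u1 ar -mulrA; congr (_ * _); rewrite mulrCA divff ?mulr1 ?gt_eqF.
  have -> : `|a| `^ r * (1 + r * (u - 1) + r * (K * e * `|u - 1|)) =
    `|a| `^ r + r * (`|a| `^ r * (u - 1)) + r * K * e * (`|a| `^ r * `|u - 1|) by ring.
  rewrite E1 E2.
  have : r * K * e * (`|a| `^ (r - 1) * `|b|) <= C * e * (`|a| `^ (r - 1) * `|b|).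
    by rewrite ler_wpM2r// ler_wpM2r ?(ltW e0)// CE; lra.
  have : 0 <= C * e `^ (- r) * `|b| `^ r by rewrite !mulr_ge0.
  lra.
(* Far regime: [|a|] and [|b|] are both at most [|b| / e], and every term is compared with the power
   [r] of that number. *)
have b0 : 0 < `|b|.
  by apply: le_lt_trans bea; rewrite mulr_ge0// ltW.
have eV : 1 <= e^-1 by rewrite -[leLHS]invr1 lef_pV2 ?posrE//; lra.
have ae : `|a| <= `|b| / e by rewrite ler_pdivlMr// mulrC ltW.
have eVr : (e^-1) `^ r = e `^ (- r).
  by rewrite powR_inv ?(ltW e0)// powRN.
have eb0 : 0 <= e^-1 * `|b| by rewrite mulr_ge0// invr_ge0 ltW.
have ebE : e `^ (- r) * `|b| `^ r = (e^-1 * `|b|) `^ r.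
  by rewrite powRM ?eVr// invr_ge0 ltW.
have beb : `|b| <= e^-1 * `|b| by rewrite ler_peMl.
have ae' : `|a| <= e^-1 * `|b| by rewrite mulrC.
have T1 : `|a + b| `^ r <= 2 `^ r * (e `^ (- r) * `|b| `^ r).
  rewrite ebE -powRM//; apply: ge0_ler_powR; rewrite ?nnegrE//; first lra.
    by rewrite mulr_ge0.
  by apply: (le_trans (ler_normD a b)); lra.
have T2 : - (r * sgpow (r - 1) a * b) <= r * (e `^ (- r) * `|b| `^ r).
  apply: le_trans (ler_norm _) _; rewrite normrN normrM (normrM r) norm_sgpow; last lra.
  rewrite (ger0_norm (_ : 0 <= r)); last lra.
  rewrite -mulrA ler_wpM2l//; first lra.
  rewrite ebE -[leRHS]mulr_powRB1//; last lra.
  rewrite mulrC ler_pM ?powR_ge0//.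
  by apply: ge0_ler_powR; rewrite ?nnegrE//; lra.
have : (2 `^ r + r) * (e `^ (- r) * `|b| `^ r) <= C * e `^ (- r) * `|b| `^ r.
  by rewrite -mulrA ler_wpM2r ?mulr_ge0// CE; lra.
have : 0 <= C * e * (`|a| `^ (r - 1) * `|b|) by rewrite !mulr_ge0// ltW.
have : 0 <= `|a| `^ r by exact: powR_ge0.
lra.
Qed.

Lemma powR_addl r a b : 0 <= r -> 0 <= a -> 0 <= b ->
  (a + b) `^ r <= 2 `^ r * (a `^ r + b `^ r).
Proof.
move=> r0; wlog ab : a b / a <= b => [H a0 b0|a0 b0].
  have [ab|/ltW ba] := leP a b; first exact: H.
  by rewrite addrC [X in _ * X]addrC; exact: H.
apply: (@le_trans _ _ ((2 * b) `^ r)).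
  by apply: ge0_ler_powR; rewrite ?nnegrE//; lra.
by rewrite powRM// ler_wpM2l ?powR_ge0// lerDr powR_ge0.
Qed.

(** Jensen's inequality for a uniform mean: the tangent inequalities at the mean are added, and
    their linear parts cancel. *)
Lemma powR_mean r (n : nat) (y : nat -> R) : 1 <= r -> (forall k, 0 <= y k) ->
  ((\sum_(1 <= k < n.+2) y k) / n.+1%:R) `^ r <=
  (\sum_(1 <= k < n.+2) y k `^ r) / n.+1%:R.
Proof.
move=> r1 y0; set m := _ / _.
have n0 : 0 < n.+1%:R :> R by rewrite ltr0n.
have m0 : 0 <= m by rewrite divr_ge0 ?sumr_ge0.
have [mz|mp] := eqVneq m 0.
  rewrite mz powR0; last by lra.
  by rewrite divr_ge0 ?sumr_ge0// => k _; exact: powR_ge0.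
have {mp m0}mp : 0 < m by rewrite lt_neqAle eq_sym mp.
rewrite ler_pdivlMr//.
have : \sum_(1 <= k < n.+2) (m `^ r + r * m `^ (r - 1) * (y k - m)) <=
   \sum_(1 <= k < n.+2) y k `^ r by apply: ler_sum => k _; exact: powR_tangent.
apply: le_trans.
rewrite big_split/= -mulr_sumr sumrB !sumr_const_nat subn1/=.
rewrite -[m `^ r *+ _]mulr_natr -[m *+ _]mulr_natr /m divfK ?gt_eqF//.
by rewrite subrr mulr0 addr0.
Qed.

(** The tangent of the convex function [t^(-c)] at [n.+2], evaluated at [n.+1]. Replacing [n.+2] by
    [n.+1] costs [2^(1 + c)] because [n.+2 <= 2 n.+1]. It turns all summable errors into telescoping
    differences, so that no series has to be summed. *)
Lemma inv_powR_telescope c (n : nat) : 0 < c ->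
  n.+1%:R `^ (- (1 + c)) <= 2 `^ (1 + c) / c *
    (n.+1%:R `^ (- c) - n.+2%:R `^ (- c)) :> R.
Proof.
move=> c0.
have n1 : 0 < n.+1%:R :> R by rewrite ltr0n.
have n2 : 0 < n.+2%:R :> R by rewrite ltr0n.
have := @powR_tangent_neg (- c) n.+1%:R n.+2%:R _ n1 n2.
rewrite oppr_le0 (ltW c0) => /(_ isT).
have -> : n.+1%:R - n.+2%:R = -1 :> R by rewrite -[n.+2]addn1 natrD; lra.
have -> : - c - 1 = - (1 + c) by lra.
move=> H.
have H1 : c * n.+2%:R `^ (- (1 + c)) <= n.+1%:R `^ (- c) - n.+2%:R `^ (- c) by lra.
have H2 : n.+1%:R `^ (- (1 + c)) <= 2 `^ (1 + c) * n.+2%:R `^ (- (1 + c)) :> R.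
  rewrite !powRN mulrC ler_pdivlMl ?powR_gt0// ler_pdivrMr ?powR_gt0//.
  rewrite -powRM//; apply: ge0_ler_powR; rewrite ?nnegrE ?mulr_ge0//; first lra.
  rewrite -natrM ler_nat; lia.
apply: le_trans H2 _; rewrite -mulrA ler_wpM2l ?powR_ge0//.
by rewrite ler_pdivlMl.
Qed.

(** Discrete Gronwall inequality by [1 + s <= exp s]; the sums of [s] are replaced by the
    telescoping majorant [t]. *)
Lemma gronwall_telescope (e s t : nat -> R) (G : R) (m : nat) :
  0 <= G -> (forall n, 0 <= e n) ->
  (forall n, (m <= n)%N -> e n.+1 + G <= (e n + G) * (1 + s n)) ->
  (forall n, (m <= n)%N -> s n <= t n - t n.+1) -> (forall n, 0 <= t n) ->
  forall n, (m <= n)%N -> e n + G <= (e m + G) * expR (t m - t n).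
Proof.
move=> G0 e0 He Hs t0; elim=> [|n IH].
  by rewrite leqn0 => /eqP ->; rewrite subrr expR0 mulr1.
rewrite leq_eqVlt => /predU1P[<-|]; first by rewrite subrr expR0 mulr1.
rewrite ltnS => mn; apply: le_trans (He _ mn) _.
have -> : t m - t n.+1 = (t m - t n) + (t n - t n.+1) by lra.
rewrite expRD mulrA.
apply: (@le_trans _ _ ((e n + G) * expR (t n - t n.+1))).
  rewrite ler_wpM2l ?addr_ge0//; apply: le_trans (expR_ge1Dx _).
  by rewrite lerD2l Hs.
by rewrite ler_wpM2r ?expR_ge0// IH.
Qed.

Lemma ln_le_powR c u : 0 < c -> 0 < u -> ln u <= u `^ c / c.
Proof.
move=> c0 u0; rewrite ler_pdivlMr// mulrC -ln_powR.
by apply: ltW; apply: ln_sublinear; exact: powR_gt0.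
Qed.

End PowerInequalities.

(** * The Gamma function and the growth rate *)

Section GammaFunction.
Context (R : realType).
Notation mu := (@lebesgue_measure R).
Implicit Types (x t : R).

Definition gamma_integrand x t : R := t `^ (x - 1) * expR (- t).

Local Notation halfline := (`]0, +oo[%classic : set R).
Local Notation gint := gamma_integrand.

Lemma measurable_gamma_integrand x (D : set R) : measurable_fun D (gint x).
Proof.
apply: measurable_funTS; apply: measurable_funM.
  exact: measurable_powR.
by apply: measurableT_comp => //; exact: measurable_expR.
Qed.

Lemma gamma_integrand_ge0 x t : 0 <= gint x t.
Proof. by rewrite mulr_ge0 ?powR_ge0 ?expR_ge0. Qed.

(** Compact exhaustion of the half-line: it avoids the singular point 0, and starting at [n.+2]
    keeps every interval nondegenerate, as integration by parts requires. *)
Definition window (n : nat) : set R := `[n.+2%:R^-1, n.+2%:R]%classic.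

Lemma windowE : halfline = \bigcup_n window n.
Proof.
apply/seteqP; split => [t /=|t [n _] /=]; rewrite !in_itv/= ?andbT; last first.
  rewrite /window /= in_itv/= => /andP[nt _]; apply: lt_le_trans nt.
  by rewrite invr_gt0 ltr0n.
move=> t0; pose n := Num.Def.archi_bound (t + t^-1).
have tV : 0 < t^-1 by rewrite invr_gt0.
have : t + t^-1 < n%:R by apply: archi_boundP; rewrite addr_ge0// ltW.
move=> tn; exists n => //; rewrite /window /= in_itv/=.
have n2 : n%:R <= n.+2%:R :> R by rewrite ler_nat; lia.
apply/andP; split; last lra.
by rewrite -[leRHS]invrK lef_pV2 ?posrE ?ltr0n//; lra.
Qed.

Lemma gamma_window_cvg x :
  (\int[mu]_(t in window n) (gint x t)%:E)%E @[n --> \oo] -->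
  (\int[mu]_(t in halfline) (gint x t)%:E)%E.
Proof.
rewrite windowE; apply: ge0_nondecreasing_set_cvg_integral.
- apply/nondecreasing_seqP => n; rewrite subsetEset => t; rewrite /window /= !in_itv/= => /andP[nt tn].
  apply/andP; split.
    apply: le_trans nt; rewrite lef_pV2 ?posrE ?ltr0n// ler_nat; lia.
  by apply: le_trans tn _; rewrite ler_nat.
- by move=> n; exact: measurable_itv.
- by move=> n; apply/measurable_EFinP; exact: measurable_gamma_integrand.
- by move=> n t _; rewrite lee_fin gamma_integrand_ge0.
Qed.

Lemma gamma_integrand_derivable x t : 0 < t -> derivable (gint x) t 1.
Proof.
move=> t0; apply: derivableM.
  by apply: derivable_powR; rewrite in_itv/= t0.
by [].
Qed.

Lemma gamma_integrand_within x (a b : R) : 0 < a -> {within `[a, b], continuous (gint x)}.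
Proof.
move=> a0; apply: derivable_within_continuous => t; rewrite in_itv/= => /andP[at_ _].
by apply: gamma_integrand_derivable; exact: lt_le_trans at_.
Qed.

Lemma gamma_window_intg x n : mu.-integrable (window n) (EFin \o gint x).
Proof.
apply: continuous_compact_integrable; first exact: segment_compact.
by apply: gamma_integrand_within; rewrite invr_gt0 ltr0n.
Qed.

Definition gamma_window x n : R := \int[mu]_(t in window n) gint x t.

Lemma gamma_windowE x n :
  (\int[mu]_(t in window n) (gint x t)%:E)%E = (gamma_window x n)%:E.
Proof.
rewrite /gamma_window /Rintegral fineK//; apply: integrable_fin_num => //.
- exact: measurable_itv.
- exact: gamma_window_intg.
Qed.

Lemma gamma_window_parts x n : gamma_window (x + 1) n =
  x * gamma_window x n + (gint (x + 1) n.+2%:R^-1 - gint (x + 1) n.+2%:R).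
Proof.
have n2 : 0 < n.+2%:R^-1 :> R by rewrite invr_gt0 ltr0n.
have nn : n.+2%:R^-1 < n.+2%:R :> R.
  apply: (@lt_trans _ _ 1); last by rewrite ltr1n.
  by rewrite invf_lt1 ?ltr0n// ltr1n.
have dpow (y t : R) : 0 < t -> derivable (@powR R ^~ y) t 1.
  by move=> t0; apply: derivable_powR; rewrite in_itv/= t0.
have cpow (y t : R) : 0 < t -> {for t, continuous (@powR R ^~ y)}.
  by move=> t0; apply/differentiable_continuous/derivable1_diffP/dpow.
have cexp t : {for t, continuous (fun t => - expR (- t) : R)}.
  by apply/differentiable_continuous/derivable1_diffP.
have dexp t : (fun t => - expR (- t) : R)^`()%classic t = expR (- t).
  rewrite derive1_comp// derive1N// derive1_id mulN1r derive1_comp// derive1E.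
  have /funeqP -> := @derive_expR R.
  by rewrite derive1N// derive1_id mulrN1 opprK.
have Rp := @Rintegration_by_parts R (@powR R ^~ x) (fun t => - expR (- t))
  (fun t => x * t `^ (x - 1)) (fun t => expR (- t)) n.+2%:R^-1 n.+2%:R nn.
have -> : gamma_window (x + 1) n = \int[mu]_(t in window n) (t `^ x * expR (- t)).
  by apply: eq_Rintegral => t _; rewrite /gint addrK.
rewrite Rp; last first.
- by move=> t _; exact: dexp.
- split.
  + by move=> t _; exact: ex_derive.
  + exact/cvg_at_right_filter/cexp.
  + exact/cvg_at_left_filter/cexp.
- by apply: derivable_within_continuous => t _; exact: ex_derive.
- move=> t; rewrite in_itv/= => /andP[nt _].
  by apply: powR_derive1; rewrite in_itv/= andbT (lt_trans n2).
- split.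
  + by move=> t; rewrite in_itv/= => /andP[nt _]; apply: dpow; rewrite (lt_trans n2).
  + exact/cvg_at_right_filter/cpow.
  + apply/cvg_at_left_filter/cpow; exact: lt_trans nn.
- apply: derivable_within_continuous => t; rewrite in_itv/= => /andP[nt _].
  by apply: derivableM => //; apply: dpow; exact: lt_le_trans nt.
have -> : \int[mu]_(t in `[n.+2%:R^-1, n.+2%:R]) (x * t `^ (x - 1) * - expR (- t)) =
    - (x * gamma_window x n).
  rewrite -mulNr -RintegralZl; last 2 first.
  - exact: measurable_itv.
  - exact: gamma_window_intg.
  by apply: eq_Rintegral => t _; rewrite /gint; ring.
by rewrite /gint addrK; ring.
Qed.

Lemma gamma_integrand_decay x : exists2 C : R, 0 <= C &
  forall t, 1 <= t -> gint x t <= C / t.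
Proof.
pose k := Num.Def.archi_bound `|x|.
have kx : x <= k%:R.
  by apply: ltW; apply: le_lt_trans (ler_norm _) _; exact: archi_boundP.
(* The term of order [k.+1] of the exponential series dominates [t^k * t] up to this factorial, and
   [t^(x - 1) <= t^k] for [t >= 1]. *)
exists (k.+1)`!%:R => // t t1; have t0 : 0 < t by lra.
have et : t ^+ k.+1 / (k.+1)`!%:R <= expR t.
  by apply: le_trans (expR_ge1Dxn k (ltW t0)); rewrite lerDr.
have f0 : 0 < (k.+1)`!%:R :> R by rewrite ltr0n fact_gt0.
have H1 : t `^ (x - 1) <= t ^+ k.
  rewrite -(powR_mulrn k (ltW t0)); apply: ler_powR => //; lra.
have H2 : t ^+ k.+1 <= (k.+1)`!%:R * expR t.
  by rewrite mulrC -ler_pdivrMr.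
rewrite /gint ler_pdivlMr// expRN mulrAC ler_pdivrMr ?expR_gt0//.
by apply: le_trans H2; rewrite exprSr; apply: ler_wpM2r => //; exact: ltW.
Qed.

Lemma gamma_boundary_cvg0 x : 1 <= x ->
  gint (x + 1) n.+2%:R^-1 - gint (x + 1) n.+2%:R @[n --> \oo] --> (0 : R).
Proof.
move=> x1; have [C C0 HC] := gamma_integrand_decay (x + 1).
have h2 : n.+2%:R^-1 @[n --> \oo] --> (0 : R).
  have := @cvg_harmonic R; rewrite -(@cvg_shiftS _ (harmonic : nat -> R)).
  by apply: cvg_trans; apply: near_eq_cvg; near=> n.
have hC : C * n.+2%:R^-1 @[n --> \oo] --> (0 : R).
  by rewrite -(mulr0 C); apply: cvgMl_tmp h2.
rewrite -(subr0 (0 : R)); apply: cvgB.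
  apply: squeeze_cvgr (cvg_cst 0) h2; near=> n.
  rewrite gamma_integrand_ge0/=.
  have n0 : 0 < n.+2%:R^-1 :> R by rewrite invr_gt0 ltr0n.
  have n1 : n.+2%:R^-1 <= 1 :> R by rewrite invf_le1 ?ltr0n// ler1n.
  rewrite /gint addrK; apply: (@le_trans _ _ (n.+2%:R^-1 `^ x)).
    by rewrite ler_piMr ?powR_ge0// expR_le1 oppr_le0 ltW.
  by rewrite -[leRHS]powRr1 ?(ltW n0)//; apply: ger_powR => //; rewrite n0.
apply: squeeze_cvgr (cvg_cst 0) hC; near=> n.
by rewrite gamma_integrand_ge0 HC// ler1n.
Unshelve. all: by end_near. Qed.

(** Stated for the extended-real integral, so that finiteness at [x + 1] comes out of the recursion
    instead of being needed for it. *)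
Lemma gamma_cvg_step x (l : R) : 1 <= x ->
  (\int[mu]_(t in halfline) (gint x t)%:E)%E = l%:E ->
  (\int[mu]_(t in halfline) (gint (x + 1) t)%:E)%E = (x * l)%:E.
Proof.
move=> x1 xl; have := @gamma_window_cvg x; rewrite xl.
under eq_cvg do rewrite gamma_windowE.
move/fine_cvgP => [_ cl].
have c2 : (gamma_window (x + 1) n)%:E @[n --> \oo] --> (x * l)%:E.
  apply: cvg_EFin; first by near=> n.
  rewrite -[x * l]addr0.
  under eq_cvg do rewrite /= gamma_window_parts.
  by apply: cvgD (gamma_boundary_cvg0 x1); apply: cvgMl_tmp.
have c1 : (gamma_window (x + 1) n)%:E @[n --> \oo] -->
    (\int[mu]_(t in halfline) (gint (x + 1) t)%:E)%E.
  by have := @gamma_window_cvg (x + 1); under eq_cvg do rewrite gamma_windowE.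
exact: (cvg_unique (@ereal_hausdorff R) c1 c2).
Unshelve. all: by end_near. Qed.

Lemma gamma1 : (\int[mu]_(t in halfline) (gint 1 t)%:E)%E = 1%E.
Proof.
rewrite integral_itv_obnd_cbnd; last first.
  by apply/measurable_EFinP; exact: measurable_gamma_integrand.
rewrite -(@integral_exponential_pdf R 1 ltr01).
rewrite integral_mkcond; apply: eq_integral => t _.
rewrite /exponential_pdf /patch; case: ifPn => // _.
by rewrite /gint subrr powRr0 mulN1r.
Qed.

(** Finiteness at positive integers follows from the recursion started at the exponential density;
    in between, [t^(x - 1) <= 1 + t^k] for [k >= x] dominates. *)
Lemma gamma_fin x : 1 <= x ->
  mu.-integrable halfline (EFin \o gint x).
Proof.
move=> x1.
have gnat k : exists l : R, (\int[mu]_(t in halfline) (gint k.+1%:R t)%:E)%E = l%:E.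
  elim: k => [|k [l IH]]; first by exists 1; exact: gamma1.
  by exists (k.+1%:R * l); rewrite -[k.+2]addn1 natrD; apply: gamma_cvg_step IH; rewrite ler1n.
have gi k : mu.-integrable halfline (EFin \o gint k.+1%:R).
  apply/integrableP; split; first by apply/measurable_EFinP; exact: measurable_gamma_integrand.
  have [l lE] := gnat k; apply: (@le_lt_trans _ _ l%:E); last exact: ltry.
  rewrite -lE le_eqVlt; apply/orP; left; apply/eqP; apply: eq_integral => t _.
  by rewrite /= ger0_norm// gamma_integrand_ge0.
pose k := Num.Def.archi_bound x.
have xk : x <= k%:R by apply: ltW; apply: archi_boundP; lra.
apply: le_integrable (integrableD _ (gi 0%N) (gi k)) => //.
- by apply/measurable_EFinP; exact: measurable_gamma_integrand.
- move=> t /=; rewrite in_itv/= andbT => t0.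
  rewrite lee_fin !ger0_norm ?addr_ge0 ?gamma_integrand_ge0//.
  rewrite /gint -mulrDl ler_wpM2r ?expR_ge0// subrr powRr0.
  have [t1|t1] := leP t 1.
    rewrite (@le_trans _ _ 1)// ?lerDl ?powR_ge0//.
    by rewrite -[leRHS](powRr0 t); apply: ger_powR; [rewrite t0|lra].
  rewrite (@le_trans _ _ (t `^ (k.+1%:R - 1)))// ?lerDr//.
  by apply: ler_powR; [exact: ltW|rewrite -[k.+1]addn1 natrD; lra].
Qed.

Lemma Gamma_funE x : Gamma_fun x = \int[mu]_(t in halfline) gint x t.
Proof. by []. Qed.

Lemma Gamma_fun_ereal x : 1 <= x ->
  (\int[mu]_(t in halfline) (gint x t)%:E)%E = (Gamma_fun x)%:E.
Proof.
by move=> x1; rewrite /Gamma_fun /Rintegral fineK//; apply: integrable_fin_num (gamma_fin x1).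
Qed.

Lemma Gamma_fun_rec x : 1 <= x -> Gamma_fun (x + 1) = x * Gamma_fun x.
Proof.
move=> x1; have := gamma_cvg_step x1 (Gamma_fun_ereal x1).
by rewrite Gamma_fun_ereal ?(le_trans x1)// ?lerDl// => -[].
Qed.

Lemma Gamma_fun1 : Gamma_fun (1 : R) = 1.
Proof. by have := gamma1; rewrite Gamma_fun_ereal// => -[]. Qed.

(** A tangent inequality for [t^r] integrated against [t^(x - 1) exp (- t)]. For [y = x] the linear
    term vanishes by the recursion, which leaves [x^r Gamma(x) <= Gamma(x + r)]. The pointwise
    inequality is a hypothesis so that exponents [r >= 1] and [r <= 0] are both covered. *)
Lemma Gamma_fun_tangent x r y : 1 <= x -> 1 <= x + r -> 0 < y ->
  (forall t, 0 < t -> y `^ r + r * y `^ (r - 1) * (t - y) <= t `^ r) ->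
  y `^ r * Gamma_fun x + r * y `^ (r - 1) * (Gamma_fun (x + 1) - y * Gamma_fun x)
    <= Gamma_fun (x + r).
Proof.
move=> x1 xr1 y0 H.
have x2 : 1 <= x + 1 by lra.
have mh : measurable (`]0, +oo[%classic : set (measurableTypeR R)) by exact: measurable_itv.
pose c1 := y `^ r - r * y `^ (r - 1) * y; pose c2 := r * y `^ (r - 1).
have i1 : mu.-integrable halfline (EFin \o (fun t => c1 * gint x t)).
  by apply: (eq_integrable mh) (integrableZl mh c1 (gamma_fin x1)).
have i2 : mu.-integrable halfline (EFin \o (fun t => c2 * gint (x + 1) t)).
  by apply: (eq_integrable mh) (integrableZl mh c2 (gamma_fin x2)).
have -> : y `^ r * Gamma_fun x + r * y `^ (r - 1) * (Gamma_fun (x + 1) - y * Gamma_fun x)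
   = c1 * Gamma_fun x + c2 * Gamma_fun (x + 1).
  by rewrite /c1 /c2; move: (Gamma_fun x) (Gamma_fun (x + 1)) => g1 g2; ring.
rewrite !Gamma_funE -RintegralZl//; last exact: gamma_fin.
rewrite -RintegralZl//; last exact: gamma_fin.
rewrite -RintegralD//; apply: le_Rintegral => //.
- by apply: (eq_integrable mh) (integrableD mh i1 i2).
- exact: gamma_fin.
- move=> t /=; rewrite in_itv/= andbT => t0.
  have E1 : gint (x + 1) t = t * gint x t.
    rewrite /gint addrK mulrA; congr (_ * _).
    by rewrite mulr_powRB1 ?(ltW t0)//; lra.
  have E2 : gint (x + r) t = t `^ r * gint x t.
    rewrite /gint mulrA; congr (_ * _).
    by rewrite -powRD ?(gt_eqF t0) ?implybT//; congr (_ `^ _); ring.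
  rewrite E1 E2.
  have -> : c1 * gint x t + c2 * (t * gint x t) =
    (y `^ r + r * y `^ (r - 1) * (t - y)) * gint x t by rewrite /c1 /c2; ring.
  by rewrite ler_wpM2r ?gamma_integrand_ge0// H.
Qed.

Lemma Gamma_fun1D_ge1 (r : R) : 1 <= r -> 1 <= Gamma_fun (1 + r).
Proof.
move=> r1; have r2 : 1 <= 1 + r by lra.
have := @Gamma_fun_tangent 1 r 1 (lexx _) r2 ltr01.
rewrite Gamma_fun_rec// Gamma_fun1 !mulr1 subrr mulr0 addr0 powR1; apply.
move=> t t0; have := @powR_tangent R r t 1 r1 (ltW t0) ltr01.
by rewrite powR1.
Qed.

Definition growth (rho : R) (n : nat) : R := \prod_(1 <= k < n) (1 + rho / k%:R).

Lemma growthS rho n : growth rho n.+2 = growth rho n.+1 * (1 + rho / n.+1%:R).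
Proof. by rewrite /growth big_nat_recr. Qed.

Lemma growth1 rho : growth rho 1 = 1.
Proof. by rewrite /growth big_geq. Qed.

Lemma growth_gt0 rho n : 0 <= rho -> 0 < growth rho n.
Proof.
move=> r0; rewrite /growth big_seq; apply: prodr_gt0 => k _.
by rewrite ltr_wpDr// divr_ge0.
Qed.

Lemma Gamma_fun_nat_gt0 n : 0 < Gamma_fun (n.+1%:R : R).
Proof.
elim: n => [|n IH]; first by rewrite Gamma_fun1.
by rewrite -[n.+2]addn1 natrD Gamma_fun_rec ?ler1n// mulr_gt0 ?ltr0n.
Qed.

(** Both sides obey the same recursion in [n]; it reduces the asymptotics of [growth] to a ratio of
    Gamma values. *)
Lemma growth_Gamma rho n : 0 <= rho ->
  Gamma_fun (n.+1%:R + rho) = growth rho n.+1 * Gamma_fun n.+1%:R * Gamma_fun (1 + rho).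
Proof.
move=> r0; elim: n => [|n IH]; first by rewrite growth1 Gamma_fun1 !mul1r.
have n1 : 1 <= n.+1%:R :> R by rewrite ler1n.
have n0 : n.+1%:R != 0 :> R by rewrite pnatr_eq0.
have -> : n.+2%:R + rho = n.+1%:R + rho + 1 by rewrite -[n.+2]addn1 natrD; ring.
have E2 : n.+2%:R = n.+1%:R + 1 :> R by rewrite -[n.+2]addn1 natrD.
have nr : 1 <= n.+1%:R + rho by rewrite ler_wpDr.
rewrite (Gamma_fun_rec nr) IH growthS [in RHS]E2 (Gamma_fun_rec n1).
move: (growth _ _) (Gamma_fun _) (Gamma_fun _) => g1 g2 g3.
by field.
Qed.

Lemma growth_lower rho n : 1 <= rho ->
  n.+1%:R `^ rho / Gamma_fun (1 + rho) <= growth rho n.+1.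
Proof.
move=> r1; have r0 : 0 <= rho by exact: le_trans r1.
have n1 : 1 <= n.+1%:R :> R by rewrite ler1n.
have n0 : 0 < n.+1%:R :> R by rewrite ltr0n.
have nr : 1 <= n.+1%:R + rho by rewrite ler_wpDr.
have G0 := Gamma_fun_nat_gt0 n.
have G1 : 0 < Gamma_fun (1 + rho) := lt_le_trans ltr01 (Gamma_fun1D_ge1 r1).
have := @Gamma_fun_tangent n.+1%:R rho n.+1%:R n1 nr n0.
rewrite Gamma_fun_rec// subrr mulr0 addr0 => /(_ _)/wrap[|].
  by move=> t t0; apply: powR_tangent => //; exact: ltW.
rewrite (growth_Gamma n r0) mulrAC (ler_pM2r G0) => H.
by rewrite (ler_pdivrMr _ _ G1).
Qed.

(** The companion of [growth_lower]: the tangent bound with exponent [- rho] at the point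
    [n.+1 + rho], which leads back to [n.+1]. *)
Lemma growth_upper rho n : 1 <= rho ->
  growth rho n.+1 <= (n.+1%:R + rho) `^ rho / Gamma_fun (1 + rho).
Proof.
move=> r1; have r0 : 0 <= rho by exact: le_trans r1.
have rN : - rho <= 0 by rewrite oppr_le0.
have n1 : 1 <= n.+1%:R :> R by rewrite ler1n.
have nr : 1 <= n.+1%:R + rho by rewrite ler_wpDr.
have nr0 : 0 < n.+1%:R + rho by exact: lt_le_trans nr.
have G0 := Gamma_fun_nat_gt0 n.
have G1 : 0 < Gamma_fun (1 + rho) := lt_le_trans ltr01 (Gamma_fun1D_ge1 r1).
have := @Gamma_fun_tangent (n.+1%:R + rho) (- rho) (n.+1%:R + rho) nr _ nr0.
rewrite addrK => /(_ n1).
rewrite Gamma_fun_rec// subrr mulr0 addr0 => /(_ _)/wrap[|].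
  by move=> t t0; exact: powR_tangent_neg.
rewrite (growth_Gamma n r0) powRN mulrC ler_pdivrMr ?powR_gt0// => H.
rewrite (ler_pdivlMr _ _ G1).
by rewrite -(ler_pM2r G0) mulrAC [leRHS]mulrC.
Qed.

Lemma growth_cvg rho : 1 <= rho ->
  growth rho n / n%:R `^ rho @[n --> \oo] --> (Gamma_fun (1 + rho))^-1.
Proof.
move=> r1; have G1 := Gamma_fun1D_ge1 r1; set G := Gamma_fun _.
rewrite -(@cvg_shiftS _ (fun n => growth rho n / n%:R `^ rho)).
have h : rho * (n.+1%:R)^-1 @[n --> \oo] --> (0 : R).
  by rewrite -(mulr0 rho); apply: cvgMl_tmp (@cvg_harmonic R).
have h1 : 1 + rho * (n.+1%:R)^-1 @[n --> \oo] --> (1 : R).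
  by rewrite -[X in _ --> X]addr0; apply: cvgD h; exact: cvg_cst.
have c1 : {for 1, continuous (fun x : R => x `^ rho)}.
  by apply/differentiable_continuous/derivable1_diffP/derivable_powR; rewrite in_itv/= ltr01.
have h2 : (1 + rho * (n.+1%:R)^-1) `^ rho * G^-1 @[n --> \oo] --> G^-1.
  rewrite -[X in _ --> X]mul1r; apply: cvgMr_tmp.
  by have := cvg_comp _ _ h1 c1; rewrite powR1.
apply: squeeze_cvgr (cvg_cst G^-1) h2; near=> n.
have n0 : 0 < n.+1%:R :> R by rewrite ltr0n.
have p0 : 0 < n.+1%:R `^ rho :> R by exact: powR_gt0.
apply/andP; split.
  by rewrite ler_pdivlMr// mulrC growth_lower.
rewrite ler_pdivrMr//; apply: le_trans (growth_upper n r1) _.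
rewrite [leRHS]mulrAC; apply: ler_wpM2r; first by rewrite invr_ge0 /G; lra.
rewrite -powRM ?(ltW n0)//; last by rewrite addr_ge0// mulr_ge0 ?invr_ge0 ?(ltW n0)//; lra.
rewrite (_ : (1 + _) * _ = n.+1%:R + rho)//.
by field; rewrite gt_eqF.
Unshelve. all: by end_near. Qed.

Lemma growth_ge_nat rho n : 1 <= rho -> n.+1%:R <= growth rho n.+1.
Proof.
move=> r1; elim: n => [|n IH]; first by rewrite growth1.
have n0 : 0 < n.+1%:R :> R by rewrite ltr0n.
rewrite growthS; apply: (@le_trans _ _ (n.+1%:R * (1 + 1 / n.+1%:R))).
  rewrite mulrDr mulr1 mulrCA divff ?gt_eqF// mulr1 -[n.+2]addn1 natrD; lra.
apply: ler_pM => //.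
by rewrite lerD2l ler_wpM2r// invr_ge0 ltW.
Qed.

(** Telescopes because [k / a_k - (k + 1) / a_(k+1) = (rho - 1) / a_(k+1)]. *)
Lemma growth_inv_sum rho n : 1 < rho ->
  \sum_(2 <= k < n.+2) (growth rho k)^-1 =
  (rho - 1)^-1 * (1 - n.+1%:R / growth rho n.+1).
Proof.
move=> r1; elim: n => [|n IH].
  by rewrite big_geq// growth1 divr1 subrr mulr0.
have a0 : growth rho n.+1 != 0 by rewrite gt_eqF// growth_gt0//; lra.
have n0 : 0 < n.+1%:R :> R by rewrite ltr0n.
have E2 : n.+2%:R = n.+1%:R + 1 :> R by rewrite -[n.+2]addn1 natrD.
rewrite big_nat_recr//= IH growthS E2.
by field; rewrite a0 !gt_eqF//=; lra.
Qed.

End GammaFunction.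

(** * Moments and martingales of the walk *)

Section PowerCalculus.
Context (R : realType).
Implicit Types (a b r : R).

Lemma powR_young r a b : 1 <= r -> 0 <= a -> 0 <= b ->
  a `^ (r - 1) * b <= a `^ r + b `^ r.
Proof.
move=> r1 a0 b0; have r0 : 0 < r by lra.
have [ab|/ltW ba] := leP a b.
  apply: (@le_trans _ _ (b `^ (r - 1) * b)).
    by apply: ler_wpM2r => //; apply: ge0_ler_powR; rewrite ?nnegrE//; lra.
  by rewrite mulrC mulr_powRB1// lerDr powR_ge0.
apply: (@le_trans _ _ (a `^ (r - 1) * a)).
  by apply: ler_wpM2l => //; exact: powR_ge0.
by rewrite mulrC mulr_powRB1// lerDl powR_ge0.
Qed.

Lemma powR_le_1D r s a : 0 <= r <= s -> 0 <= a -> a `^ r <= 1 + a `^ s.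
Proof.
move=> /andP[r0 rs] a0; have [a1|a1] := leP a 1.
  rewrite (@le_trans _ _ 1)// ?lerDl ?powR_ge0//.
  have : a `^ r <= 1 `^ r by apply: ge0_ler_powR; rewrite ?nnegrE.
  by rewrite powR1.
rewrite (@le_trans _ _ (a `^ s))// ?lerDr//.
by apply: ler_powR => //; exact: ltW.
Qed.

Lemma measurable_sgpow r : 0 < r -> measurable_fun setT (@sgpow R r).
Proof.
move=> r0.
have -> : @sgpow R r = fun a => (Num.max a 0) `^ r - (Num.max (- a) 0) `^ r.
  apply/funext => a; rewrite /sgpow; have [a0|a0|->] := ltgtP a 0.
  - rewrite ltr0_sg// ltr0_norm// max_l; last lra.
    by rewrite powR0 ?gt_eqF// sub0r mulN1r.
  - rewrite gtr0_sg// gtr0_norm// max_r; last lra.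
    by rewrite powR0 ?gt_eqF// subr0 mul1r.
  - by rewrite sgr0 oppr0 maxxx mul0r subrr.
apply: measurable_funB.
  apply: (measurableT_comp (measurable_powR _)); exact: measurable_maxr.
apply: (measurableT_comp (measurable_powR _)); apply: measurable_maxr => //.
Qed.

Lemma measurable_norm_powR r : measurable_fun setT (fun y : R => `|y| `^ r).
Proof. exact: (measurableT_comp (measurable_powR _) (@normr_measurable R setT)). Qed.

End PowerCalculus.

(** * Growth of the power moments of the steps *)

Section Moments.
Context (d : measure_display) (T : measurableType d) (R : realType).
Variable P : probability T R.
Variables (p : R) (X xi : {RV P >-> R}).
Variables (Xs : nat -> {RV P >-> R}) (eps : nat -> {RV P >-> bool})
  (U : nat -> {RV P >-> nat}) (xis : nat -> {RV P >-> R}).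
Hypothesis inputs : rwes_inputs Xs eps U xis p X xi.
Hypothesis p_gt0 : 0 < p.
Hypothesis p_le1 : p <= 1.

Local Notation x := (echoed_step Xs eps U xis).
Local Notation known := (known Xs eps U xis).

Lemma echo_product n (W : T -> R) (g : R -> R) : measurable_fun setT g ->
  known (history n.+1) W -> intg P W -> intg P (g \o xi) ->
  intg P (fun w => W w * g (xis n.+2 w)) /\
  Ex P (fun w => W w * g (xis n.+2 w)) = Ex P W * Ex P (g \o xi).
Proof.
move=> mg kW Wi gi.
have [gxi <-] := same_law_Ex (echoes_law inputs (isT : (2 <= n.+2)%N)) mg gi.
apply: (known_ExM inputs (i := inr (inr n.+2)) (J := history n.+1)) => //.
- rewrite cons_uniq history_uniq andbT; apply/negP => /mem_history[_] /=.
  by rewrite ltnn.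
- by move=> j; rewrite inE => /predU1P[->//|/mem_history[]].
- exact: (@echo_sig _ _ _ _ _ _ _ _ n.+2 g mg).
Qed.

(** For a multiplicative [h] the echo factors out of the echoed terms, and one step acts on
    expectations linearly with the factor [p E g(xi) / n.+1]. The identity, the absolute value and
    its powers are the cases used. *)
Lemma homogeneous_step n (W : T -> R) (h g : R -> R) :
  measurable_fun setT h -> measurable_fun setT g -> h 0 = 0 ->
  (forall c y, h (c * y) = g c * h y) ->
  known (history n.+1) W -> intg P W -> intg P (h \o X) -> intg P (g \o xi) ->
  (forall k, (1 <= k < n.+2)%N -> intg P (fun w => W w * h (x k w))) ->
  intg P (fun w => W w * h (x n.+2 w)) /\
  Ex P (fun w => W w * h (x n.+2 w)) = (1 - p) * Ex P W * Ex P (h \o X) +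
    p * Ex P (g \o xi) / n.+1%:R * \sum_(1 <= k < n.+2) Ex P (fun w => W w * h (x k w)).
Proof.
move=> mh mg h0 hg kW Wi hX gxi Wk.
have prod k : (1 <= k < n.+2)%N ->
    intg P (fun w => W w * h (xis n.+2 w * x k w)) /\
    Ex P (fun w => W w * h (xis n.+2 w * x k w)) = Ex P (fun w => W w * h (x k w)) * Ex P (g \o xi).
  move=> kn.
  have kWk : known (history n.+1) (fun w => W w * h (x k w)).
    by apply: knownM => //; apply: known_comp => //; exact: known_step.
  have [i E] := echo_product mg kWk (Wk _ kn) gxi.
  have eq : (fun w => W w * h (x k w) * g (xis n.+2 w)) =1
      (fun w => W w * h (xis n.+2 w * x k w)) by move=> w; rewrite hg; ring.
  by split; [exact: eq_intg eq i|rewrite -(eq_Ex P eq) E].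
have [i ->] := one_step_Ex inputs mh h0 kW Wi hX (fun k kn => (prod k kn).1).
split => //; congr (_ + _).
rewrite big_nat (eq_bigr (fun k => Ex P (fun w => W w * h (x k w)) * Ex P (g \o xi))); last first.
  by move=> k kn; rewrite (prod _ kn).2.
by rewrite -big_nat -mulr_suml; ring.
Qed.

Section Moment.
Variable q : R.
Hypothesis q_gt0 : 0 < q.
Hypothesis Xq : intg P (fun w => `|X w| `^ q).
Hypothesis xiq : intg P (fun w => `|xi w| `^ q).

Lemma power_step n (W : T -> R) : known (history n.+1) W -> intg P W ->
  (forall k, (1 <= k < n.+2)%N -> intg P (fun w => W w * `|x k w| `^ q)) ->
  intg P (fun w => W w * `|x n.+2 w| `^ q) /\
  Ex P (fun w => W w * `|x n.+2 w| `^ q) =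
    (1 - p) * Ex P W * Ex P (fun w => `|X w| `^ q) +
    p * Ex P (fun w => `|xi w| `^ q) / n.+1%:R *
      \sum_(1 <= k < n.+2) Ex P (fun w => W w * `|x k w| `^ q).
Proof.
move=> kW Wi Wk.
apply: (@homogeneous_step n W (fun y => `|y| `^ q) (fun y => `|y| `^ q)) => //.
- exact: measurable_norm_powR.
- exact: measurable_norm_powR.
- by rewrite normr0 powR0// gt_eqF.
- by move=> c y; rewrite normrM powRM.
Qed.

Lemma intg_step k : (1 <= k)%N -> intg P (fun w => `|x k w| `^ q).
Proof.
elim/ltn_ind: k => -[//|[|k]] IH _.
  exact: (same_law_Ex (spins_law inputs (isT : (1 <= 1)%N)) (@measurable_norm_powR _ q) Xq).1.
have [||] := @power_step k (fun=> 1) _ (intg_cst P 1).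
- exact: known_cst.
- by move=> j /andP[j1 jk]; apply: eq_intg (IH _ jk j1) => w; rewrite mul1r.
by move=> i _; apply: eq_intg i => w; rewrite mul1r.
Qed.

Definition moment_sum n := Ex P (fun w => \sum_(1 <= k < n.+2) `|x k w| `^ q).

Lemma intg_range (F : nat -> T -> R) (i j : nat) :
  (forall k, (i <= k < j)%N -> intg P (F k)) ->
  intg P (fun w => \sum_(i <= k < j) F k w) /\
  Ex P (fun w => \sum_(i <= k < j) F k w) = \sum_(i <= k < j) Ex P (F k).
Proof.
move=> Fi; pose G k := if (i <= k < j)%N then F k else fun=> 0.
have Gi k : intg P (G k).
  by rewrite /G; case: ifPn => [/Fi//|_]; exact: intg_cst.
have E : (fun w => \sum_(i <= k < j) G k w) =1 (fun w => \sum_(i <= k < j) F k w).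
  by move=> w; rewrite big_nat [RHS]big_nat; apply: eq_bigr => k kn; rewrite /G kn.
split; first by apply: eq_intg E _; exact: intg_sum.
rewrite -(eq_Ex P E) Ex_sum// big_nat [RHS]big_nat; apply: eq_bigr => k kn.
by rewrite /G kn.
Qed.

Lemma intg_moment_sum n : intg P (fun w => \sum_(1 <= k < n.+2) `|x k w| `^ q).
Proof. by apply: (intg_range _).1 => k /andP[k1 _]; exact: intg_step. Qed.

Lemma moment_sumS n : moment_sum n.+1 = moment_sum n *
    (1 + p * Ex P (fun w => `|xi w| `^ q) / n.+1%:R)
  + (1 - p) * Ex P (fun w => `|X w| `^ q).
Proof.
rewrite {1}/moment_sum.
have E : (fun w => \sum_(1 <= k < n.+3) `|x k w| `^ q) =1
    (fun w => \sum_(1 <= k < n.+2) `|x k w| `^ q + `|x n.+2 w| `^ q).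
  by move=> w; rewrite big_nat_recr.
rewrite (eq_Ex P E) ExD; [|exact: intg_moment_sum|exact: intg_step].
have [||_] := @power_step n (fun=> 1) _ (intg_cst P 1).
- exact: known_cst.
- by move=> j /andP[j1 _]; apply: eq_intg (intg_step j1) => w; rewrite mul1r.
rewrite (eq_Ex P (g := fun w => `|x n.+2 w| `^ q)); last by move=> w; rewrite mul1r.
move=> ->; rewrite Ex_cst mulr1 -/(moment_sum n).
have -> : \sum_(1 <= k < n.+2) Ex P (fun w => 1 * `|x k w| `^ q) = moment_sum n.
  rewrite /moment_sum (intg_range _).2; last by move=> k /andP[k1 _]; exact: intg_step.
  by apply: eq_bigr => k _; apply: eq_Ex => w; rewrite mul1r.
by rewrite mulrDr mulr1 -addrA [p * _ / _ * _]mulrC [X in _ + X]addrC.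
Qed.

(** Induction on the recursion of [moment_sum]. Bernoulli gives
    [(n + 1)^kappa >= n^kappa (1 + kappa / n)], and the excess of [kappa] over [p m_q] absorbs the
    constant inflow from fresh spins, since [n^kappa / n >= 1]. *)
Lemma moment_sum_growth kappa : 1 <= kappa ->
  p * Ex P (fun w => `|xi w| `^ q) < kappa ->
  exists2 K, 0 <= K & forall n, moment_sum n <= K * n.+1%:R `^ kappa.
Proof.
move=> k1 pk; set mq := p * _ in pk *; set c := (1 - p) * Ex P (fun w => `|X w| `^ q).
have c0 : 0 <= c.
  rewrite /c; apply: mulr_ge0; [by rewrite subr_ge0|apply: Ex_ge0 => w; exact: powR_ge0].
have m0 : 0 <= moment_sum 0.
  by apply: Ex_ge0 => w; apply: sumr_ge0 => k _; exact: powR_ge0.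
have km : 0 < kappa - mq by lra.
(* The first summand starts the induction; the second makes the inflow [c] at most
   [K * (kappa - mq)]. *)
exists (moment_sum 0 + c / (kappa - mq)).
  by rewrite addr_ge0// divr_ge0// ltW.
set K := _ + _; have Kc : c <= K * (kappa - mq).
  by rewrite /K mulrDl divfK ?gt_eqF// lerDr mulr_ge0// ltW.
have K0 : 0 <= K by rewrite addr_ge0// divr_ge0// ltW.
elim=> [|n IH].
  by rewrite powR1 mulr1 /K lerDl divr_ge0// ltW.
have n0 : 0 < n.+1%:R :> R by rewrite ltr0n.
have b : n.+1%:R `^ kappa * (1 + kappa / n.+1%:R) <= n.+2%:R `^ kappa.
  have -> : n.+2%:R = n.+1%:R * (1 + n.+1%:R^-1) :> R.
    by rewrite mulrDr mulr1 divff ?gt_eqF// -[n.+2]addn1 natrD.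
  rewrite powRM//.
  rewrite ler_wpM2l ?powR_ge0//.
  have := @bernoulli_ge1 R kappa (1 + n.+1%:R^-1) k1.
  by rewrite addrAC subrr add0r; apply; rewrite addr_ge0// invr_ge0 ltW.
have n1k : 1 <= n.+1%:R `^ kappa / n.+1%:R :> R.
  rewrite ler_pdivlMr// mul1r -[leLHS]powRr1 ?(ltW n0)//; apply: ler_powR => //.
  by rewrite ler1n.
rewrite moment_sumS -/c -/mq.
have mq0 : 0 <= mq.
  by apply: mulr_ge0; [exact: ltW|apply: Ex_ge0 => w; exact: powR_ge0].
have f0 : 0 <= 1 + mq / n.+1%:R by rewrite addr_ge0// divr_ge0// ltW.
have s1 : moment_sum n * (1 + mq / n.+1%:R) <= K * n.+1%:R `^ kappa * (1 + mq / n.+1%:R).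
  by rewrite ler_wpM2r.
have s2 : c <= K * (kappa - mq) * (n.+1%:R `^ kappa / n.+1%:R).
  by apply: le_trans Kc _; rewrite ler_peMr// mulr_ge0// ltW.
have s3 : K * (n.+1%:R `^ kappa * (1 + kappa / n.+1%:R)) <= K * n.+2%:R `^ kappa.
  by rewrite ler_wpM2l.
move: s1 s2 s3; clear; move: (n.+1%:R^-1) (n.+1%:R `^ kappa) (n.+2%:R `^ kappa) (moment_sum n) => v u u2 s s1 s2 s3.
lra.
Qed.

End Moment.
End Moments.

(** * The martingales of the walk and the size of their increments *)

Section Martingale.
Context (d : measure_display) (T : measurableType d) (R : realType).
Variable P : probability T R.
Variables (p : R) (X xi : {RV P >-> R}).
Variables (Xs : nat -> {RV P >-> R}) (eps : nat -> {RV P >-> bool})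
  (U : nat -> {RV P >-> nat}) (xis : nat -> {RV P >-> R}).
Hypothesis inputs : rwes_inputs Xs eps U xis p X xi.
Hypothesis p_gt0 : 0 < p.
Hypothesis p_le1 : p <= 1.
Variable rho : R.
Hypothesis rho_gt1 : 1 < rho.
Hypothesis rhoE : rho = p * Ex P (fun w => `|xi w|).
Hypothesis X_intg : intg P X.
Hypothesis xi_intg : intg P xi.

Local Notation x := (echoed_step Xs eps U xis).
Local Notation known := (known Xs eps U xis).

(* All sequences of the section are shifted by one: index [n] refers to the
   first [n.+1] steps of the walk. *)
Local Notation a n := (growth rho n.+1).

Definition inv_sum n : R := \sum_(2 <= k < n.+2) (growth rho k)^-1.

Definition abs_sum n w := \sum_(1 <= k < n.+2) `|x k w|.

Lemma rho_gt0 : 0 < rho. Proof. exact: lt_trans rho_gt1. Qed.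

Lemma a_gt0 n : 0 < a n.
Proof. by apply: growth_gt0; apply: ltW; exact: rho_gt0. Qed.

Lemma inv_sum_bound n : 0 <= inv_sum n <= (rho - 1)^-1.
Proof.
rewrite /inv_sum; apply/andP; split.
  apply: sumr_ge0 => k _; rewrite invr_ge0 ltW// growth_gt0// ltW//.
  exact: rho_gt0.
rewrite growth_inv_sum// ler_piMr ?invr_ge0 ?subr_ge0 ?(ltW rho_gt1)//.
by rewrite lerBlDr lerDl divr_ge0// ltW// a_gt0.
Qed.

Lemma intg_abs_step k : (1 <= k)%N -> intg P (fun w => `|x k w|).
Proof.
move=> k1.
have Xi : intg P (fun w => `|X w| `^ 1).
  by apply: eq_intg (intg_norm X_intg) => w; rewrite powRr1.
have xii : intg P (fun w => `|xi w| `^ 1).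
  by apply: eq_intg (intg_norm xi_intg) => w; rewrite powRr1.
by apply: eq_intg (intg_step inputs ltr01 Xi xii k1) => w; rewrite powRr1.
Qed.

Lemma intg_one_step k : (1 <= k)%N -> intg P (x k).
Proof. by move=> k1; apply: intg_normP (intg_abs_step k1); exact: meas_step. Qed.

Section Homogeneous.
Variables (h g : R -> R).
Hypothesis mh : measurable_fun setT h.
Hypothesis mg : measurable_fun setT g.
Hypothesis h0 : h 0 = 0.
Hypothesis hg : forall c y, h (c * y) = g c * h y.
Hypothesis hn : forall y, `|h y| = `|y|.
Hypothesis g_intg : intg P (g \o xi).
Hypothesis g_mean : p * Ex P (g \o xi) = rho.

Definition drift := (1 - p) * Ex P (h \o X).

Definition hsum n w := \sum_(1 <= k < n.+2) h (x k w).

(** With [h = id] this is the martingale of the walk. With [h = Num.norm] it is the counterpart for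
    absolute values, which supplies the moment bounds for the former and, up to a constant, is the
    mass studied in the critical case. *)
Definition mart n w := hsum n w / a n - drift * inv_sum n.

(** The new step minus its conditional mean given the first [n.+1] steps, on the scale [a n.+1] of
    the enlarged walk. *)
Definition incr n w :=
  (h (x n.+2 w) - rho * (hsum n w / n.+1%:R) - drift) / a n.+1.

Lemma h_intg : intg P (h \o X).
Proof.
apply: (intg_le (g := fun w => `|X w|)).
- exact: measurableT_comp.
- exact: intg_norm.
- by move=> w /=; rewrite hn.
Qed.

Lemma hsumS n w : hsum n.+1 w = hsum n w + h (x n.+2 w).
Proof. by rewrite /hsum big_nat_recr. Qed.

Lemma martS n w : mart n.+1 w = mart n w + incr n w.
Proof.
have an := a_gt0 n; have n0 : 0 < n.+1%:R :> R by rewrite ltr0n.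
have rn : 0 < n.+1%:R + rho by rewrite addr_gt0// rho_gt0.
have isS : inv_sum n.+1 = inv_sum n + (a n.+1)^-1 by rewrite /inv_sum big_nat_recr.
rewrite /mart /incr hsumS isS growthS.
by field; rewrite !nat1r !gt_eqF.
Qed.

Lemma mart0 w : mart 0 w = h (x 1%N w).
Proof.
by rewrite /mart /hsum /inv_sum big_nat1 growth1 big_geq// mulr0 subr0 divr1.
Qed.

Lemma known_hsum n : known (history n.+1) (hsum n).
Proof.
apply: known_sum => k; rewrite mem_index_iota => kn.
by apply: known_comp => //; exact: known_step.
Qed.

Lemma known_mart m n : (m <= n)%N -> known (history n.+1) (mart m).
Proof.
move=> mn; apply: (known_sub (@history_le m.+1 n.+1 mn)).
apply: knownB; last exact: known_cst.
by apply: knownM; [exact: known_hsum|exact: known_cst].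
Qed.

Lemma norm_hsum n w : `|hsum n w| <= abs_sum n w.
Proof.
by apply: le_trans (ler_norm_sum _ _ _) _; apply: ler_sum => k _; rewrite hn.
Qed.

Lemma intg_h_step k : (1 <= k)%N -> intg P (fun w => h (x k w)).
Proof.
move=> k1; apply: (intg_le (g := fun w => `|x k w|)).
- by apply: measurableT_comp => //; exact: meas_step.
- exact: intg_abs_step.
- by move=> w; rewrite hn.
Qed.

Lemma intg_hsum n : intg P (hsum n).
Proof. by apply: (intg_range _).1 => k /andP[k1 _]; exact: intg_h_step. Qed.

Lemma intg_mart n : intg P (mart n).
Proof.
apply: intgB; last exact: intg_cst.
by apply: eq_intg (intgZ (a n)^-1 (intg_hsum n)) => w; rewrite mulrC.
Qed.

(** The martingale property in tested form. The test function is not assumed bounded, because it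
    will be a signed power of a martingale difference. *)
Lemma incr_mean0 n (W : T -> R) : known (history n.+1) W -> intg P W ->
  (forall k, (1 <= k < n.+2)%N -> intg P (fun w => W w * h (x k w))) ->
  intg P (fun w => W w * incr n w) /\ Ex P (fun w => W w * incr n w) = 0.
Proof.
move=> kW Wi Wk.
have [i E] := homogeneous_step inputs mh mg h0 hg kW Wi h_intg g_intg Wk.
have [si sE] := intg_range Wk.
have shE : (fun w => W w * hsum n w) =1 (fun w => \sum_(1 <= k < n.+2) W w * h (x k w)).
  by move=> w; rewrite /hsum mulr_sumr.
have shi : intg P (fun w => W w * hsum n w) by exact: eq_intg (fsym shE) si.
have i2 := intgZ (rho / n.+1%:R) shi; have i3 := intgZ drift Wi.
have i4 := intgB i i2; have i5 := intgB i4 i3; have i6 := intgZ (a n.+1)^-1 i5.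
have EE : (fun w => (a n.+1)^-1 * (W w * h (x n.+2 w) - rho / n.+1%:R * (W w * hsum n w)
    - drift * W w)) =1 (fun w => W w * incr n w).
  by move=> w; rewrite /incr; ring.
split; first exact: eq_intg EE i6.
rewrite -(eq_Ex P EE) ExZ// ExB// ExB// ExZ// ExZ// E (eq_Ex P shE) sE g_mean /drift.
ring.
Qed.

(** The bound no longer involves [h], so one moment estimate serves the identity and the absolute
    value. *)
Lemma incr_bound n w : `|incr n w| <=
  (`|x n.+2 w| + rho * (abs_sum n w / n.+1%:R) + (1 - p) * Ex P (fun w => `|X w|)) / a n.+1.
Proof.
rewrite /incr normrM normfV (gtr0_norm (a_gt0 _)) ler_wpM2r ?invr_ge0 ?(ltW (a_gt0 _))//.
apply: le_trans (ler_normB _ _) _; apply: lerD.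
  apply: le_trans (ler_normB _ _) _; rewrite hn lerD2l normrM (gtr0_norm rho_gt0).
  rewrite ler_wpM2l ?(ltW rho_gt0)// normrM normfV [`|n.+1%:R|]ger0_norm//.
  by rewrite ler_wpM2r ?norm_hsum// invr_ge0.
rewrite /drift normrM ger0_norm ?subr_ge0// ler_wpM2l ?subr_ge0//.
apply: le_trans (Ex_norm h_intg) _; rewrite le_eqVlt; apply/orP; left; apply/eqP.
by apply: eq_Ex => w'; rewrite /= hn.
Qed.

End Homogeneous.

Section Exponent.
Variable r : R.
Hypothesis r_gt1 : 1 < r.
Hypothesis Xr : intg P (fun w => `|X w| `^ r).
Hypothesis xir : intg P (fun w => `|xi w| `^ r).
Hypothesis echo_moment : p * Ex P (fun w => `|xi w| `^ r) < r * rho.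

Lemma r_gt0 : 0 < r. Proof. exact: lt_trans r_gt1. Qed.

(** A midpoint: at least 1 and strictly above [p m_r], as [moment_sum_growth] requires, yet strictly
    below [r rho], which leaves the surplus [c]. *)
Let kappa := (Num.max 1 (p * Ex P (fun w => `|xi w| `^ r)) + r * rho) / 2.
Let c := r * rho - kappa.

Lemma kappa_bounds : [/\ 1 <= kappa, p * Ex P (fun w => `|xi w| `^ r) < kappa & 0 < c].
Proof.
have rr : 1 < r * rho.
  by apply: (lt_trans r_gt1); rewrite ltr_pMr// r_gt0.
rewrite /c /kappa.
move: echo_moment; set m := p * _ => em.
have m1 : 1 <= Num.max 1 m by rewrite le_max lexx.
have mm : m <= Num.max 1 m by rewrite le_max lexx orbT.
have ml : Num.max 1 m < r * rho by rewrite gt_max rr.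
split; lra.
Qed.

Lemma abs_sum_ge0 n w : 0 <= abs_sum n w.
Proof. by apply: sumr_ge0. Qed.

Lemma abs_mean_pow n w : (abs_sum n w / n.+1%:R) `^ r <=
  (\sum_(1 <= k < n.+2) `|x k w| `^ r) / n.+1%:R.
Proof. by apply: (@powR_mean R r n (fun k => `|x k w|)) => //; exact: ltW. Qed.

Lemma meas_abs_sum n : measurable_fun setT (abs_sum n).
Proof.
apply: (@known_meas _ _ _ _ Xs eps U xis (history n.+1)).
apply: known_sum => k; rewrite mem_index_iota => kn.
by apply: (known_comp (@normr_measurable R setT)); exact: known_step.
Qed.

Lemma intg_abs_sum n : intg P (fun w => abs_sum n w `^ r).
Proof.
apply: (intg_le (g := fun w => n.+1%:R `^ r / n.+1%:R * \sum_(1 <= k < n.+2) `|x k w| `^ r)).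
- exact: (measurableT_comp (measurable_powR _) (meas_abs_sum n)).
- by apply: intgZ; exact: (intg_moment_sum inputs r_gt0 Xr xir).
- move=> w; rewrite ger0_norm ?powR_ge0//.
  have n0 : 0 < n.+1%:R :> R by rewrite ltr0n.
  rewrite -{1}(divfK (lt0r_neq0 n0) (abs_sum n w)) powRM ?divr_ge0 ?abs_sum_ge0//.
  rewrite mulrC -mulrA ler_wpM2l ?powR_ge0//.
  by apply: le_trans (abs_mean_pow n w) _; rewrite mulrC.
Qed.

(** The moment sum is of order at most [n^kappa], a uniformly chosen parent divides it by [n], and
    the scale contributes [n^(- r rho)]; the resulting exponent is [kappa - 1 - r rho = - (1 + c)],
    which is summable. *)
Lemma norm_incr_moment : exists2 C : R, 0 <= C &
  forall n (D : T -> R), measurable_fun setT D ->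
  (forall w, `|D w| <= (`|x n.+2 w| + rho * (abs_sum n w / n.+1%:R)
     + (1 - p) * Ex P (fun w => `|X w|)) / a n.+1) ->
  intg P (fun w => `|D w| `^ r) /\
  Ex P (fun w => `|D w| `^ r) <= C * n.+1%:R `^ (- (1 + c)).
Proof.
have [k1 kp c0] := kappa_bounds.
have [K K0 HK] := moment_sum_growth inputs p_gt0 p_le1 r_gt0 Xr xir k1 kp.
set mr := Ex P (fun w => `|xi w| `^ r) in kp *.
set Xm := Ex P (fun w => `|X w| `^ r).
set c1 := (1 - p) * Ex P (fun w => `|X w|).
have mr0 : 0 <= mr by apply: Ex_ge0 => w; exact: powR_ge0.
have Xm0 : 0 <= Xm by apply: Ex_ge0 => w; exact: powR_ge0.
have c10 : 0 <= c1 by rewrite /c1 mulr_ge0 ?subr_ge0//; exact: Ex_ge0.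
pose G := Gamma_fun (1 + rho).
have G1 : 1 <= G by apply: Gamma_fun1D_ge1; exact: ltW.
have rr0 := ltW r_gt0.
(* Two uses of [powR_addl] separate the three summands of the bound on [D]. *)
pose L := 2 `^ r * 2 `^ r.
have L0 : 0 <= L by rewrite mulr_ge0 ?powR_ge0.
have two : 1 <= 2 `^ r :> R.
  have : 1 `^ r <= 2 `^ r :> R by apply: ge0_ler_powR; rewrite ?nnegrE//; lra.
  by rewrite powR1.
pose C := L * (((1 - p) * Xm + c1 `^ r) + (p * mr + rho `^ r) * K) * G `^ r.
have S0 : 0 <= (1 - p) * Xm + c1 `^ r.
  by rewrite addr_ge0 ?powR_ge0// mulr_ge0// subr_ge0.
have S1 : 0 <= p * mr + rho `^ r by exact: (addr_ge0 (mulr_ge0 (ltW p_gt0) mr0) (powR_ge0 _ _)).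
have C0 : 0 <= C.
  by rewrite /C mulr_ge0 ?powR_ge0// mulr_ge0// addr_ge0// mulr_ge0.
exists C => // n D mD HD.
have n0 : 0 < n.+1%:R :> R by rewrite ltr0n.
have n1 : 1 <= n.+1%:R :> R by rewrite ler1n.
have an := a_gt0 n.+1.
pose V w := \sum_(1 <= k < n.+2) `|x k w| `^ r.
have Vi : intg P V by exact: (intg_moment_sum inputs r_gt0 Xr xir).
have xi2 : intg P (fun w => `|x n.+2 w| `^ r) by exact: (intg_step inputs r_gt0 Xr xir).
pose B w := (a n.+1) `^ (- r) * L * (`|x n.+2 w| `^ r + rho `^ r / n.+1%:R * V w + c1 `^ r).
have Bi : intg P B.
  apply: intgZ; apply: intgD; last exact: intg_cst.
  by apply: intgD => //; exact: intgZ.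
have DB w : `|D w| `^ r <= B w.
  set u := `|x n.+2 w|; set v := rho * (abs_sum n w / n.+1%:R).
  have u0 : 0 <= u by exact: normr_ge0.
  have v0 : 0 <= v by rewrite mulr_ge0 ?(ltW rho_gt0)// divr_ge0 ?abs_sum_ge0.
  have s0 : 0 <= u + v + c1 by rewrite !addr_ge0.
  apply: (@le_trans _ _ (((u + v + c1) / a n.+1) `^ r)).
    by apply: ge0_ler_powR; rewrite ?nnegrE ?divr_ge0 ?(ltW an).
  rewrite powRM ?invr_ge0 ?(ltW an)// powR_inv ?(ltW an)// -powRN mulrC /B -mulrA.
  rewrite ler_wpM2l ?powR_ge0//.
  apply: le_trans (powR_addl rr0 (addr_ge0 u0 v0) c10) _.
  rewrite /L -mulrA ler_wpM2l ?powR_ge0// mulrDr; apply: lerD; last first.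
    by rewrite ler_peMl// powR_ge0.
  apply: le_trans (powR_addl rr0 u0 v0) _; rewrite ler_wpM2l ?powR_ge0// lerD2l.
  rewrite powRM ?(ltW rho_gt0)//; last by rewrite divr_ge0 ?abs_sum_ge0.
  by rewrite -mulrA ler_wpM2l ?powR_ge0// [leRHS]mulrC; exact: abs_mean_pow.
have Di : intg P (fun w => `|D w| `^ r).
  apply: (intg_le _ Bi); first exact: (measurableT_comp (@measurable_norm_powR R r) mD).
  by move=> w; rewrite ger0_norm ?powR_ge0.
split => //; apply: le_trans (Ex_le Di Bi DB) _.
have VE : Ex P V = moment_sum Xs eps U xis r n by [].
have V0 : 0 <= moment_sum Xs eps U xis r n.
  by apply: Ex_ge0 => w; apply: sumr_ge0 => k _; exact: powR_ge0.
have xE : Ex P (fun w => `|x n.+2 w| `^ r) =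
    (1 - p) * Xm + p * mr / n.+1%:R * moment_sum Xs eps U xis r n.
  have [||_] := @power_step _ _ _ _ _ _ _ _ _ _ _ inputs r r_gt0 Xr xir n (fun=> 1) _ (intg_cst P 1).
  - exact: known_cst.
  - move=> k /andP[kk _]; apply: eq_intg (intg_step inputs r_gt0 Xr xir kk) => w.
    by rewrite mul1r.
  rewrite (eq_Ex P (g := fun w => `|x n.+2 w| `^ r)); last by move=> w; rewrite mul1r.
  move=> ->; rewrite Ex_cst mulr1 -VE (intg_range _).2; last first.
    by move=> k /andP[kk _]; exact: (intg_step inputs r_gt0 Xr xir kk).
  congr (_ + _ * _); apply: eq_bigr => k _; apply: eq_Ex => w; by rewrite mul1r.
have BE : Ex P B = a n.+1 `^ (- r) * L *
    (((1 - p) * Xm + c1 `^ r) + (p * mr + rho `^ r) * (moment_sum Xs eps U xis r n / n.+1%:R)).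
  rewrite /B ExZ; last first.
    by apply: intgD; [apply: intgD => //; exact: intgZ|exact: intg_cst].
  rewrite ExD; [|by apply: intgD => //; exact: intgZ|exact: intg_cst].
  rewrite ExD//; last exact: intgZ.
  by rewrite ExZ// Ex_cst xE VE; ring.
rewrite BE.
have nk : 1 <= n.+1%:R `^ (kappa - 1) :> R.
  by rewrite -[leLHS](powRr0 n.+1%:R); apply: ler_powR => //; lra.
have VK : moment_sum Xs eps U xis r n / n.+1%:R <= K * n.+1%:R `^ (kappa - 1).
  rewrite ler_pdivrMr//; apply: le_trans (HK n) _; rewrite -mulrA ler_wpM2l//.
  by rewrite [leRHS]mulrC mulr_powRB1//; lra.
have bracket : ((1 - p) * Xm + c1 `^ r) + (p * mr + rho `^ r) *
    (moment_sum Xs eps U xis r n / n.+1%:R) <=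
    (((1 - p) * Xm + c1 `^ r) + (p * mr + rho `^ r) * K) * n.+1%:R `^ (kappa - 1).
  rewrite [leRHS]mulrDl; apply: lerD; first by rewrite ler_peMr.
  by rewrite -mulrA ler_wpM2l.
have aG : a n.+1 `^ (- r) <= G `^ r * n.+1%:R `^ (- (r * rho)).
  have -> : G `^ r * n.+1%:R `^ (- (r * rho)) = (n.+1%:R `^ rho / G) `^ (- r).
    have G0 : 0 <= G by lra.
    have E : (n.+1%:R `^ rho / G) `^ r = n.+1%:R `^ (r * rho) / G `^ r.
      by rewrite powRM ?powR_ge0 ?invr_ge0// powR_inv// -powRrM mulrC [rho * r]mulrC mulrC.
    by rewrite [RHS]powRN E invf_div powRN.
  rewrite !powRN lef_pV2 ?posrE ?powR_gt0// ?divr_gt0 ?powR_gt0//; last lra.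
  apply: ge0_ler_powR; rewrite ?nnegrE ?(ltW an)//.
    by rewrite divr_ge0 ?powR_ge0//; lra.
  apply: le_trans (growth_lower _ (ltW rho_gt1)) _.
  rewrite growthS ler_peMr ?(ltW (a_gt0 _))//.
  by rewrite lerDl divr_ge0// ltW// rho_gt0.
apply: (@le_trans _ _ (G `^ r * n.+1%:R `^ (- (r * rho)) * L *
   ((((1 - p) * Xm + c1 `^ r) + (p * mr + rho `^ r) * K) * n.+1%:R `^ (kappa - 1)))).
  apply: ler_pM => //.
  - by rewrite mulr_ge0 ?powR_ge0.
  - by rewrite addr_ge0// mulr_ge0// divr_ge0.
  - by rewrite ler_wpM2r.
rewrite le_eqVlt; apply/orP; left; apply/eqP.
have -> : n.+1%:R `^ (- (1 + c)) = n.+1%:R `^ (- (r * rho)) * n.+1%:R `^ (kappa - 1).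
  rewrite -powRD ?(gt_eqF n0) ?implybT//; congr (_ `^ _); rewrite /c; ring.
by rewrite /C; ring.
Qed.

End Exponent.
End Martingale.

(** * Moment recursion for martingale differences *)

Section MartingaleMoments.
Context (d : measure_display) (T : measurableType d) (R : realType).
Variable P : probability T R.
Variables (p : R) (X xi : {RV P >-> R}).
Variables (Xs : nat -> {RV P >-> R}) (eps : nat -> {RV P >-> bool})
  (U : nat -> {RV P >-> nat}) (xis : nat -> {RV P >-> R}).
Hypothesis inputs : rwes_inputs Xs eps U xis p X xi.
Hypothesis p_gt0 : 0 < p.
Hypothesis p_le1 : p <= 1.
Variable rho : R.
Hypothesis rho_gt1 : 1 < rho.
Hypothesis rhoE : rho = p * Ex P (fun w => `|xi w|).
Hypothesis X_intg : intg P X.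
Hypothesis xi_intg : intg P xi.

Local Notation x := (echoed_step Xs eps U xis).
Local Notation known := (known Xs eps U xis).
Local Notation a n := (growth rho n.+1).
Local Notation mart := (mart p X Xs eps U xis rho).
Local Notation incr := (incr p X Xs eps U xis rho).
Local Notation abs_sum := (abs_sum Xs eps U xis).

Definition homogeneous_pair (h g : R -> R) : Prop :=
  [/\ [/\ measurable_fun setT h, measurable_fun setT g, h 0 = 0,
          (forall c y, h (c * y) = g c * h y) & (forall y, `|h y| = `|y|)],
      intg P (g \o xi) & p * Ex P (g \o xi) = rho].

Lemma abs_pair : homogeneous_pair Num.norm Num.norm.
Proof.
split => //; last exact: intg_norm.
by split => //; [exact: normr0|exact: normrM|move=> y; rewrite normr_id].
Qed.

Section Exponent.
Variable r : R.
Hypothesis r_gt1 : 1 < r.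
Hypothesis Xr : intg P (fun w => `|X w| `^ r).
Hypothesis xir : intg P (fun w => `|xi w| `^ r).
Hypothesis echo_moment : p * Ex P (fun w => `|xi w| `^ r) < r * rho.

Definition scaled_moment n := Ex P (fun w => (abs_sum n w / a n) `^ r).

Lemma intg_scaled n : intg P (fun w => (abs_sum n w / a n) `^ r).
Proof.
have an := a_gt0 rho_gt1 n.
apply: eq_intg (intgZ ((a n)^-1 `^ r) (intg_abs_sum inputs r_gt1 Xr xir n)) => w.
by rewrite mulrC -powRM ?abs_sum_ge0 ?invr_ge0 ?(ltW an).
Qed.

(** Given the past, [|x n.+2|] has mean [rho * abs_sum / n.+1] plus a constant, the same quantity
    that the bound on the increment already contains; hence the factor 2. The order [1/n] obtained
    here is not summable: the extra factor [e] of [power_expansion] has to help. *)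
Lemma weighted_incr n (h : R -> R) (N : T -> R) : (exists g, homogeneous_pair h g) ->
  known (history n.+1) N -> intg P (fun w => `|N w| `^ r) ->
  intg P (fun w => `|incr h n w| `^ r) ->
  intg P (fun w => `|N w| `^ (r - 1) * `|incr h n w|) /\
  Ex P (fun w => `|N w| `^ (r - 1) * `|incr h n w|) <=
    2 * (rho + (1 - p) * Ex P (fun w => `|X w|)) / n.+1%:R *
    (Ex P (fun w => `|N w| `^ r) + scaled_moment n + 1).
Proof.
have slack (z1 z2 z3 z4 : R) : 0 <= z2 -> 0 <= z4 -> z1 + z3 <= z1 + z2 + z3 + z4 by lra.
move=> [g [[mh mg h0 hg hn] gi gm]] kN Ni Di.
have r1 : 1 < r := r_gt1.
have rr : 0 <= r - 1 <= r by apply/andP; split; lra.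
have rho0 := rho_gt0 rho_gt1.
have an := a_gt0 rho_gt1 n; have an1 := a_gt0 rho_gt1 n.+1.
have n0 : 0 < n.+1%:R :> R by rewrite ltr0n.
set c1 := (1 - p) * Ex P (fun w => `|X w|).
have c10 : 0 <= c1 by rewrite /c1 mulr_ge0 ?subr_ge0//; exact: Ex_ge0.
pose W w := `|N w| `^ (r - 1).
have W0 w : 0 <= W w by exact: powR_ge0.
have kW : known (history n.+1) W by exact: (known_comp (@measurable_norm_powR R (r - 1))).
have mW := known_meas kW.
have mD : measurable_fun setT (incr h n).
  have m1 := known_meas (@known_mart _ _ _ _ p X Xs eps U xis rho h mh n.+1 n.+1 (leqnn _)).
  have m2 := known_meas (@known_mart _ _ _ _ p X Xs eps U xis rho h mh n n (leqnn _)).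
  rewrite (_ : incr h n = fun w => mart h n.+1 w - mart h n w); first exact: measurable_funB.
  by apply/funext => w; rewrite (martS p X Xs eps U xis rho_gt1) addrAC subrr add0r.
have WDi : intg P (fun w => W w * `|incr h n w|).
  apply: (intg_le _ (intgD Ni Di)).
    by apply: measurable_funM => //; exact: measurableT_comp.
  move=> w; rewrite ger0_norm ?mulr_ge0//.
  by apply: (le_trans (powR_young (ltW r_gt1) (normr_ge0 _) (normr_ge0 _))).
have Wi : intg P W.
  apply: (intg_le _ (intgD (intg_cst P 1) Ni)) => // w.
  by rewrite ger0_norm//; exact: (powR_le_1D rr (normr_ge0 _)).
have xr k : (1 <= k)%N -> intg P (fun w => `|x k w| `^ r).
  exact: (intg_step inputs (r_gt0 r_gt1) Xr xir).
have Wxi k : (1 <= k < n.+2)%N -> intg P (fun w => W w * `|x k w|).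
  move=> /andP[k1 _]; apply: (intg_le _ (intgD Ni (xr _ k1))).
    by apply: measurable_funM => //; apply: measurableT_comp => //; exact: meas_step.
  move=> w; rewrite ger0_norm ?mulr_ge0//.
  by apply: (le_trans (powR_young (ltW r_gt1) (normr_ge0 _) (normr_ge0 _))).
have Xai : intg P (Num.norm \o X) by exact: intg_norm.
have xiai : intg P (Num.norm \o xi) by exact: intg_norm.
have [W2i W2E] := @homogeneous_step _ _ _ _ _ _ _ _ _ _ _ inputs n W Num.norm Num.norm
   (@normr_measurable R setT) (@normr_measurable R setT) (normr0 _) (@normrM _) kW Wi Xai xiai Wxi.
have WSi : intg P (fun w => W w * abs_sum n w) /\
    Ex P (fun w => W w * abs_sum n w) = \sum_(1 <= k < n.+2) Ex P (fun w => W w * `|x k w|).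
  have [i E] := intg_range Wxi.
  have EE : (fun w => \sum_(1 <= k < n.+2) W w * `|x k w|) =1 (fun w => W w * abs_sum n w).
    by move=> w; rewrite /abs_sum mulr_sumr.
  by split; [exact: eq_intg EE i|rewrite -(eq_Ex P EE)].
have {WSi}[WSi WSE] := WSi.
have W2E' : Ex P (fun w => W w * `|x n.+2 w|) = c1 * Ex P W + rho / n.+1%:R * Ex P (fun w => W w * abs_sum n w).
  have xE : p * Ex P (Num.norm \o xi) = rho by rewrite rhoE.
  rewrite W2E WSE xE.
  by rewrite /c1 [Ex P (Num.norm \o X)](_ : _ = Ex P (fun w => `|X w|))//; ring.
(* On the scale [a n], Young's inequality turns the product of [|N|^(r - 1)] and the mass into two
   moments of order [r]. *)
have WSle : Ex P (fun w => W w * abs_sum n w) <= a n * (Ex P (fun w => `|N w| `^ r) + scaled_moment n).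
  rewrite /scaled_moment -ExD//; last exact: intg_scaled.
  rewrite -ExZ; last by apply: intgD => //; exact: intg_scaled.
  apply: Ex_le => //; first by apply: intgZ; apply: intgD => //; exact: intg_scaled.
  move=> w; have S0 : 0 <= abs_sum n w / a n by rewrite divr_ge0 ?abs_sum_ge0 ?(ltW an).
  have := powR_young (ltW r_gt1) (normr_ge0 (N w)) S0.
  rewrite -(ler_pM2l an) => /(le_trans _); apply.
  by rewrite mulrCA [a n * _]mulrC divfK ?gt_eqF.
have Wle : Ex P W <= 1 + Ex P (fun w => `|N w| `^ r).
  rewrite -[X in _ <= X + _](Ex_cst P 1) -ExD//; last exact: intg_cst.
  apply: Ex_le => //; first by apply: intgD => //; exact: intg_cst.
  by move=> w; exact: (powR_le_1D rr (normr_ge0 _)).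
split => //.
pose B w := (a n.+1)^-1 * (W w * `|x n.+2 w| + rho / n.+1%:R * (W w * abs_sum n w) + c1 * W w).
have i1 := intgZ (rho / n.+1%:R) WSi; have i2 := intgD W2i i1; have i3 := intgZ c1 Wi.
have i4 := intgD i2 i3; have Bi : intg P B by exact: intgZ.
apply: (@le_trans _ _ (Ex P B)).
  apply: Ex_le => // w; apply: (@le_trans _ _ (W w * ((`|x n.+2 w| + rho * (abs_sum n w / n.+1%:R) + c1) / a n.+1))).
    by apply: ler_wpM2l => //; exact: incr_bound.
  by rewrite /B le_eqVlt; apply/orP; left; apply/eqP; ring.
have BE : Ex P B = (a n.+1)^-1 * (2 * (rho / n.+1%:R) * Ex P (fun w => W w * abs_sum n w) + 2 * c1 * Ex P W).
  by rewrite /B ExZ// ExD// ExD// ExZ// ExZ// W2E'; ring.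
rewrite BE.
set E := Ex P (fun w => `|N w| `^ r).
have E0 : 0 <= E by apply: Ex_ge0 => w; exact: powR_ge0.
have s0 : 0 <= scaled_moment n by apply: Ex_ge0 => w; exact: powR_ge0.
have aa : a n <= a n.+1.
  by rewrite growthS ler_peMr ?(ltW an)// lerDl divr_ge0 ?(ltW rho0).
(* The growth is at least linear, so the contribution of the spins is also of order [1/n]. *)
have na : n.+1%:R <= a n.+1.
  apply: le_trans (growth_ge_nat n.+1 (ltW rho_gt1)); by rewrite ler_nat.
have V1 : (a n.+1)^-1 * (a n) <= 1 by rewrite mulrC ler_pdivrMr// mul1r.
have V2 : (a n.+1)^-1 <= n.+1%:R^-1 by rewrite lef_pV2 ?posrE.
have V0 : 0 < (a n.+1)^-1 by rewrite invr_gt0.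
have T1 : (a n.+1)^-1 * (2 * (rho / n.+1%:R) * Ex P (fun w => W w * abs_sum n w)) <=
    2 * (rho / n.+1%:R) * (E + scaled_moment n).
  rewrite mulrCA; apply: ler_wpM2l; first by apply: mulr_ge0 => //; apply: divr_ge0 => //; exact: ltW.
  apply: (le_trans (ler_wpM2l (ltW V0) WSle)).
  by rewrite mulrA; exact: (ler_piMl (addr_ge0 E0 s0) V1).
have T2 : (a n.+1)^-1 * (2 * c1 * Ex P W) <= 2 * c1 / n.+1%:R * (1 + E).
  rewrite mulrCA -[leRHS]mulrA; apply: ler_wpM2l; first exact: mulr_ge0.
  exact: (ler_pM (ltW V0) (Ex_ge0 P W0) V2 Wle).
rewrite mulrDr; apply: le_trans (lerD T1 T2) _.
have nV : 0 < n.+1%:R^-1 :> R by rewrite invr_gt0.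
have k1 : 0 <= rho / n.+1%:R by rewrite divr_ge0 ?(ltW rho0).
have k2 : 0 <= c1 / n.+1%:R * scaled_moment n by rewrite mulr_ge0// divr_ge0.
have -> : 2 * (rho + c1) / n.+1%:R * (E + scaled_moment n + 1) =
  2 * (rho / n.+1%:R) * (E + scaled_moment n) + 2 * (rho / n.+1%:R)
  + 2 * c1 / n.+1%:R * (1 + E) + 2 * (c1 / n.+1%:R * scaled_moment n) by ring.
exact: slack (mulr_ge0 _ k1) (mulr_ge0 _ k2).
Qed.

(** The linear term of [power_expansion] vanishes by [incr_mean0]. The constants do not depend on
    [n], [h] or [Z]: the choice [Z = 0] will give bounded moments, and [Z] an earlier value of the
    martingale the Cauchy property. *)
Lemma moment_step : exists2 C : R, 0 <= C & exists2 c : R, 0 < c &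
  forall n (h : R -> R) (Z : T -> R), (exists g, homogeneous_pair h g) ->
    known (history n.+1) Z -> intg P (fun w => `|mart h n w - Z w| `^ r) ->
    intg P (fun w => `|mart h n.+1 w - Z w| `^ r) /\
    Ex P (fun w => `|mart h n.+1 w - Z w| `^ r) <=
      Ex P (fun w => `|mart h n w - Z w| `^ r) + C * n.+1%:R `^ (- (1 + c)) *
      (Ex P (fun w => `|mart h n w - Z w| `^ r) + scaled_moment n + 1).
Proof.
have [CD CD0 HD] := norm_incr_moment inputs p_gt0 p_le1 rho_gt1 r_gt1 Xr xir echo_moment.
have [_ _] := kappa_bounds rho_gt1 r_gt1 echo_moment.
set c := r * rho - _ in HD *; move=> c0.
have r0 := r_gt0 r_gt1; have rho0 := rho_gt0 rho_gt1.
have r1 : 1 < r := r_gt1.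
pose C0 := power_expansion_const r.
have C00 : 0 <= C0.
  rewrite /C0 /power_expansion_const addr_ge0 ?(ltW r0)// addr_ge0 ?powR_ge0//.
  apply: mulr_ge0; [exact: ltW|apply: mulr_ge0; [lra|by rewrite addr_ge0 ?powR_ge0]].
set c1 := (1 - p) * Ex P (fun w => `|X w|).
have c10 : 0 <= c1 by rewrite /c1 mulr_ge0 ?subr_ge0//; exact: Ex_ge0.
(* With [e] of order [n^(-c')] the cross term is of order [n^(-(1 + c'))], while [e^(-r)] is of
   order [n^(c/2)] and turns the bound [n^(-(1 + c))] into [n^(-(1 + c/2))]; both are summable. *)
pose c' := c / (2 * r).
have c'0 : 0 < c' by rewrite divr_gt0// mulr_gt0.
exists (C0 * (rho + c1) + C0 * 2 `^ r * CD).
  apply: addr_ge0; last by rewrite !mulr_ge0 ?powR_ge0.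
  by apply: mulr_ge0 => //; apply: addr_ge0 => //; exact: ltW.
exists c' => // n h Z hp kZ Ni.
have [g [[mh mg h0 hg hn] gi gm]] := hp.
pose N w := mart h n w - Z w; pose D w := incr h n w.
have kN : known (history n.+1) N by apply: knownB => //; exact: known_mart.
have mN := known_meas kN.
have mD : measurable_fun setT D.
  have m1 := known_meas (@known_mart _ _ _ _ p X Xs eps U xis rho h mh n.+1 n.+1 (leqnn _)).
  have m2 := known_meas (@known_mart _ _ _ _ p X Xs eps U xis rho h mh n n (leqnn _)).
  rewrite (_ : D = fun w => mart h n.+1 w - mart h n w); first exact: measurable_funB.
  by apply/funext => w; rewrite (martS p X Xs eps U xis rho_gt1) addrAC subrr add0r.
have [Di DE] := HD n D mD (incr_bound Xs eps U xis p_le1 rho_gt1 X_intg mh hn n).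
have [WDi WDE] := weighted_incr hp kN Ni Di.
have n0 : 0 < n.+1%:R :> R by rewrite ltr0n.
have n1 : 1 <= n.+1%:R :> R by rewrite ler1n.
pose e := n.+1%:R `^ (- c') / 2.
have pc' : 0 < n.+1%:R `^ (- c') :> R by exact: powR_gt0.
have e0 : 0 < e by rewrite divr_gt0.
have e2 : e <= 2^-1.
  rewrite /e ler_piMl ?invr_ge0// powRN invf_le1 ?powR_gt0//.
  by rewrite -[leLHS](powRr0 n.+1%:R); apply: ler_powR => //; exact: ltW.
(* The derivative of [|N|^r] up to the factor [r]: a function of the past, hence orthogonal to the
   increment. *)
pose W w := sgpow (r - 1) (N w).
have r10 : 0 < r - 1 by lra.
have kW : known (history n.+1) W by apply: known_comp kN; exact: measurable_sgpow.
have WN w : `|W w| = `|N w| `^ (r - 1) by exact: norm_sgpow.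
have Wi : intg P W.
  apply: (intg_le (known_meas kW) (intgD (intg_cst P 1) Ni)) => w.
  by rewrite WN; apply: powR_le_1D => //; apply/andP; split; lra.
have Wxi k : (1 <= k < n.+2)%N -> intg P (fun w => W w * h (x k w)).
  move=> /andP[k1 _]; apply: (intg_le _ (intgD Ni (intg_step inputs r0 Xr xir k1))).
    apply: measurable_funM; first exact: known_meas kW.
    by apply: measurableT_comp => //; exact: meas_step.
  move=> w; rewrite normrM WN hn.
  by apply: powR_young => //; exact: ltW.
have [W1i W1E] := incr_mean0 inputs X_intg mh mg h0 hg hn gi gm kW Wi Wxi.
pose B w := `|N w| `^ r + r * (W w * D w) + C0 * e * (`|N w| `^ (r - 1) * `|D w|)
  + C0 * e `^ (- r) * `|D w| `^ r.
have j1 := intgZ r W1i; have j2 := intgD Ni j1; have j3 := intgZ (C0 * e) WDi.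
have j4 := intgD j2 j3; have j5 := intgZ (C0 * e `^ (- r)) Di.
have Bi : intg P B by exact: intgD.
have ND w : mart h n.+1 w - Z w = N w + D w.
  by rewrite (martS p X Xs eps U xis rho_gt1) /N /D; ring.
have NDB w : `|mart h n.+1 w - Z w| `^ r <= B w.
  rewrite ND; have e12 : 0 < e <= 2^-1 by rewrite e0 e2.
  apply: (le_trans (power_expansion (N w) (D w) r_gt1 e12)). by rewrite /B /W [r * (_ * D w)]mulrA.
have NDi : intg P (fun w => `|mart h n.+1 w - Z w| `^ r).
  apply: (intg_le _ Bi).
    apply: (measurableT_comp (@measurable_norm_powR R r)).
    apply: measurable_funB; last exact: known_meas kZ.
    exact: known_meas (@known_mart _ _ _ _ p X Xs eps U xis rho h mh n.+1 n.+1 (leqnn _)).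
  by move=> w; rewrite ger0_norm ?powR_ge0.
split => //; apply: le_trans (Ex_le NDi Bi NDB) _.
have BE : Ex P B = Ex P (fun w => `|N w| `^ r)
    + C0 * e * Ex P (fun w => `|N w| `^ (r - 1) * `|D w|) + C0 * e `^ (- r) * Ex P (fun w => `|D w| `^ r).
  by rewrite /B ExD// ExD// ExD// ExZ// ExZ// ExZ// W1E mulr0 addr0.
rewrite BE -/N; set E := Ex P (fun w => `|N w| `^ r).
have E0 : 0 <= E by apply: Ex_ge0 => w; exact: powR_ge0.
have s0 : 0 <= scaled_moment n by apply: Ex_ge0 => w; exact: powR_ge0.
set s := scaled_moment n in s0 WDE *.
set u := n.+1%:R `^ (- (1 + c')).
have uE : u = n.+1%:R `^ (- c') / n.+1%:R.
  rewrite /u (_ : - (1 + c') = - c' - 1); last ring.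
  by rewrite powRB ?powRr1// (gt_eqF n0) implybT.
have T1 : C0 * e * Ex P (fun w => `|N w| `^ (r - 1) * `|D w|) <= C0 * (rho + c1) * u * (E + s + 1).
  apply: (@le_trans _ _ (C0 * e * (2 * (rho + c1) / n.+1%:R * (E + s + 1)))).
    by rewrite ler_wpM2l// mulr_ge0// ltW.
  by rewrite uE /e le_eqVlt; apply/orP; left; apply/eqP; field; rewrite nat1r gt_eqF.
have eE : e `^ (- r) = 2 `^ r * n.+1%:R `^ (c / 2).
  rewrite powRN /e powRM ?(ltW pc') ?invr_ge0// powR_inv// invfM invrK mulrC; congr (_ * _).
  rewrite -powRrM -powRN; congr (_ `^ _); rewrite /c'; field; exact: lt0r_neq0.
have u2 : n.+1%:R `^ (c / 2) * n.+1%:R `^ (- (1 + c)) <= u.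
  rewrite -powRD ?(gt_eqF n0) ?implybT//; apply: ler_powR => //.
  have : c' <= c / 2.
    rewrite /c' ler_pM2l// lef_pV2 ?posrE ?mulr_gt0//; by rewrite ler_peMr// ltW.
  have -> : c / 2 + - (1 + c) = - (1 + c / 2) by field.
  by rewrite lerN2 lerD2l.
have T2 : C0 * e `^ (- r) * Ex P (fun w => `|D w| `^ r) <= C0 * 2 `^ r * CD * u.
  apply: (@le_trans _ _ (C0 * e `^ (- r) * (CD * n.+1%:R `^ (- (1 + c))))).
    by rewrite ler_wpM2l// mulr_ge0 ?powR_ge0.
  rewrite eE [leLHS](_ : _ = C0 * 2 `^ r * CD * (n.+1%:R `^ (c / 2) * n.+1%:R `^ (- (1 + c)))); last ring.
  by rewrite ler_wpM2l// !mulr_ge0 ?powR_ge0.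
have u0 : 0 <= u by exact: powR_ge0.
have T3 : C0 * 2 `^ r * CD * u <= C0 * 2 `^ r * CD * u * (E + s + 1).
  apply: ler_peMr; last by rewrite lerDr; exact: addr_ge0.
  apply: mulr_ge0 => //; apply: mulr_ge0 => //; apply: mulr_ge0; [exact: C00|exact: powR_ge0].
rewrite -addrA lerD2l [X in _ <= X * _]mulrDl [leRHS]mulrDl; apply: lerD => //.
exact: le_trans T3.
Qed.

End Exponent.
End MartingaleMoments.

(** * Maximal inequalities *)

Section AlmostSure.
Context (d : measure_display) (T : measurableType d) (R : realType).
Variable P : probability T R.

(** For each [j] the intersection over [m] is null. It converts probability bounds for exceeding the
    level of index [j] after time [m] into an almost sure statement. *)
Lemma ae_exists_notin (E : nat -> nat -> set T) :
  (forall j m, measurable (E j m)) ->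
  (forall j (e : R), 0 < e -> exists m, (P (E j m) <= e%:E)%E) ->
  {ae P, forall w, forall j, exists m, ~ E j m w}.
Proof.
move=> mE HE; apply: ae_foralln => j.
have m0 : measurable (\bigcap_m E j m) by exact: bigcapT_measurable.
exists (\bigcap_m E j m); split => //.
  apply/eqP; rewrite eq_le measure_ge0 andbT; apply/lee_addgt0Pr => e e0.
  have [m Pm] := HE j e e0; rewrite add0e; apply: le_trans Pm.
  by apply: le_measure; rewrite ?inE//; exact: bigcap_inf.
move=> w /= nE m _; apply: contrapT => nEm; apply: nE; by exists m.
Qed.

Section Maximal.
Variables (Z : nat -> T -> R) (lambda : R) (m : nat).
Hypothesis lambda_gt0 : 0 < lambda.

Definition below (z : R) : R := (z < lambda)%R%:R.

(** Indicator that [Z] stays below [lambda] from time [m] to time [n]. As a product it is updated by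
    one factor per step and is visibly a function of the past. *)
Definition calm n w : R := \prod_(m <= k < n.+1) below (Z k w).

Lemma measurable_below : measurable_fun setT below.
Proof.
rewrite (_ : below = \1_[set z | z < lambda]); last first.
  apply/funext => z; rewrite indicE /below; case: ltP => z_l.
    by rewrite mem_set.
  by rewrite memNset//=; apply/negP; rewrite -leNgt.
apply: measurable_indic.
by rewrite (_ : [set z | z < lambda] = `]-oo, lambda[%classic)//; exact: measurable_itv.
Qed.

Lemma below01 z : 0 <= below z <= 1.
Proof. by rewrite /below; case: (z < lambda); rewrite lexx ler01. Qed.

Lemma calm01 n w : 0 <= calm n w <= 1.
Proof.
apply/andP; split; first by apply: prodr_ge0 => k _; case/andP: (below01 (Z k w)).
by apply: prodr_ile1 => k _; exact: below01.
Qed.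

Lemma calmS n w : (m <= n.+1)%N -> calm n.+1 w = calm n w * below (Z n.+1 w).
Proof. by move=> mn; rewrite /calm big_nat_recr. Qed.

Lemma calmm w : calm m w = below (Z m w).
Proof. by rewrite /calm big_nat1. Qed.

Lemma calm_eq1 n w : (forall k, (m <= k <= n)%N -> Z k w < lambda) -> calm n w = 1.
Proof.
by move=> H; rewrite /calm big_nat big1// => k kn; rewrite /below H.
Qed.

Lemma calm_eq0 n w k : (m <= k <= n)%N -> lambda <= Z k w -> calm n w = 0.
Proof.
move=> kn Zk; rewrite /calm (bigD1_seq k) ?mem_index_iota ?iota_uniq//=.
by rewrite /below ltNge Zk mul0r.
Qed.

Hypothesis mZ : forall k, measurable_fun setT (Z k).
Hypothesis Zi : forall k, intg P (Z k).
Hypothesis Z0 : forall k w, 0 <= Z k w.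

Lemma meas_calm n : measurable_fun setT (calm n).
Proof.
rewrite /calm; elim: (index_iota m n.+1) => [|k s IH].
  rewrite (_ : (fun _ => _) = cst 1) //.
  by apply/funext => w; rewrite big_nil.
rewrite (_ : (fun _ => _) = (fun w => below (Z k w) * \prod_(k <- s) below (Z k w))); last first.
  by apply/funext => w; rewrite big_cons.
by apply: measurable_funM => //; exact: (measurableT_comp measurable_below).
Qed.

Lemma intg_calm n : intg P (calm n).
Proof.
apply: (intg_le (meas_calm n) (intg_cst P 1)) => w.
by case/andP: (calm01 n w) => ? ?; rewrite ger0_norm.
Qed.

Lemma intg_calmM n f : intg P f -> intg P (fun w => calm n w * f w).
Proof.
move=> fi; apply: (@intgMb _ _ _ _ _ _ 1) => //; first exact: meas_calm.
by move=> w; case/andP: (calm01 n w) => ? ?; rewrite ger0_norm.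
Qed.

Lemma intg_ncalmM n f : intg P f -> intg P (fun w => (1 - calm n w) * f w).
Proof.
move=> fi; apply: eq_intg (intgB fi (intg_calmM n fi)) => w; ring.
Qed.

(** Doob's inequality by induction on [n]: the part of the event that crosses at time [n.+1] carries
    values at least [lambda], and the part that crossed earlier does not lose mean. Only the test
    functions [1 - calm k] enter the hypothesis. *)
Lemma submartingale_maximal n : (m <= n)%N ->
  (forall k, (m <= k)%N -> Ex P (fun w => (1 - calm k w) * Z k w) <=
     Ex P (fun w => (1 - calm k w) * Z k.+1 w)) ->
  lambda * Ex P (fun w => 1 - calm n w) <= Ex P (Z n).
Proof.
move=> mn sub.
have ci k : intg P (fun w => 1 - calm k w) by apply: intgB; [exact: intg_cst|exact: intg_calm].
have key : lambda * Ex P (fun w => 1 - calm n w) <= Ex P (fun w => (1 - calm n w) * Z n w).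
  have base : lambda * Ex P (fun w => 1 - calm m w) <= Ex P (fun w => (1 - calm m w) * Z m w).
    rewrite -ExZ//; apply: Ex_le; [exact: intgZ|exact: intg_ncalmM|].
    move=> w; rewrite calmm /below; case: ltP => zl.
      by rewrite subrr mul0r mulr0.
    by rewrite subr0 mulr1 mul1r.
  elim: n mn => [|n IH]; first by rewrite leqn0 => /eqP <-.
  rewrite leq_eqVlt => /predU1P[<-//|].
  rewrite ltnS => mn; have := le_trans (IH mn) (sub _ mn) => H.
  have i1 : intg P (fun w => calm n w * (1 - below (Z n.+1 w))).
    apply: intg_calmM; apply: intgB; first exact: intg_cst.
    apply: (intg_le (measurableT_comp measurable_below (mZ _)) (intg_cst P 1)) => w /=.
    by case/andP: (below01 (Z n.+1 w)) => ? ?; rewrite ger0_norm.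
  have i2 : intg P (fun w => calm n w * (1 - below (Z n.+1 w)) * Z n.+1 w).
    apply: eq_intg (intgB (intg_calmM n (Zi n.+1)) (intg_calmM n.+1 (Zi n.+1))) => w.
    by rewrite calmS; [ring|exact: leqW].
  have E1 : (fun w => 1 - calm n.+1 w) =1 (fun w => (1 - calm n w) + calm n w * (1 - below (Z n.+1 w))).
    by move=> w; rewrite calmS; [ring|exact: leqW].
  have E2 : (fun w => (1 - calm n.+1 w) * Z n.+1 w) =1
      (fun w => (1 - calm n w) * Z n.+1 w + calm n w * (1 - below (Z n.+1 w)) * Z n.+1 w).
    by move=> w; rewrite calmS; [ring|exact: leqW].
  rewrite (eq_Ex P E1) (eq_Ex P E2) ExD// [leRHS]ExD//; last exact: intg_ncalmM.
  rewrite mulrDr; apply: lerD => //; rewrite -ExZ//; apply: Ex_le => //; first exact: intgZ.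
  move=> w; have /andP[c0 _] := calm01 n w.
  rewrite /below; case: ltP => zl; rewrite ?subrr ?mulr0 ?mul0r//.
  by rewrite subr0 mulr1 mulrC ler_wpM2l.
apply: le_trans key _; apply: Ex_le => //; first exact: intg_ncalmM.
by move=> w; rewrite ler_piMl// lerBlDr lerDl; case/andP: (calm01 n w).
Qed.

(** The quantity [lambda P(crossed) + E[calm n * Z n]] does not increase with [n] and starts below
    [E Z m]. *)
Lemma supermartingale_maximal n : (m <= n)%N ->
  (forall k, (m <= k)%N -> Ex P (fun w => calm k w * Z k.+1 w) <=
     Ex P (fun w => calm k w * Z k w)) ->
  lambda * Ex P (fun w => 1 - calm n w) <= Ex P (Z m).
Proof.
move=> mn sup.
have ci k : intg P (fun w => 1 - calm k w) by apply: intgB; [exact: intg_cst|exact: intg_calm].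
have base : lambda * Ex P (fun w => 1 - calm m w) + Ex P (fun w => calm m w * Z m w) <= Ex P (Z m).
  rewrite -ExZ// -ExD; [|exact: intgZ|exact: intg_calmM].
  apply: Ex_le => //; first by apply: intgD; [exact: intgZ|exact: intg_calmM].
  move=> w; rewrite calmm /below; case: ltP => zl.
    by rewrite subrr mulr0 add0r mul1r.
  by rewrite subr0 mulr1 mul0r addr0.
suff key : lambda * Ex P (fun w => 1 - calm n w) + Ex P (fun w => calm n w * Z n w) <= Ex P (Z m).
  apply: le_trans key; rewrite lerDl; apply: Ex_ge0 => w.
  by rewrite mulr_ge0//; case/andP: (calm01 n w).
elim: n mn => [|n IH]; first by rewrite leqn0 => /eqP <-.
rewrite leq_eqVlt => /predU1P[<-//|]; rewrite ltnS => mn.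
apply: le_trans (IH mn).
have i1 : intg P (fun w => calm n w * (1 - below (Z n.+1 w))).
  apply: intg_calmM; apply: intgB; first exact: intg_cst.
  apply: (intg_le (measurableT_comp measurable_below (mZ _)) (intg_cst P 1)) => w /=.
  by case/andP: (below01 (Z n.+1 w)) => ? ?; rewrite ger0_norm.
have E1 : (fun w => 1 - calm n.+1 w) =1 (fun w => (1 - calm n w) + calm n w * (1 - below (Z n.+1 w))).
  by move=> w; rewrite calmS; [ring|exact: leqW].
rewrite (eq_Ex P E1) ExD// mulrDr -addrA lerD2l; apply: le_trans (sup _ mn).
rewrite -ExZ// -ExD; [|exact: intgZ|exact: intg_calmM].
apply: Ex_le; [by apply: intgD; [exact: intgZ|exact: intg_calmM]|exact: intg_calmM|].
move=> w; have /andP[c0 _] := calm01 n w; rewrite calmS; last exact: leqW.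
rewrite /below; case: ltP => zl; first by rewrite subrr !mulr0 add0r mulr1.
by rewrite subr0 !mulr1 mulr0 mul0r addr0 mulrC ler_wpM2l.
Qed.

(** Continuity from below: the event of ever crossing after time [m] is the increasing union of the
    events [calm n = 0]. *)
Lemma maximal_event (b : R) :
  (forall n, (m <= n)%N -> lambda * Ex P (fun w => 1 - calm n w) <= b) ->
  measurable (\bigcup_(k >= m) [set w | lambda <= Z k w]) /\
  (P (\bigcup_(k >= m) [set w | (lambda <= Z k w)%R]) <= (b / lambda)%:E)%E.
Proof.
move=> Hb.
have mA k : measurable [set w | lambda <= Z k w].
  rewrite -[X in measurable X]setTI.
  exact: (measurable_fun_le measurableT (measurable_cst lambda) (mZ k)).
pose E n := [set w | calm n w = 0].
have mE n : measurable (E n).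
  have -> : E n = calm n @^-1` [set 0] by [].
  by rewrite -[X in measurable X]setTI; apply: meas_calm => //; exact: measurable_set1.
have calmb n w : calm n w = 0 \/ calm n w = 1.
  have [/hasP[k]|/hasPn H] := boolP (has (fun k => lambda <= Z k w) (index_iota m n.+1)).
    by rewrite mem_index_iota ltnS => kn lz; left; exact: calm_eq0 kn lz.
  right; apply: calm_eq1 => k kn; rewrite ltNge; apply: H.
  by rewrite mem_index_iota ltnS.
have UE : \bigcup_(k >= m) [set w | lambda <= Z k w] = \bigcup_n E (m + n)%N.
  apply/seteqP; split => [w [k /= mk lz]|w [n _ En]].
    exists (k - m)%N => //; rewrite /E /= subnKC//.
    by apply: (@calm_eq0 _ _ k) => //; rewrite mk leqnn.
  have [k /andP[mk kn] lz] : exists2 k, (m <= k <= m + n)%N & lambda <= Z k w.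
    apply: contrapT => H; have := @calm_eq1 (m + n)%N w.
    rewrite En => /(_ _)/wrap[k kn|/eqP]; last by rewrite eq_sym oner_eq0.
    by rewrite ltNge; apply/negP => lz; apply: H; exists k.
  by exists k.
have mU : measurable (\bigcup_n E (m + n)%N) by exact: bigcupT_measurable.
rewrite UE; split => //.
have ndE : nondecreasing_seq (fun n => E (m + n)%N).
  apply/nondecreasing_seqP => n; rewrite subsetEset => w; rewrite /E /= => En.
  by rewrite addnS calmS ?En ?mul0r// leqW// leq_addr.
have cv := nondecreasing_cvg_mu (fun n => mE (m + n)%N) mU ndE.
refine (cvge_le _ (cv _ P)).
near=> n => /=.
have PE : (P (E (m + n)%N) = (Ex P (fun w => 1 - calm (m + n) w))%:E)%E.
  rewrite -(Ex_indic P (mE _)); congr (_ %:E); apply: eq_Ex => w.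
  rewrite indicE; have [c0|c1] := calmb (m + n)%N w.
    by rewrite mem_set// c0 subr0.
  by rewrite memNset ?c1 ?subrr// /E /= c1 => /eqP; rewrite oner_eq0.
rewrite PE lee_fin ler_pdivlMr// mulrC.
by apply: Hb; rewrite leq_addr.
Unshelve. all: by end_near. Qed.

End Maximal.
End AlmostSure.

(** * Convergence of the martingales *)

Lemma powR_natN_cvg0 (R : realType) (c : R) : 0 < c ->
  n.+1%:R `^ (- c) @[n --> \oo] --> (0 : R).
Proof.
move=> c0; apply/cvgrPdist_lt => e e0; near=> n.
have n0 : 0 < n.+1%:R :> R by rewrite ltr0n.
rewrite sub0r normrN ger0_norm ?powR_ge0// powRN -[ltRHS]invrK ltf_pV2 ?posrE ?invr_gt0 ?powR_gt0//.
have -> : e^-1 = (e^-1 `^ (c^-1)) `^ c.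
  by rewrite -powRrM mulVf ?gt_eqF// powRr1// invr_ge0 ltW.
apply: gt0_ltr_powR; rewrite ?nnegrE ?powR_ge0//.
apply: (@lt_le_trans _ _ n%:R); last by rewrite ler_nat.
near: n; exact: nbhs_infty_gtr.
Unshelve. all: by end_near. Qed.

Lemma sg_below (R : realType) (y : R) : Num.sg y = below 0 (- y) - below 0 y.
Proof.
rewrite /below oppr_lt0; have [y0|y0|->] := ltgtP y 0.
- by rewrite ltr0_sg// sub0r.
- by rewrite gtr0_sg// subr0.
- by rewrite sgr0 subrr.
Qed.

(** The sign is a subgradient of the absolute value; tested against an increment it makes the
    absolute value of a martingale a submartingale. *)
Lemma norm_sg_tangent (R : realType) (y D : R) : `|y| + Num.sg y * D <= `|y + D|.
Proof.
have [y0|y0|->] := ltgtP y 0.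
- by rewrite ltr0_sg// ltr0_norm// mulN1r -opprD -normrN ler_norm.
- by rewrite gtr0_sg// gtr0_norm// mul1r ler_norm.
- by rewrite sgr0 mul0r normr0 !add0r.
Qed.

Lemma measurable_sg (R : realType) : measurable_fun setT (@Num.sg R).
Proof.
rewrite (_ : @Num.sg R = fun y => below 0 (- y) - below 0 y); last first.
  by apply/funext => y; exact: sg_below.
apply: measurable_funB; last exact: measurable_below.
exact: (measurableT_comp (measurable_below 0) (@oppr_measurable R setT)).
Qed.

Lemma cauchy_seq_cvg (R : realType) (u : nat -> R) :
  (forall j : nat, exists m, forall k, (m <= k)%N -> `|u k - u m| < j.+1%:R^-1) ->
  cvgn u.
Proof.
move=> H; apply/cauchy_cvgP/cauchy_ballP => e e0.
have [j je] : exists j : nat, j.+1%:R^-1 < e / 2.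
  have : 0 < e / 2 by rewrite divr_gt0.
  move=> e20; exists (Num.Def.archi_bound (e / 2)^-1).
  rewrite -[ltRHS]invrK ltf_pV2 ?posrE ?invr_gt0 ?ltr0n//.
  apply: lt_le_trans (archi_boundP _) _; first by rewrite invr_ge0 ltW.
  by rewrite ler_nat.
have [m Hm] := H j.
exists (u @` [set k | (m <= k)%N], u @` [set k | (m <= k)%N]).
  by split; exists m => // k mk; exists k.
move=> [_ _] [[k mk <-] [l ml <-]].
suff : `|u k - u l| < e by [].
have kl : u k - u l = (u k - u m) - (u l - u m) by ring.
have le := ler_normB (u k - u m) (u l - u m).
have := Hm k mk; have := Hm l ml; rewrite kl.
move: le je; move: (j.+1%:R^-1) => v; lra.
Qed.

Section MartingaleConvergence.
Context (d : measure_display) (T : measurableType d) (R : realType).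
Variable P : probability T R.
Variables (p : R) (X xi : {RV P >-> R}).
Variables (Xs : nat -> {RV P >-> R}) (eps : nat -> {RV P >-> bool})
  (U : nat -> {RV P >-> nat}) (xis : nat -> {RV P >-> R}).
Hypothesis inputs : rwes_inputs Xs eps U xis p X xi.
Hypothesis p_gt0 : 0 < p.
Hypothesis p_le1 : p <= 1.
Variable rho : R.
Hypothesis rho_gt1 : 1 < rho.
Hypothesis rhoE : rho = p * Ex P (fun w => `|xi w|).
Hypothesis X_intg : intg P X.
Hypothesis xi_intg : intg P xi.

Local Notation x := (echoed_step Xs eps U xis).
Local Notation known := (known Xs eps U xis).
Local Notation a n := (growth rho n.+1).
Local Notation mart := (mart p X Xs eps U xis rho).
Local Notation abs_sum := (abs_sum Xs eps U xis).
Local Notation drift := (drift p X).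
Local Notation homogeneous_pair := (homogeneous_pair p xi rho).

Lemma known_prod J (s : seq nat) (F : nat -> T -> R) :
  (forall k, k \in s -> known J (F k)) -> known J (fun w => \prod_(k <- s) F k w).
Proof.
elim: s => [|k s IH] FJ.
  rewrite (_ : (fun _ => _) = cst 1); first exact: known_cst.
  by apply/funext => w; rewrite big_nil.
rewrite (_ : (fun _ => _) = (fun w => F k w * \prod_(k <- s) F k w)); last first.
  by apply/funext => w; rewrite big_cons.
apply: knownM; first by apply: FJ; rewrite mem_head.
by apply: IH => j js; apply: FJ; rewrite inE js orbT.
Qed.

Lemma mart_meas (h : R -> R) n : measurable_fun setT h -> measurable_fun setT (mart h n).
Proof.
move=> mh; exact: known_meas (@known_mart _ _ _ _ p X Xs eps U xis rho h mh n n (leqnn _)).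
Qed.

Section Exponent.
Variable r : R.
Hypothesis r_gt1 : 1 < r.
Hypothesis Xr : intg P (fun w => `|X w| `^ r).
Hypothesis xir : intg P (fun w => `|xi w| `^ r).
Hypothesis echo_moment : p * Ex P (fun w => `|xi w| `^ r) < r * rho.

Local Notation scaled_moment := (scaled_moment Xs eps U xis rho r).
Local Notation moment_step := (moment_step inputs p_gt0 p_le1 rho_gt1 rhoE X_intg
  xi_intg r_gt1 Xr xir echo_moment).

(** The recursion for [h = Num.norm], [Z = 0] contains [scaled_moment] itself, but [abs_sum / a]
    differs from that martingale by a bounded constant, so the recursion closes and Gronwall
    applies. *)
Lemma scaled_bounded : exists2 G : R, 0 <= G & forall n, scaled_moment n <= G.
Proof.
have [C C0 [c c0 step]] := moment_step.
have r0 := r_gt0 r_gt1; have r00 := ltW r0.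
have ap : exists g, homogeneous_pair Num.norm g.
  by exists Num.norm; exact: (abs_pair rhoE xi_intg).
pose e n := Ex P (fun w => `|mart Num.norm n w| `^ r).
have k0 n : known (history n.+1) (fun=> 0) by exact: known_cst.
have ei n : intg P (fun w => `|mart Num.norm n w| `^ r).
  elim: n => [|n IH].
    apply: eq_intg (intg_step inputs r0 Xr xir (ltnSn 0)) => w.
    by rewrite mart0 normr_id.
  have := step n Num.norm (fun=> 0) ap (k0 n) => /(_ _)/wrap[|[i _]].
    by apply: eq_intg IH => w; rewrite subr0.
  by apply: eq_intg i => w; rewrite subr0.
have e0 n : 0 <= e n by apply: Ex_ge0 => w; exact: powR_ge0.
have es n : e n.+1 <= e n + C * n.+1%:R `^ (- (1 + c)) * (e n + scaled_moment n + 1).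
  have := step n Num.norm (fun=> 0) ap (k0 n) => /(_ _)/wrap[|[_]].
    by apply: eq_intg (ei n) => w; rewrite subr0.
  have E k : Ex P (fun w => `|mart Num.norm k w - 0| `^ r) = e k.
    by apply: eq_Ex => w; rewrite subr0.
  by rewrite !E.
have dr0 : 0 <= drift Num.norm by apply: mulr_ge0; [rewrite subr_ge0|apply: Ex_ge0 => w; exact: normr_ge0].
have r1V : 0 < (rho - 1)^-1 by rewrite invr_gt0 subr_gt0.
(* Bounds the deterministic part [drift * inv_sum], since [inv_sum <= 1 / (rho - 1)]. *)
pose K := (drift Num.norm / (rho - 1)) `^ r.
have K0 : 0 <= K by exact: powR_ge0.
have ske n : scaled_moment n <= 2 `^ r * (e n + K).
  have Ki : intg P (fun w => 2 `^ r * (`|mart Num.norm n w| `^ r + K)).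
    by apply: intgZ; apply: intgD => //; exact: intg_cst.
  rewrite -[K in leRHS](Ex_cst P) -ExD//; last exact: intg_cst.
  rewrite -ExZ; last by apply: intgD => //; exact: intg_cst.
  apply: Ex_le => //; first exact: (intg_scaled inputs rho_gt1 r_gt1 Xr xir).
  move=> w; have dB : 0 <= drift Num.norm / (rho - 1) by rewrite mulr_ge0// ltW.
  have a0 := a_gt0 rho_gt1 n.
  have /andP[b0 b1] := inv_sum_bound rho_gt1 n.
  have S0 : 0 <= abs_sum n w / a n by rewrite divr_ge0 ?abs_sum_ge0 ?(ltW a0).
  have le : abs_sum n w / a n <= `|mart Num.norm n w| + drift Num.norm / (rho - 1).
    have -> : abs_sum n w / a n = mart Num.norm n w + drift Num.norm * inv_sum rho n.
      exact: (esym (subrK (drift Num.norm * inv_sum rho n) (abs_sum n w / a n))).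
    by apply: lerD; [exact: ler_norm|rewrite ler_wpM2l].
  apply: le_trans (powR_addl r00 (normr_ge0 _) dB).
  by apply: ge0_ler_powR => //; rewrite nnegrE// addr_ge0.
(* Chosen so that [e n + scaled_moment n + 1 <= C3 * (e n + 1)]. *)
pose C3 := 1 + 2 `^ r + 2 `^ r * K.
have p2 : 0 <= 2 `^ r :> R by exact: powR_ge0.
have p2K : 0 <= 2 `^ r * K by rewrite mulr_ge0.
have C30 : 0 <= C3 by rewrite /C3; lra.
pose s n := C * C3 * n.+1%:R `^ (- (1 + c)).
pose t n := C * C3 * (2 `^ (1 + c) / c) * n.+1%:R `^ (- c).
have t0 n : 0 <= t n.
  by rewrite /t !mulr_ge0 ?powR_ge0 ?invr_ge0 ?(ltW c0).
have st n : (0 <= n)%N -> s n <= t n - t n.+1.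
  move=> _; rewrite /t -mulrBr /s -[leRHS]mulrA ler_wpM2l ?mulr_ge0//.
  exact: inv_powR_telescope.
have He n : (0 <= n)%N -> e n.+1 + 1 <= (e n + 1) * (1 + s n).
  move=> _; apply: le_trans (lerD (es n) (lexx 1)) _.
  have : C * n.+1%:R `^ (- (1 + c)) * (e n + scaled_moment n + 1) <=
      C * n.+1%:R `^ (- (1 + c)) * (C3 * (e n + 1)).
    rewrite ler_wpM2l ?mulr_ge0 ?powR_ge0//; have := ske n; rewrite /C3.
    have := mulr_ge0 p2K (e0 n); lra.
  rewrite /s; move: (e n) (n.+1%:R `^ (- (1 + c))) => en u; lra.
have gr := gronwall_telescope (ler01 : 0 <= (1 : R)) e0 He st t0.
exists (2 `^ r * ((e 0%N + 1) * expR (t 0%N) + K)).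
  by rewrite mulr_ge0// addr_ge0// mulr_ge0 ?expR_ge0// addr_ge0.
move=> n; apply: le_trans (ske n) _; rewrite ler_wpM2l// lerD2r.
apply: (@le_trans _ _ (e n + 1)); first by rewrite lerDl.
apply: le_trans (gr n (leq0n n)) _; rewrite ler_wpM2l ?addr_ge0// ler_expR.
by rewrite lerBlDr lerDl.
Qed.

Lemma mart_diff_intg (h : R -> R) m n : (exists g, homogeneous_pair h g) -> (m <= n)%N ->
  intg P (fun w => `|mart h n w - mart h m w| `^ r).
Proof.
move=> hp; have [C C0 [c c0 step]] := moment_step.
have [g [[mh _ _ _ _] _ _]] := hp.
have base : intg P (fun w => `|mart h m w - mart h m w| `^ r).
  apply: eq_intg (intg_cst P 0) => w; rewrite subrr normr0 powR0//.
  by rewrite gt_eqF// (r_gt0 r_gt1).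
elim: n => [|n IH]; first by rewrite leqn0 => /eqP <-.
rewrite leq_eqVlt => /predU1P[<-//|]; rewrite ltnS => mn.
by have [] := step n h (mart h m) hp (known_mart p X rho mh mn) (IH mn).
Qed.

Lemma mart_intg_pow (h : R -> R) n : (exists g, homogeneous_pair h g) ->
  intg P (fun w => `|mart h n w| `^ r).
Proof.
move=> hp; have [g [[mh mg h0 hg hn] gi gm]] := hp.
have r0 := r_gt0 r_gt1.
have i0 := mart_diff_intg hp (leq0n n).
have i1 : intg P (fun w => `|mart h 0 w| `^ r).
  apply: eq_intg (intg_step inputs r0 Xr xir (ltnSn 0)) => w.
  by rewrite mart0 hn.
apply: (intg_le _ (intgZ (2 `^ r) (intgD i0 i1))).
  exact: (measurableT_comp (@measurable_norm_powR R r) (mart_meas n mh)).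
move=> w; rewrite ger0_norm ?powR_ge0//.
apply: le_trans (powR_addl (ltW r0) (normr_ge0 _) (normr_ge0 _)).
apply: ge0_ler_powR; rewrite ?nnegrE ?addr_ge0 ?(ltW r0)//.
by rewrite -{1}(subrK (mart h 0 w) (mart h n w)) ler_normD.
Qed.

(** Gronwall for the difference from time [m] on, which starts at 0: the bound is
    [(G + 1) (exp (t m) - 1)], and [t m] tends to 0. *)
Lemma mart_cauchy (h : R -> R) (e : R) : (exists g, homogeneous_pair h g) -> 0 < e ->
  exists m0, forall m n, (m0 <= m <= n)%N ->
    Ex P (fun w => `|mart h n w - mart h m w| `^ r) <= e.
Proof.
move=> hp e0.
have [C C0 [c c0 step]] := moment_step.
have [G G0 HG] := scaled_bounded.
have [g [[mh _ _ _ _] _ _]] := hp.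
have r0 := r_gt0 r_gt1.
pose s n := C * n.+1%:R `^ (- (1 + c)).
pose t n : R := C * (2 `^ (1 + c) / c) * n.+1%:R `^ (- c).
have t0 n : 0 <= t n.
  by rewrite /t !mulr_ge0 ?powR_ge0 ?invr_ge0 ?(ltW c0).
have st m n : (m <= n)%N -> s n <= t n - t n.+1.
  move=> _; rewrite /t -mulrBr /s -[leRHS]mulrA ler_wpM2l ?mulr_ge0//.
  exact: inv_powR_telescope.
have G1 : 0 < G + 1 by rewrite ltr_wpDl.
have bound m n : (m <= n)%N ->
    Ex P (fun w => `|mart h n w - mart h m w| `^ r) <= (G + 1) * (expR (t m) - 1).
  move=> mn; pose f k := Ex P (fun w => `|mart h k w - mart h m w| `^ r).
  have f0 k : 0 <= f k by apply: Ex_ge0 => w; exact: powR_ge0.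
  have fm : f m = 0.
    rewrite /f -[RHS](Ex_cst P 0); apply: eq_Ex => w.
    by rewrite subrr normr0 powR0// gt_eqF.
  have Hf k : (m <= k)%N -> f k.+1 + (G + 1) <= (f k + (G + 1)) * (1 + s k).
    move=> mk; have [_] := step k h (mart h m) hp (known_mart p X rho mh mk) (mart_diff_intg hp mk).
    rewrite -/(f k.+1) -/(f k) -/(s k) => H.
    have : s k * (f k + scaled_moment k + 1) <= s k * (f k + (G + 1)).
      apply: ler_wpM2l; first by rewrite mulr_ge0 ?powR_ge0.
      by rewrite -addrA lerD2l lerD2r HG.
    move=> H'; rewrite [leRHS]mulrDr mulr1 [_ * s k]mulrC [leRHS]addrAC lerD2r.
    by apply: (le_trans H); rewrite lerD2l.
  have := gronwall_telescope (ltW G1) f0 Hf (st m) t0 mn; rewrite fm add0r => H.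
  have : (G + 1) * expR (t m - t n) <= (G + 1) * expR (t m).
    by rewrite ler_pM2l// ler_expR lerBlDr lerDl.
  rewrite mulrBr mulr1 lerBrDr -/(f n); exact: le_trans.
have tcv : t n @[n --> \oo] --> 0.
  rewrite -(mulr0 (C * (2 `^ (1 + c) / c))); apply: cvgMl_tmp.
  exact: powR_natN_cvg0.
have ecv : (G + 1) * (expR (t n) - 1) @[n --> \oo] --> 0.
  rewrite -(mulr0 (G + 1)); apply: cvgMl_tmp.
  rewrite -(subrr 1); apply: cvgB; last exact: cvg_cst.
  rewrite -expR0; exact: (cvg_comp _ _ tcv (@continuous_expR R 0)).
have /cvgrPdist_lt/(_ e e0)[m0 _ Hm0] := ecv.
exists m0 => m n /andP[m0m mn]; apply: le_trans (bound _ _ mn) _.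
have := Hm0 m m0m; rewrite sub0r normrN => /ltW; apply: le_trans.
exact: ler_norm.
Qed.

(** From order [r] to order 1 by [y <= u + u^(1 - r) y^r], with half of [e] given to each
    summand. *)
Lemma mart_cauchy1 (h : R -> R) (e : R) : (exists g, homogeneous_pair h g) -> 0 < e ->
  exists m0, forall m n, (m0 <= m <= n)%N ->
    Ex P (fun w => `|mart h n w - mart h m w|) <= e.
Proof.
move=> hp e0; have [g [[mh mg h0 hg hn] gi gm]] := hp.
pose u := e / 2; have u0 : 0 < u by rewrite divr_gt0.
pose K := u `^ (1 - r); have K0 : 0 < K by exact: powR_gt0.
have eK : 0 < e / 2 / K by rewrite !divr_gt0.
have [m0 Hm0] := mart_cauchy hp eK; exists m0 => m n mn.
have /andP[_ mn'] := mn.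
have i := mart_diff_intg hp mn'.
have md : intg P (fun w => mart h n w - mart h m w).
  by apply: intgB; exact: (intg_mart inputs rho X_intg xi_intg mh hn).
apply: (@le_trans _ _ (Ex P (fun w => u + K * `|mart h n w - mart h m w| `^ r))).
  apply: Ex_le; [exact: intg_norm|apply: intgD; [exact: intg_cst|exact: intgZ]|].
  move=> w; set y := `|_|; have y0 : 0 <= y by exact: normr_ge0.
  have [yu|uy] := leP y u.
    by rewrite (le_trans yu)// lerDl mulr_ge0 ?powR_ge0// ltW.
  have yp : 0 < y by exact: lt_trans uy.
  rewrite (@le_trans _ _ (K * y `^ r))// ?lerDr ?(ltW u0)//.
  have -> : y `^ r = y `^ (r - 1) * y.
    by rewrite mulrC mulr_powRB1// (r_gt0 r_gt1).
  rewrite mulrA ler_peMl// /K (_ : 1 - r = - (r - 1)); last ring.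
  rewrite powRN mulrC ler_pdivlMr ?powR_gt0// mul1r.
  by apply: ge0_ler_powR; rewrite ?nnegrE ?subr_ge0 ?(ltW r_gt1) ?(ltW u0)// ltW.
rewrite ExD; [|exact: intg_cst|exact: intgZ].
rewrite Ex_cst ExZ//; have := Hm0 m n mn; rewrite ler_pdivlMr// mulrC => H.
by rewrite /u; lra.
Qed.

(** The maximal inequality for [|M_k - M_m|], [k >= m], combined with the Cauchy property in mean:
    outside a null set every tolerance is eventually respected. *)
Lemma mart_cvg (h : R -> R) : (exists g, homogeneous_pair h g) ->
  {ae P, forall w, cvgn (mart h ^~ w)}.
Proof.
move=> hp; have [g [[mh mg h0 hg hn] gi gm]] := hp.
pose Z m k w := `|mart h k w - mart h m w|.
have mi k : intg P (mart h k) by exact: (intg_mart inputs rho X_intg xi_intg mh hn).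
have Zi m k : intg P (Z m k) by apply: intg_norm; exact: intgB.
have Z0 m k w : 0 <= Z m k w by exact: normr_ge0.
have mZ m k := intg_meas (Zi m k).
pose lam (j : nat) : R := j.+1%:R^-1.
have lam0 j : 0 < lam j by rewrite invr_gt0 ltr0n.
pose E j m := \bigcup_(k >= m) [set w | lam j <= Z m k w].
have sub m j k : (m <= k)%N -> Ex P (fun w => (1 - calm (Z m) (lam j) m k w) * Z m k w) <=
     Ex P (fun w => (1 - calm (Z m) (lam j) m k w) * Z m k.+1 w).
  move=> mk.
  (* The sign of the current difference, restricted to the event already crossed, is a bounded
     function of the past and so annihilates the next increment. *)
  pose sg w : R := Num.sg (mart h k w - mart h m w).
  pose v w := 1 - calm (Z m) (lam j) m k w; pose W w := v w * sg w.
  have v01 w : 0 <= v w <= 1.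
    have /andP[c0 c1] := calm01 (Z m) (lam j) m k w.
    by rewrite /v subr_ge0 c1 lerBlDr lerDl.
  have kdiff i : (m <= i <= k)%N -> known (history k.+1) (fun w => mart h i w - mart h m w).
    by move=> /andP[mi' ik]; apply: knownB; apply: known_mart => //; exact: leq_trans ik.
  have kv : known (history k.+1) v.
    apply: knownB; first exact: known_cst.
    apply: known_prod => i; rewrite mem_index_iota ltnS => mik.
    apply: (known_comp (measurable_below (lam j))).
    by apply: (known_comp (@normr_measurable R setT)); exact: kdiff.
  have kW : known (history k.+1) W.
    apply: knownM => //; apply: (known_comp (@measurable_sg R)).
    by apply: kdiff; rewrite mk leqnn.
  have W1 w : `|W w| <= 1.
    have /andP[v0 v1] := v01 w; rewrite normrM (ger0_norm v0) normr_sg.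
    by case: eqP => _ /=; rewrite ?mulr0 ?mulr1.
  have Wi : intg P W.
    by apply: (intg_le (known_meas kW) (intg_cst P 1)).
  have Wh i : (1 <= i < k.+2)%N -> intg P (fun w => W w * h (x i w)).
    move=> /andP[i1 _]; apply: (intgMb (c := 1)) => //; last exact: known_meas kW.
    exact: (intg_h_step inputs X_intg xi_intg mh hn).
  have [Di DE] := incr_mean0 inputs X_intg mh mg h0 hg hn gi gm kW Wi Wh.
  have vZi i : intg P (fun w => v w * Z m i w).
    apply: (intgMb (c := 1)) => //; first exact: known_meas kv.
    by move=> w; have /andP[v0 v1] := v01 w; rewrite ger0_norm.
  rewrite -[leLHS]addr0 -DE -ExD//; apply: Ex_le => //; first exact: intgD.
  move=> w; have /andP[v0 v1] := v01 w.
  rewrite -/(v w) /W -mulrA -mulrDr ler_wpM2l// /Z (martS p X Xs eps U xis rho_gt1).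
  by rewrite [mart h k w + _ - _]addrAC; exact: norm_sg_tangent.
have bnd j (e : R) : 0 < e -> exists m, (P (E j m) <= e%:E)%E.
  move=> e0; have el : 0 < e * lam j by rewrite mulr_gt0.
  have [m Hm] := mart_cauchy1 hp el; exists m.
  have [|_ H] := @maximal_event _ _ _ P (Z m) (lam j) m (lam0 j) (mZ m) (e * lam j).
    move=> n mn; apply: le_trans (Hm m n _); last by rewrite leqnn.
    apply: (submartingale_maximal (mZ m) (Zi m) (Z0 m) mn) => k mk.
    exact: sub.
  by apply: le_trans H _; rewrite mulfK// gt_eqF.
have mE j m : measurable (E j m).
  apply: bigcup_measurable => k _; rewrite -[X in measurable X]setTI.
  exact: (measurable_fun_le measurableT (measurable_cst (lam j)) (mZ m k)).
apply: filterS (ae_exists_notin mE bnd) => w Hw.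
apply: cauchy_seq_cvg => j; have [m nE] := Hw j; exists m => k mk.
by rewrite ltNge; apply/negP => lz; apply: nE; exists k.
Qed.

End Exponent.
End MartingaleConvergence.

(** * Measurable limits, Fatou and norms *)

Section LimitTools.
Context (d : measure_display) (T : measurableType d) (R : realType).
Variable P : probability T R.

(** The upper limit in the extended reals is measurable everywhere, whether or not the sequence
    converges; its finite part is the limit wherever there is one. *)
Lemma ae_limit (f : nat -> T -> R) : (forall n, measurable_fun setT (f n)) ->
  {ae P, forall w, cvgn (f ^~ w)} ->
  exists2 g : T -> R, measurable_fun setT g & {ae P, forall w, f n w @[n --> \oo] --> g w}.
Proof.
move=> mf cf; exists (fun w => fine (limn_esup (fun n => (f n w)%:E))).
  apply: (measurableT_comp (fine_measurable measurableT)).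
  by apply: measurable_fun_limn_esup => n; exact/measurable_EFinP.
apply: filterS cf => w cw.
have cwE : (f n w)%:E @[n --> \oo] --> (limn (f ^~ w))%:E.
  by apply: cvg_EFin; [near=> n|exact: cw].
by have [_ ->] := cvg_limn_einf_sup cwE.
Unshelve. all: by end_near. Qed.

Lemma fatou_Ex (f : nat -> T -> R) (g : T -> R) (m : nat) (b : R) :
  (forall n, (m <= n)%N -> intg P (f n)) -> (forall n w, 0 <= f n w) ->
  measurable_fun setT g -> (forall w, 0 <= g w) ->
  {ae P, forall w, f n w @[n --> \oo] --> g w} ->
  (forall n, (m <= n)%N -> Ex P (f n) <= b) -> intg P g /\ Ex P g <= b.
Proof.
move=> fi f0 mg g0 fg fb.
have fi' n : intg P (f (m + n)%N) by apply: fi; exact: leq_addr.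
pose F n w := (f (m + n)%N w)%:E : \bar R.
have mF n : measurable_fun setT (F n) by apply/measurable_EFinP; exact: intg_meas (fi' n).
have F0 n w : setT w -> (0 <= F n w)%E by move=> _; rewrite lee_fin.
have Fat := @fatou _ _ _ P setT measurableT F mF F0.
have gE : (\int[P]_w (g w)%:E = \int[P]_w limn_einf (F ^~ w))%E.
  apply: ae_eq_integral => //.
  - exact/measurable_EFinP.
  - rewrite (_ : (fun _ => _) = (fun w => - limn_esup (fun n => - F n w))%E)//.
    apply/measurableT_comp => //; apply: measurable_fun_limn_esup => n.
    by apply/measurableT_comp.
  - apply: filterS fg => w cw _.
    have cF : F n w @[n --> \oo] --> (g w)%:E.
      apply: cvg_EFin; first by near=> n.
      have := cw; rewrite -(@cvg_shiftn m _ (f ^~ w)); apply: cvg_trans.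
      by apply: near_eq_cvg; near=> n; rewrite /= addnC.
    by have [-> _] := cvg_limn_einf_sup cF.
have le : (\int[P]_w (g w)%:E <= b%:E)%E.
  rewrite gE; apply: le_trans Fat _.
  apply: le_trans (limn_einf_sup _) _; rewrite limn_esup_lim.
  apply: lime_le; first exact: is_cvg_esups.
  near=> n; apply: ub_ereal_sup => _ [k /= nk <-].
  by rewrite ExE// lee_fin fb// leq_addr.
have gi : intg P g by apply: ge0_intg => //; apply: le_lt_trans le _; exact: ltry.
by split => //; move: le; rewrite ExE// lee_fin.
Unshelve. all: by end_near. Qed.

Lemma Ex_norm_eq0 (f : T -> R) : intg P f -> Ex P (fun w => `|f w|) = 0 ->
  {ae P, forall w, f w = 0}.
Proof.
move=> fi E0; pose E (j m : nat) := [set w | (j.+1%:R^-1 : R) <= `|f w|].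
have mf := intg_meas fi.
have mE j m : measurable (E j m).
  rewrite /E -[X in measurable X]setTI.
  have mn : measurable_fun setT (fun w => `|f w|) by exact: measurableT_comp.
  exact: (measurable_fun_le measurableT (measurable_cst (j.+1%:R^-1 : R)) mn).
have : {ae P, forall w, forall j, exists m, ~ E j m w}.
  apply: ae_exists_notin => // j e e0; exists 0%N.
  have j0 : 0 < j.+1%:R^-1 :> R by rewrite invr_gt0 ltr0n.
  have := Ex_markov (intg_norm fi) (fun w => normr_ge0 _) j0.
  rewrite E0 pmulr_rle0// => H.
  rewrite -[leLHS]fineK; last exact: fin_num_measure.
  by rewrite lee_fin; apply: le_trans H (ltW e0).
apply: filterS => w Hw; apply/eqP; rewrite -normr_eq0; apply/eqP.
apply: contrapT => /eqP n0; have n0' : 0 < `|f w| by rewrite lt_neqAle eq_sym n0 normr_ge0.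
pose j := Num.Def.archi_bound `|f w|^-1.
have [m] := Hw j; apply; rewrite /E /=.
rewrite -[leRHS]invrK lef_pV2 ?posrE ?invr_gt0 ?ltr0n//.
apply: ltW; apply: lt_le_trans (archi_boundP _) _; first by rewrite invr_ge0.
by rewrite ler_nat.
Qed.

Lemma LnormE (r : R) (f : T -> R) : 0 < r -> intg P (fun w => `|f w| `^ r) ->
  ('N[P]_(r%:E)[EFin \o f] = ((Ex P (fun w => `|f w| `^ r)) `^ (r^-1))%:E)%E.
Proof.
move=> r0 fi; rewrite unlock /Lnorm.
rewrite (eq_integral (fun w => (`|f w| `^ r)%:E))//.
by rewrite ExE// poweR_EFin.
Qed.

Lemma Lfun_intg (r : R) (f : T -> R) : 0 < r -> measurable_fun setT f ->
  intg P (fun w => `|f w| `^ r) -> f \in Lfun P r%:E.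
Proof.
move=> r0 mf fi; rewrite inE; apply/andP; split; first by rewrite inE.
by rewrite inE /= /finite_norm LnormE// ltry.
Qed.

Lemma intg_Lfun (r : R) (f : T -> R) : 1 <= r -> f \in Lfun P r%:E ->
  measurable_fun setT f /\ intg P (fun w => `|f w| `^ r).
Proof.
move=> r1 fL; split; last exact: Lfun_integrable fL.
by move: fL; rewrite inE => /andP[/[!inE]].
Qed.

End LimitTools.

(** A positive limit follows from differentiability of the power; the limit 0 needs its own
    argument, by inverting the power. *)
Lemma ge0_cvg_powR (R : realType) (u : nat -> R) (l r : R) : 0 < r ->
  (forall n, 0 <= u n) -> u n @[n --> \oo] --> l ->
  u n `^ r @[n --> \oo] --> l `^ r.
Proof.
move=> r0 u0 ul.
have l0 : 0 <= l by apply: (cvgr_to_ge ul); near=> n.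
have [lz|lz] := eqVneq l 0; last first.
  have lp : 0 < l by rewrite lt_neqAle eq_sym lz.
  have c1 : {for l, continuous (fun y : R => y `^ r)}.
    by apply/differentiable_continuous/derivable1_diffP/derivable_powR; rewrite in_itv/= lp.
  exact: cvg_comp _ _ ul c1.
rewrite lz powR0 ?gt_eqF//; apply/cvgrPdist_lt => e e0.
move: ul; rewrite lz => /cvgrPdist_lt ul.
have er0 : 0 < e `^ r^-1 by exact: powR_gt0.
have {}ul := ul _ er0; near=> n.
have : `|0 - u n| < e `^ r^-1 by near: n.
rewrite !sub0r !normrN !ger0_norm ?powR_ge0// => ue.
have -> : e = (e `^ r^-1) `^ r by rewrite -powRrM mulVf ?gt_eqF// powRr1// ltW.
by apply: gt0_ltr_powR; rewrite ?nnegrE ?(ltW er0).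
Unshelve. all: by end_near. Qed.

(** * The limit of the martingale of the walk *)

Section Limit.
Context (d : measure_display) (T : measurableType d) (R : realType).
Variable P : probability T R.
Variables (p : R) (X xi : {RV P >-> R}).
Variables (Xs : nat -> {RV P >-> R}) (eps : nat -> {RV P >-> bool})
  (U : nat -> {RV P >-> nat}) (xis : nat -> {RV P >-> R}).
Hypothesis inputs : rwes_inputs Xs eps U xis p X xi.
Hypothesis p_gt0 : 0 < p.
Hypothesis p_le1 : p <= 1.
Variable rho : R.
Hypothesis rho_gt1 : 1 < rho.
Hypothesis rhoE : rho = p * Ex P (fun w => `|xi w|).
Hypothesis rho_xi : rho = p * Ex P xi.
Hypothesis X_intg : intg P X.
Hypothesis xi_intg : intg P xi.

Local Notation x := (echoed_step Xs eps U xis).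
Local Notation known := (known Xs eps U xis).
Local Notation a n := (growth rho n.+1).
Local Notation M n := (mart p X Xs eps U xis rho id n).
Local Notation homogeneous_pair := (homogeneous_pair p xi rho).

Lemma id_pair : homogeneous_pair id id.
Proof. by split => //; split. Qed.

Let ex_id_pair : exists g, homogeneous_pair id g.
Proof. by exists id; exact: id_pair. Qed.

(** Membership in [Lambda] with the integrability of both powers spelled out; the moment inequality
    is multiplied by [p] so that it reads in terms of [rho]. *)
Definition good_exponent (r : R) : Prop :=
  [/\ 1 < r, intg P (fun w => `|X w| `^ r), intg P (fun w => `|xi w| `^ r)
    & p * Ex P (fun w => `|xi w| `^ r) < r * rho].

Lemma M_meas n : measurable_fun setT (M n).
Proof. exact: mart_meas. Qed.

Lemma M_intg n : intg P (M n).
Proof. exact: (intg_mart inputs rho X_intg xi_intg (h := id)). Qed.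

Lemma M_cvg r : good_exponent r -> {ae P, forall w, cvgn (fun n => M n w)}.
Proof.
move=> [r1 Xr xir m]; exact: (mart_cvg inputs p_gt0 p_le1 rho_gt1 rhoE X_intg xi_intg r1 Xr xir m ex_id_pair).
Qed.

Variable g : T -> R.
Hypothesis mg : measurable_fun setT g.
Hypothesis Mg : {ae P, forall w, M n w @[n --> \oo] --> g w}.

(** Fatou's lemma along the second index of the Cauchy estimate. *)
Lemma limit_Lr r (e : R) : good_exponent r -> 0 < e -> exists m0, forall m, (m0 <= m)%N ->
  intg P (fun w => `|g w - M m w| `^ r) /\ Ex P (fun w => `|g w - M m w| `^ r) <= e.
Proof.
move=> [r1 Xr xir mom] e0.
have r0 : 0 < r by lra.
have [m0 Hm0] := mart_cauchy inputs p_gt0 p_le1 rho_gt1 rhoE X_intg xi_intg r1 Xr xir mom ex_id_pair e0.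
exists m0 => m m0m.
apply: (@fatou_Ex _ _ _ P (fun n w => `|M n w - M m w| `^ r) _ m).
- move=> n mn.
  exact: (mart_diff_intg inputs p_gt0 p_le1 rho_gt1 rhoE X_intg xi_intg r1 Xr xir mom ex_id_pair mn).
- by move=> n w; exact: powR_ge0.
- apply: (measurableT_comp (@measurable_norm_powR R r)); apply: measurable_funB => //.
  exact: M_meas.
- by move=> w; exact: powR_ge0.
- apply: filterS Mg => w cw.
  have c1 : `|M n w - M m w| @[n --> \oo] --> `|g w - M m w|.
    by apply: cvg_norm; apply: cvgB => //; exact: cvg_cst.
  exact: ge0_cvg_powR.
- by move=> n mn; apply: Hm0; rewrite m0m.
Qed.

Lemma limit_L1 r (e : R) : good_exponent r -> 0 < e -> exists m0, forall m, (m0 <= m)%N ->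
  intg P (fun w => g w - M m w) /\ Ex P (fun w => `|g w - M m w|) <= e.
Proof.
move=> [r1 Xr xir mom] e0.
have [m0 Hm0] := mart_cauchy1 inputs p_gt0 p_le1 rho_gt1 rhoE X_intg xi_intg r1 Xr xir mom ex_id_pair e0.
exists m0 => m m0m.
have mgM : measurable_fun setT (fun w => g w - M m w).
  by apply: measurable_funB => //; exact: M_meas.
have [i E] : intg P (fun w => `|g w - M m w|) /\ Ex P (fun w => `|g w - M m w|) <= e.
  apply: (@fatou_Ex _ _ _ P (fun n w => `|M n w - M m w|) _ m).
  - by move=> n mn; apply: intg_norm; apply: intgB; exact: M_intg.
  - by move=> n w; exact: normr_ge0.
  - exact: measurableT_comp.
  - by move=> w; exact: normr_ge0.
  - apply: filterS Mg => w cw.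
    by apply: cvg_norm; apply: cvgB => //; exact: cvg_cst.
  - by move=> n mn; apply: Hm0; rewrite m0m.
by split => //; exact: intg_normP i.
Qed.

Section Closed.
Variable r : R.
Hypothesis r_good : good_exponent r.

Lemma limit_intg : intg P g.
Proof.
have [m0 H] := limit_L1 r_good ltr01; have [i _] := H m0 (leqnn _).
by apply: eq_intg (intgD i (M_intg m0)) => w; rewrite subrK.
Qed.

Lemma bounded_known_intg n (W f : T -> R) : known (history n) W ->
  (forall w, `|W w| <= 1) -> intg P f -> intg P (fun w => W w * f w).
Proof. by move=> kW W1 fi; apply: (intgMb fi (known_meas kW) W1). Qed.

(** The limit closes the martingale. The tested mean of [M m] is constant for [m >= n], and
    convergence in mean carries it to the limit because [W] is bounded by 1. *)
Lemma limit_closed n (W : T -> R) : known (history n.+1) W -> (forall w, `|W w| <= 1) ->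
  Ex P (fun w => W w * g w) = Ex P (fun w => W w * M n w).
Proof.
move=> kW W1.
have Wi m f : (n <= m)%N -> intg P f -> intg P (fun w => W w * f w).
  by move=> _; exact: (bounded_known_intg kW W1).
have step m : (n <= m)%N -> Ex P (fun w => W w * M m w) = Ex P (fun w => W w * M n w).
  elim: m => [|m IH]; first by rewrite leqn0 => /eqP ->.
  rewrite leq_eqVlt => /predU1P[<-//|]; rewrite ltnS => nm; rewrite -(IH nm).
  have kW' : known (history m.+1) W by apply: known_sub kW; exact: history_le.
  have [[mh mg' h0 hg hn] gi gm] := id_pair.
  have Wint : intg P W by apply: (intg_le (known_meas kW) (intg_cst P 1)).
  have [Di DE] := incr_mean0 inputs X_intg mh mg' h0 hg hn gi gm kW' Wint
    (fun k kn => bounded_known_intg kW W1 (intg_one_step inputs X_intg xi_intg (proj1 (andP kn)))).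
  rewrite -[RHS]addr0 -DE -ExD//; last by apply: (Wi m) => //; exact: M_intg.
  by apply: eq_Ex => w; rewrite (martS p X Xs eps U xis rho_gt1) mulrDr.
apply/eqP; rewrite -subr_eq0 -normr_le0; apply/ler_addgt0Pr => e e0; rewrite add0r.
have [m0 H] := limit_L1 r_good e0.
pose m := maxn m0 n; have [i E] := H m (leq_maxl _ _).
rewrite -(step m (leq_maxr _ _)) -ExB; last 2 first.
- by apply: (Wi m); [exact: leq_maxr|exact: limit_intg].
- by apply: (Wi m); [exact: leq_maxr|exact: M_intg].
apply: le_trans E; apply: le_trans (Ex_norm _) _.
  apply: eq_intg (Wi m _ (leq_maxr _ _) i) => w; by rewrite mulrBr.
apply: Ex_le; last 1 first.
- by move=> w; rewrite -mulrBr normrM ler_piMl.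
- apply: intg_norm; apply: eq_intg (Wi m _ (leq_maxr _ _) i) => w; by rewrite mulrBr.
- exact: intg_norm.
Qed.

Lemma limit_mean : Ex P g = Ex P X.
Proof.
have k1 : known (history 1) (fun=> 1) by exact: known_cst.
have := @limit_closed 0 (fun=> 1) k1 (fun w => _).
rewrite (eq_Ex P (f := fun w => 1 * g w) (g := g)); last by move=> w; rewrite mul1r.
move=> ->; last by rewrite normr1.
rewrite (eq_Ex P (g := Xs 1%N)) => [|w]; last by rewrite mul1r mart0.
by have [_ <-] := same_law_Ex (spins_law inputs (isT : (1 <= 1)%N)) (@measurable_id _ R setT) X_intg.
Qed.

(** Testing the closure against the sign of [M n - c] gives [E|M n - c| = E[W (g - c)] = 0]. *)
Lemma limit_constant c : {ae P, forall w, g w = c} ->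
  forall n, {ae P, forall w, M n w = c}.
Proof.
move=> gc n.
have ci : intg P (fun w => M n w - c) by apply: intgB; [exact: M_intg|exact: intg_cst].
suff : Ex P (fun w => `|M n w - c|) = 0.
  by move=> /(Ex_norm_eq0 ci); apply: filterS => w /eqP; rewrite subr_eq0 => /eqP.
pose W w : R := Num.sg (M n w - c).
have kW : known (history n.+1) W.
  apply: (known_comp (@measurable_sg R)); apply: knownB; last exact: known_cst.
  exact: known_mart.
have W1 w : `|W w| <= 1 by rewrite normr_sg; case: eqP.
have E := limit_closed kW W1.
have Wg : Ex P (fun w => W w * g w) = Ex P (fun w => W w * c).
  apply: ae_eq_Ex.
  - by apply: measurable_funM => //; exact: known_meas kW.
  - by apply: measurable_funM => //; exact: known_meas kW.
  - by apply: filterS gc => w ->.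
rewrite (eq_Ex P (g := fun w => W w * M n w - W w * c)) => [|w]; last first.
  by rewrite /W -mulrBr normrEsg.
rewrite ExB -?E ?Wg ?subrr//.
- by apply: (bounded_known_intg kW W1); exact: M_intg.
- by apply: (bounded_known_intg kW W1); exact: intg_cst.
Qed.

End Closed.
End Limit.

(** * The walk in the subcritical case *)

Section Walk.
Context (d : measure_display) (T : measurableType d) (R : realType).
Variable P : probability T R.
Variables (p : R) (X xi : {RV P >-> R}).
Variables (Xs : nat -> {RV P >-> R}) (eps : nat -> {RV P >-> bool})
  (U : nat -> {RV P >-> nat}) (xis : nat -> {RV P >-> R}).
Hypothesis inputs : rwes_inputs Xs eps U xis p X xi.
Hypothesis p_gt0 : 0 < p.
Hypothesis p_le1 : p <= 1.
Variable rho : R.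
Hypothesis rho_gt1 : 1 < rho.
Hypothesis rhoE : rho = p * Ex P (fun w => `|xi w|).
Hypothesis rho_xi : rho = p * Ex P xi.
Hypothesis X_intg : intg P X.
Hypothesis xi_intg : intg P xi.

Local Notation x := (echoed_step Xs eps U xis).
Local Notation known := (known Xs eps U xis).
Local Notation a n := (growth rho n.+1).
Local Notation M n := (mart p X Xs eps U xis rho id n).
Local Notation good_exponent := (good_exponent p X xi rho).
Local Notation S n := (hsum Xs eps U xis id n).
Local Notation drift := (drift p X id).

(** Each echo of an earlier step is chosen with positive weight [p / n.+1], so if the new step is
    constant, each echoed product must equal that constant; taking means gives the formula. *)
Lemma constant_step n b : {ae P, forall w, x n.+2 w = b} ->
  forall k, (1 <= k < n.+2)%N -> b = Ex P (x k) * Ex P xi.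
Proof.
move=> xb k kn.
(* Vanishes at 0, as [one_step_Ex] requires, and attains its minimum [- |b|] only at [b]. An average
   equal to the minimum forces every term of positive weight to be minimal. *)
pose h (y : R) := `|y - b| - `|b|.
have mh : measurable_fun setT h.
  apply: measurable_funB => //; apply: measurableT_comp => //.
  by apply: measurable_funB.
have h0 : h 0 = 0 by rewrite /h sub0r normrN subrr.
have hle y : `|h y| <= `|y|.
  have := ler_normB y b; have := ler_normB (y - b) y.
  rewrite /h addrAC subrr sub0r normrN => ? ?.
  by rewrite ler_norml; apply/andP; split; lra.
have hge y : - `|b| <= h y by rewrite /h lerDr.
have hXi : intg P (h \o X).
  by apply: (intg_le _ (intg_norm X_intg)) => [|w /=]; [exact: measurableT_comp|exact: hle].
have xki j : (1 <= j)%N -> intg P (x j) by exact: (intg_one_step inputs X_intg xi_intg).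
have kx j : (1 <= j < n.+2)%N -> known (history n.+1) (x j) by move=> jn; exact: known_step.
have prod j : (1 <= j < n.+2)%N -> intg P (fun w => x j w * xis n.+2 w) /\
    Ex P (fun w => x j w * xis n.+2 w) = Ex P (x j) * Ex P xi.
  move=> /[dup] jn /andP[j1 _].
  exact: (echo_product inputs (@measurable_id _ R setT) (kx _ jn) (xki _ j1) xi_intg).
have mh' j : (1 <= j < n.+2)%N -> measurable_fun setT (fun w => h (xis n.+2 w * x j w)).
  move=> /andP[j1 _]; apply: (measurableT_comp mh); apply: measurable_funM => //.
  exact: meas_step.
have hxi j : (1 <= j < n.+2)%N -> intg P (fun w => h (xis n.+2 w * x j w)).
  move=> jn; apply: (intg_le (mh' _ jn) (intg_norm (prod _ jn).1)) => w.
  by rewrite [x j w * _]mulrC.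
have k1 : known (history n.+1) (fun=> 1) by exact: known_cst.
have [j jn|_] := @one_step_Ex _ _ _ _ _ _ _ _ _ _ _ inputs n (fun=> 1) h mh h0 k1 (intg_cst P 1) hXi _.
  by apply: eq_intg (hxi _ jn) => w; rewrite mul1r.
have -> : Ex P (fun w => 1 * h (x n.+2 w)) = - `|b|.
  rewrite -[RHS](Ex_cst P); apply: ae_eq_Ex => //.
  - apply: measurable_funM => //; apply: (measurableT_comp mh); exact: meas_step.
  - by apply: filterS xb => w ->; rewrite mul1r /h subrr normr0 sub0r.
rewrite Ex_cst mulr1.
pose H j := Ex P (fun w => 1 * h (xis n.+2 w * x j w)).
have HE j : H j = Ex P (fun w => h (xis n.+2 w * x j w)) by apply: eq_Ex => w; rewrite mul1r.
move=> tot.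
have {}tot : - `|b| = (1 - p) * Ex P (h \o X) + p / n.+1%:R * \sum_(1 <= j < n.+2) H j by [].
have Hge j : (1 <= j < n.+2)%N -> - `|b| <= H j.
  move=> jn; rewrite HE -[leLHS](Ex_cst P).
  by apply: Ex_le; [exact: intg_cst|exact: hxi|move=> w; exact: hge].
have hXge : - `|b| <= Ex P (h \o X).
  rewrite -[leLHS](Ex_cst P).
  by apply: Ex_le; [exact: intg_cst|exact: hXi|move=> w; exact: hge].
have n0 : 0 < n.+1%:R :> R by rewrite ltr0n.
have sumE : \sum_(1 <= j < n.+2) (H j + `|b|) = \sum_(1 <= j < n.+2) H j + n.+1%:R * `|b|.
  by rewrite big_split/= sumr_const_nat subn1 -[_ *+ _]mulr_natl.
have sum_ge0 : 0 <= \sum_(1 <= j < n.+2) (H j + `|b|).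
  by rewrite big_nat; apply: sumr_ge0 => j jn; rewrite -lerBlDr sub0r Hge.
have sum0 : \sum_(1 <= j < n.+2) (H j + `|b|) = 0.
  apply/eqP; rewrite eq_le sum_ge0 andbT.
  have q0 : 0 < p / n.+1%:R by rewrite divr_gt0.
  rewrite -(pmulr_rle0 _ q0) sumE mulrDr [p / _ * (_ * _)]mulrA divfK ?gt_eqF//.
  have : 0 <= (1 - p) * (Ex P (h \o X) + `|b|).
    by rewrite mulr_ge0 ?subr_ge0// -lerBlDr sub0r.
  move: tot; move: (\sum_(1 <= j < n.+2) H j) (p / n.+1%:R) (Ex P (h \o X)) => s q e; lra.
have Hk : H k = - `|b|.
  have : H k + `|b| <= 0.
    rewrite -sum0 (bigD1_seq k) ?mem_index_iota ?iota_uniq//= lerDl.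
    rewrite big_nat_cond; apply: sumr_ge0 => j /andP[jn _].
    by rewrite -lerBlDr sub0r Hge.
  have := Hge k kn; lra.
have di : intg P (fun w => xis n.+2 w * x k w - b).
  apply: intgB; last exact: intg_cst.
  by apply: eq_intg (prod _ kn).1 => w; rewrite mulrC.
have E0 : Ex P (fun w => `|xis n.+2 w * x k w - b|) = 0.
  rewrite (eq_Ex P (g := fun w => h (xis n.+2 w * x k w) + `|b|)) => [|w]; last by rewrite /h subrK.
  rewrite ExD; [|exact: hxi|exact: intg_cst].
  by rewrite Ex_cst -HE Hk addNr.
have ae0 := Ex_norm_eq0 di E0.
rewrite -(prod _ kn).2 -[LHS](Ex_cst P); apply: ae_eq_Ex => //.
  exact: intg_meas (prod _ kn).1.
by apply: filterS ae0 => w /eqP; rewrite subr_eq0 mulrC => /eqP.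
Qed.

Lemma rwesE n w : rwes Xs eps U xis n.+1 w = S n w.
Proof. by []. Qed.

Lemma S_M n w : S n w = a n * (M n w + drift * inv_sum rho n).
Proof.
have a0 := a_gt0 rho_gt1 n.
have -> : M n w + drift * inv_sum rho n = S n w / a n by exact: subrK.
by rewrite mulrC divfK// gt_eqF.
Qed.

Variable g : T -> R.
Hypothesis mg : measurable_fun setT g.
Hypothesis Mg : {ae P, forall w, M n w @[n --> \oo] --> g w}.

Lemma limit_nondegenerate r : good_exponent r -> (P [set w | X w = 0%R] < 1)%E ->
  ~ exists c, {ae P, forall w, g w = c}.
Proof.
move=> good Xnz [c gc].
have Mc n := limit_constant inputs p_gt0 p_le1 rho_gt1 rhoE rho_xi X_intg xi_intg mg Mg good gc n.
pose s n := a n * (c + drift * inv_sum rho n).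
have Sc n : {ae P, forall w, S n w = s n}.
  by apply: filterS (Mc n) => w Mw; rewrite S_M Mw.
have xc n : {ae P, forall w, x n.+2 w = s n.+1 - s n}.
  apply: filterS2 (Sc n) (Sc n.+1) => w S1 S2.
  by rewrite -S1 -S2 (hsumS Xs eps U xis id) addrAC subrr add0r.
have x1c : {ae P, forall w, x 1%N w = c} by apply: filterS (Mc 0%N) => w; rewrite mart0.
have Ex1 : Ex P (x 1%N) = c.
  rewrite -[RHS](Ex_cst P); apply: ae_eq_Ex => //; exact: meas_step.
have Ex2 : Ex P (x 2%N) = s 1%N - s 0%N.
  rewrite -[RHS](Ex_cst P); apply: ae_eq_Ex => //; exact: meas_step.
(* The first identity gives the second step as [c m_1]; the other two read the third step as an echo
   of the first and as an echo of the second. *)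
have e1 := constant_step (xc 0%N) (isT : (1 <= 1 < 2)%N).
have e2 := constant_step (xc 1%N) (isT : (1 <= 1 < 3)%N).
have e3 := constant_step (xc 1%N) (isT : (1 <= 2 < 3)%N).
set m1 := Ex P xi in e1 e2 e3.
have m1gt : 1 < m1.
  move: rho_gt1; rewrite rho_xi -/m1 => pm; apply: (lt_le_trans pm).
  have m0 : 0 < m1 by rewrite -(pmulr_rgt0 _ p_gt0); apply: lt_trans pm.
  by rewrite ler_piMl// ltW.
move: e1 e2 e3; rewrite Ex1 Ex2 => e1 e2 e3.
have c0 : c = 0.
  have : c * m1 * (m1 - 1) = 0 by rewrite mulrBr mulr1 -[in X in X - _]e1 -e3 e2 subrr.
  move=> /eqP; rewrite !mulf_eq0 => /orP[/orP[/eqP//|]|]; move=> /eqP; lra.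
have X0 : Ex P (fun w => `|X w|) = 0.
  have [_ <-] := same_law_Ex (spins_law inputs (isT : (1 <= 1)%N)) (@normr_measurable R setT) (intg_norm X_intg).
  rewrite -[RHS](Ex_cst P); apply: ae_eq_Ex => //.
  by apply: filterS x1c => w; rewrite echoed_step1 c0 /= => ->; rewrite normr0.
have aeX := Ex_norm_eq0 X_intg X0.
move: Xnz; suff -> : (P [set w | X w = 0%R] = 1)%E by rewrite ltxx.
have mX : measurable [set w | X w = 0].
  exact: (@measurable_funPTI _ _ _ _ X [set 0] (measurable_set1 _)).
rewrite -(Ex_indic P mX); congr (_ %:E); rewrite -[RHS](Ex_cst P); apply: ae_eq_Ex => //.
by apply: filterS aeX => w Xw; rewrite indicE mem_set.
Qed.

Definition scale_seq n : R := a n / n.+1%:R `^ rho.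
Definition shift_seq n : R := drift * inv_sum rho n.
Definition scale_lim : R := (Gamma_fun (1 + rho))^-1.
Definition shift_lim : R := drift / (rho - 1).

Lemma scale_cvg : scale_seq n @[n --> \oo] --> scale_lim.
Proof.
have := growth_cvg (ltW rho_gt1).
by rewrite -(@cvg_shiftS _ (fun n => growth rho n / n%:R `^ rho)).
Qed.

Lemma ratio_cvg0 : n.+1%:R / a n @[n --> \oo] --> (0 : R).
Proof.
pose G := Gamma_fun (1 + rho).
have G1 : 1 <= G by apply: Gamma_fun1D_ge1; exact: ltW.
have r1 : 0 < rho - 1 by rewrite subr_gt0.
have h : G * n.+1%:R `^ (- (rho - 1)) @[n --> \oo] --> (0 : R).
  by rewrite -(mulr0 G); apply: cvgMl_tmp; exact: powR_natN_cvg0.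
apply: squeeze_cvgr (cvg_cst 0) h; near=> n.
have n0 : 0 < n.+1%:R :> R by rewrite ltr0n.
have a0 := a_gt0 rho_gt1 n.
rewrite divr_ge0 ?(ltW a0)//= ler_pdivrMr//.
have G0 : 0 < G by lra.
have lo : n.+1%:R `^ rho <= G * a n.
  by have := growth_lower n (ltW rho_gt1); rewrite ler_pdivrMr// mulrC.
have nE : n.+1%:R = n.+1%:R `^ (- (rho - 1)) * n.+1%:R `^ rho :> R.
  rewrite -powRD ?(gt_eqF n0) ?implybT// (_ : - (rho - 1) + rho = 1) ?powRr1 ?(ltW n0)//.
  ring.
by rewrite [leLHS]nE mulrAC [leRHS]mulrC ler_wpM2l ?powR_ge0.
Unshelve. all: by end_near. Qed.

Lemma inv_sum_cvg : inv_sum rho n @[n --> \oo] --> (rho - 1)^-1.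
Proof.
rewrite -[X in _ --> X]mulr1; apply: (@cvg_trans _ ((rho - 1)^-1 * (1 - n.+1%:R / a n) @[n --> \oo])).
  by apply: near_eq_cvg; near=> n; rewrite /inv_sum growth_inv_sum.
apply: cvgMl_tmp; rewrite -[X in _ --> X]subr0; apply: cvgB; first exact: cvg_cst.
exact: ratio_cvg0.
Unshelve. all: by end_near. Qed.

Lemma shift_cvg : shift_seq n @[n --> \oo] --> shift_lim.
Proof. by apply: cvgMl_tmp; exact: inv_sum_cvg. Qed.

Lemma normalizedE n w : rwes Xs eps U xis n.+1 w / n.+1%:R `^ rho =
  scale_seq n * (M n w + shift_seq n).
Proof. by rewrite rwesE S_M /scale_seq /shift_seq mulrAC. Qed.

Lemma walk_cvg : {ae P, forall w, rwes Xs eps U xis n w / n%:R `^ rho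
   @[n --> \oo] --> scale_lim * (g w + shift_lim)}.
Proof.
apply: filterS Mg => w cw.
rewrite -(@cvg_shiftS _ (fun n => rwes Xs eps U xis n w / n%:R `^ rho)).
apply: (@cvg_trans _ (scale_seq n * (M n w + shift_seq n) @[n --> \oo])).
  by apply: near_eq_cvg; near=> n; rewrite -normalizedE.
by apply: cvgM; [exact: scale_cvg|apply: cvgD => //; exact: shift_cvg].
Unshelve. all: by end_near. Qed.

Definition walk_limit (w : T) : R := scale_lim * (g w + shift_lim).

Lemma measurable_walk_limit : measurable_fun setT walk_limit.
Proof. by apply: measurable_funM => //; apply: measurable_funD. Qed.

Lemma normalized_meas n : measurable_fun setT (fun w => rwes Xs eps U xis n w / n%:R `^ rho).
Proof.
case: n => [|n].
  rewrite (_ : (fun _ => _) = cst 0)//.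
  by apply/funext => w; rewrite /rwes big_geq// mul0r.
rewrite (_ : (fun _ => _) = (fun w => scale_seq n * (M n w + shift_seq n))); last first.
  by apply/funext => w; rewrite normalizedE.
apply: measurable_funM => //; apply: measurable_funD => //; exact: M_meas.
Qed.

Lemma intg_powD r (f h : T -> R) : 0 <= r -> measurable_fun setT f -> measurable_fun setT h ->
  intg P (fun w => `|f w| `^ r) -> intg P (fun w => `|h w| `^ r) ->
  intg P (fun w => `|f w + h w| `^ r).
Proof.
move=> r0 mf mh fi hi.
apply: (intg_le _ (intgZ (2 `^ r) (intgD fi hi))) => [|w].
  by apply: (measurableT_comp (measurable_norm_powR r)); exact: measurable_funD.
rewrite ger0_norm ?powR_ge0//; apply: le_trans (powR_addl r0 (normr_ge0 _) (normr_ge0 _)).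
by apply: ge0_ler_powR; rewrite ?nnegrE ?addr_ge0//; exact: ler_normD.
Qed.

Lemma intg_powZ r c (f : T -> R) : intg P (fun w => `|f w| `^ r) ->
  intg P (fun w => `|c * f w| `^ r).
Proof. by move=> /(intgZ (`|c| `^ r)); apply: eq_intg => w; rewrite normrM powRM. Qed.

(** The exponent need not be the one from which [g] was obtained: only the almost sure limit is
    used. The error splits into [scale_seq * (M n - g)], a vanishing multiple of [g] and a vanishing
    constant. *)
Lemma walk_Lr r : good_exponent r ->
  converges_in_Lp P r (fun n w => rwes Xs eps U xis n w / n%:R `^ rho) walk_limit.
Proof.
move=> good; have [r1 Xr xir mom] := good.
have r0 : 0 < r by lra.
have r0' := ltW r0.
have ri0 : 0 < r^-1 by rewrite invr_gt0.
have exid : exists h, homogeneous_pair p xi rho id h by exists id; exact: id_pair.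
have Mi n : intg P (fun w => `|M n w| `^ r) := mart_intg_pow inputs p_gt0 p_le1 rho_gt1 rhoE
  X_intg xi_intg r1 Xr xir mom n exid.
have mM n : measurable_fun setT (M n) by exact: M_meas.
have ci c : intg P (fun=> `|c : R| `^ r) by exact: intg_cst.
have gi : intg P (fun w => `|g w| `^ r).
  have [m0 H] := limit_Lr inputs p_gt0 p_le1 rho_gt1 rhoE rho_xi X_intg xi_intg mg Mg good ltr01.
  have [i _] := H m0 (leqnn _).
  have mgM : measurable_fun setT (fun w => g w - M m0 w) by exact: measurable_funB.
  by apply: eq_intg (intg_powD r0' mgM (mM m0) i (Mi m0)) => w; rewrite subrK.
have limi : intg P (fun w => `|walk_limit w| `^ r).
  by apply: intg_powZ; apply: intg_powD.
have Yi n : intg P (fun w => `|rwes Xs eps U xis n w / n%:R `^ rho| `^ r).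
  case: n => [|n].
    apply: eq_intg (intg_cst P 0) => w.
    by rewrite /rwes big_geq// mul0r normr0 powR0// gt_eqF.
  apply: (@eq_intg _ _ _ _ (fun w => `|scale_seq n * (M n w + shift_seq n)| `^ r)).
    by move=> w; rewrite normalizedE.
  by apply: intg_powZ; apply: intg_powD.
have mY n := normalized_meas n.
split.
- by move=> n; exact: Lfun_intg.
- by apply: Lfun_intg => //; exact: measurable_walk_limit.
pose D n w := rwes Xs eps U xis n w / n%:R `^ rho - walk_limit w.
have Di n : intg P (fun w => `|D n w| `^ r).
  have mN : measurable_fun setT (fun w => - 1 * walk_limit w).
    by apply: measurable_funM => //; exact: measurable_walk_limit.
  by apply: eq_intg (intg_powD r0' (mY n) mN (Yi n) (intg_powZ (-1) limi)) => w; rewrite mulN1r.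
apply: (@cvg_trans _ (((Ex P (fun w => `|D n w| `^ r)) `^ (r^-1))%:E @[n --> \oo])).
  by apply: near_eq_cvg; near=> n; rewrite (LnormE r0 (Di n)).
apply: cvg_EFin; first by near=> n.
have E0 n : 0 <= Ex P (fun w => `|D n w| `^ r) by apply: Ex_ge0 => w; exact: powR_ge0.
rewrite /= -(powR0 (lt0r_neq0 ri0)); apply: ge0_cvg_powR => //.
rewrite -(@cvg_shiftS _ (fun n => Ex P (fun w => `|D n w| `^ r))).
pose e n := Ex P (fun w => `|g w - M n w| `^ r).
have e0 n : 0 <= e n by apply: Ex_ge0 => w; exact: powR_ge0.
have gMi n : intg P (fun w => `|g w - M n w| `^ r).
  have mN : measurable_fun setT (fun w => - 1 * M n w) by apply: measurable_funM.
  by apply: eq_intg (intg_powD r0' mg mN gi (intg_powZ (-1) (Mi n))) => w; rewrite mulN1r.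
have ecvg : e n @[n --> \oo] --> (0 : R).
  apply/cvgr0Pnorm_le => eps0 eps0_gt0.
  have [m0 H] := limit_Lr inputs p_gt0 p_le1 rho_gt1 rhoE rho_xi X_intg xi_intg mg Mg good eps0_gt0.
  by exists m0 => // n /= /H[_]; rewrite ger0_norm.
(* The expectation of the bound that [powR_addl], used twice, gives for the three-term splitting of
   the error. *)
pose bnd n := 2 `^ r * (2 `^ r * (`|scale_seq n| `^ r * e n
   + `|scale_seq n - scale_lim| `^ r * Ex P (fun w => `|g w| `^ r))
   + `|scale_seq n * shift_seq n - scale_lim * shift_lim| `^ r).
have normcvg (u : nat -> R) l : u n @[n --> \oo] --> l -> `|u n - l| `^ r @[n --> \oo] --> (0 : R).
  move=> ul; rewrite -(powR0 (lt0r_neq0 r0)); apply: ge0_cvg_powR => //.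
  rewrite -(normr0 R) -(subrr l); apply: cvg_norm; apply: cvgB => //; exact: cvg_cst.
have bcvg : bnd n @[n --> \oo] --> (0 : R).
  rewrite (_ : 0 = 2 `^ r * (2 `^ r * (`|scale_lim| `^ r * 0 + 0 * Ex P (fun w => `|g w| `^ r)) + 0)); last first.
    by rewrite mulr0 mul0r !addr0 mulr0 mulr0.
  apply: cvgMl_tmp; apply: cvgD; last first.
    by apply: normcvg; apply: cvgM; [exact: scale_cvg|exact: shift_cvg].
  apply: cvgMl_tmp; apply: cvgD.
    apply: cvgM => //; apply: ge0_cvg_powR => //; apply: cvg_norm; exact: scale_cvg.
  by apply: cvgMr_tmp; apply: normcvg; exact: scale_cvg.
apply: squeeze_cvgr (cvg_cst 0) bcvg; near=> n; rewrite E0 /=.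
pose B w := `|scale_seq n| * `|g w - M n w|.
pose C w := `|scale_seq n - scale_lim| * `|g w|.
pose c := `|scale_seq n * shift_seq n - scale_lim * shift_lim|.
pose G w := 2 `^ r * (2 `^ r * (`|scale_seq n| `^ r * `|g w - M n w| `^ r
   + `|scale_seq n - scale_lim| `^ r * `|g w| `^ r) + c `^ r).
have i1 := intgZ (`|scale_seq n| `^ r) (gMi n).
have i2 := intgZ (`|scale_seq n - scale_lim| `^ r) gi.
have i3 := intgZ (2 `^ r) (intgD i1 i2).
have i4 := intgD i3 (intg_cst P (c `^ r)).
have Gi : intg P G by exact: (intgZ (2 `^ r) i4).
have <- : Ex P G = bnd n.
  by rewrite /G (ExZ _ i4) (ExD i3 (intg_cst P (c `^ r))) (ExZ _ (intgD i1 i2)) (ExD i1 i2) (ExZ _ (gMi n)) (ExZ _ gi) Ex_cst.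
apply: Ex_le => // w.
have Dle : `|D n.+1 w| <= B w + C w + c.
  rewrite /D normalizedE /walk_limit.
  rewrite (_ : _ - _ = - (scale_seq n * (g w - M n w)) + (scale_seq n - scale_lim) * g w
    + (scale_seq n * shift_seq n - scale_lim * shift_lim)); last by ring.
  apply: (le_trans (ler_normD _ _)); rewrite lerD2r.
  by apply: (le_trans (ler_normD _ _)); rewrite normrN /B /C -!normrM.
have B0 : 0 <= B w by rewrite mulr_ge0.
have C0 : 0 <= C w by rewrite mulr_ge0.
have c0 : 0 <= c by exact: normr_ge0.
have BC0 : 0 <= B w + C w by rewrite addr_ge0.
apply: (@le_trans _ _ ((B w + C w + c) `^ r)).
  by apply: ge0_ler_powR; rewrite ?nnegrE ?addr_ge0.
apply: (le_trans (powR_addl r0' BC0 c0)); rewrite ler_wpM2l ?powR_ge0// lerD2r.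
by apply: (le_trans (powR_addl r0' B0 C0)); rewrite ler_wpM2l ?powR_ge0// /B /C !powRM.
Unshelve. all: by end_near. Qed.

Lemma walk_limit_intg r : good_exponent r -> intg P walk_limit.
Proof.
move=> good; apply: intgZ; apply: intgD; last exact: intg_cst.
exact: (limit_intg inputs p_gt0 p_le1 rho_gt1 rhoE rho_xi X_intg xi_intg mg Mg good).
Qed.

Lemma walk_limit_mean r : good_exponent r ->
  Ex P walk_limit = Ex P X / Gamma_fun (1 + rho) * (1 + (1 - p) / (rho - 1)).
Proof.
move=> good.
have gi := limit_intg inputs p_gt0 p_le1 rho_gt1 rhoE rho_xi X_intg xi_intg mg Mg good.
rewrite /walk_limit ExZ; last by apply: intgD => //; exact: intg_cst.
rewrite ExD//; last exact: intg_cst.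
rewrite Ex_cst (limit_mean inputs p_gt0 p_le1 rho_gt1 rhoE rho_xi X_intg xi_intg mg Mg good).
have driftE : drift = (1 - p) * Ex P X by [].
by rewrite /shift_lim /scale_lim driftE; ring.
Qed.

Lemma walk_limit_nondegenerate r : good_exponent r -> (P [set w | X w = 0%R] < 1)%E ->
  nondegenerate_rv P walk_limit.
Proof.
move=> good Xnz [c wc]; apply: (limit_nondegenerate good Xnz).
have G0 : scale_lim != 0.
  by rewrite invr_eq0 gt_eqF//; apply: lt_le_trans (Gamma_fun1D_ge1 (ltW rho_gt1)).
exists (c / scale_lim - shift_lim); apply: filterS wc => w <-.
by rewrite /walk_limit mulrAC mulfV// mul1r addrK.
Qed.

End Walk.

(** * The critical case *)

Section Barrier.
Variable R : realType.
Implicit Types (u v D delta L : R).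

(* The quadratic gain over [1 + delta ln u] is what makes the critical case
   strict. *)
Lemma powR_xlnx delta u : 0 < delta -> 0 <= u ->
  u + delta * (u * ln u) + delta ^+ 2 / 4 * (2 * (u * ln u) - u) <= u `^ (1 + delta).
Proof.
move=> d0; rewrite le_eqVlt => /predU1P[<-|u0].
  by rewrite !(mul0r, mulr0, subr0, addr0) powR_ge0.
have -> : u `^ (1 + delta) = u * u `^ delta.
  by rewrite powRD ?(gt_eqF u0) ?implybT// powRr1// ltW.
have -> : u + delta * (u * ln u) + delta ^+ 2 / 4 * (2 * (u * ln u) - u) =
  u * (1 + delta * ln u + delta ^+ 2 / 4 * (2 * ln u - 1)) by ring.
rewrite ler_pM2l// /powR gt_eqF//.
have d2 : 0 < delta ^+ 2 by rewrite exprn_gt0.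
(* For [ln u < 0] the quadratic gain is negative and the first order bound is enough. *)
have [x0|x0] := leP 0 (ln u); last first.
  apply: le_trans (expR_ge1Dx _).
  have : delta ^+ 2 / 4 * (2 * ln u - 1) <= 0.
    by rewrite mulr_ge0_le0//; lra.
  lra.
(* Squaring [1 + z <= exp z] at half the exponent yields the quadratic term, and
   [(ln u)^2 >= 2 ln u - 1] makes it linear in the logarithm. *)
have -> : expR (delta * ln u) = expR (delta * ln u / 2) ^+ 2.
  by rewrite expr2 -expRD; congr expR; field.
have y0 : 0 <= 1 + delta * ln u / 2 by rewrite addr_ge0// !mulr_ge0// ltW.
apply: (@le_trans _ _ ((1 + delta * ln u / 2) ^+ 2)); last first.
  by rewrite ler_sqr ?nnegrE ?expR_ge0//; exact: expR_ge1Dx.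
have : 0 <= delta ^+ 2 * (ln u - 1) ^+ 2 by rewrite mulr_ge0 ?sqr_ge0.
rewrite !expr2; move: (ln u) => x; lra.
Qed.

Definition barrier D delta u := u * (D - ln u) - u `^ (1 + delta).

Lemma powR1D delta u : 0 < delta -> 0 <= u -> u `^ (1 + delta) = u * u `^ delta.
Proof.
move=> d0 u0; rewrite powRD ?powRr1//.
by rewrite (gt_eqF (_ : 0 < 1 + delta)) ?implybF//; lra.
Qed.

Lemma barrier0 D delta : 0 < delta -> barrier D delta 0 = 0.
Proof. by move=> d0; rewrite /barrier mul0r powR0 ?subr0//; rewrite gt_eqF//; lra. Qed.

Lemma barrier_ge0 D delta L u : 0 < delta -> 0 <= u <= L ->
  ln L + L `^ delta <= D -> 0 <= barrier D delta u.
Proof.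
move=> d0 /andP[]; rewrite le_eqVlt => /predU1P[<-|u0] uL LD; first by rewrite barrier0.
have L0 : 0 < L by exact: lt_le_trans uL.
rewrite /barrier powR1D ?(ltW u0)// -mulrBr mulr_ge0 ?(ltW u0)//.
have : ln u <= ln L by rewrite ler_ln ?posrE.
have : u `^ delta <= L `^ delta.
  by apply: ge0_ler_powR; rewrite ?nnegrE ?(ltW d0) ?(ltW u0) ?(ltW L0).
lra.
Qed.

(** Controls how negative the barrier becomes for large [u], at a cost of order [1/D]. With
    [t = u^delta] and [c = 1 + 1/delta], the bound [ln u <= t / delta] reduces it to
    [D - c t + c^2 t^2 / D >= 0], a completed square. *)
Lemma barrier_lower D delta u : 0 < delta -> 0 < D -> 0 <= u ->
  0 <= barrier D delta u + (1 + delta^-1) ^+ 2 / D * u `^ (1 + 2 * delta).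
Proof.
move=> d0 D0; rewrite le_eqVlt => /predU1P[<-|u0].
  by rewrite barrier0// add0r mulr_ge0 ?powR_ge0// divr_ge0 ?sqr_ge0 ?(ltW D0).
have u0' := ltW u0.
have -> : u `^ (1 + 2 * delta) = u * (u `^ delta) ^+ 2.
  rewrite powRD ?(gt_eqF u0) ?implybT// powRr1//; congr (_ * _).
  by rewrite expr2 -powRD ?(gt_eqF u0) ?implybT//; congr powR; ring.
rewrite /barrier powR1D//.
have := ln_le_powR d0 u0; set t := u `^ delta; set c := 1 + delta^-1 => lt.
have -> : u * (D - ln u) - u * t + c ^+ 2 / D * (u * t ^+ 2) =
  u * (D - ln u - t + c ^+ 2 / D * t ^+ 2) by ring.
rewrite mulr_ge0//.
have : 0 <= D - c * t + c ^+ 2 / D * t ^+ 2.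
  have -> : D - c * t + c ^+ 2 / D * t ^+ 2 =
      D * ((c * t / D - 2^-1) ^+ 2 + 3 / 4) by field; rewrite gt_eqF.
  by rewrite mulr_ge0 ?(ltW D0)// addr_ge0 ?sqr_ge0// divr_ge0.
rewrite /c mulrDl mul1r [delta^-1 * t]mulrC; move: lt.
move: (ln u) (t / delta) (_ ^+ 2 / D * _) => x y z; lra.
Qed.

(** From [ln (1/u) <= u^(-c) / c]. An exponent below 1 makes the first moment of a spin
    sufficient. *)
Lemma barrier_upper D delta c u : 0 < c -> 0 <= D -> 0 <= u ->
  barrier D delta u <= D * u + u `^ (1 - c) / c.
Proof.
move=> c0 D0; rewrite le_eqVlt => /predU1P[<-|u0].
  rewrite /barrier !(mul0r, mulr0) sub0r add0r.
  apply: (@le_trans _ _ 0); first by rewrite oppr_le0 powR_ge0.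
  by rewrite divr_ge0 ?powR_ge0 ?ltW.
have ui : 0 < u^-1 by rewrite invr_gt0.
have := ln_le_powR c0 ui; rewrite lnV ?posrE// powR_inv ?(ltW u0)// => h.
have := powR_ge0 u (1 + delta); rewrite /barrier.
have -> : u `^ (1 - c) / c = u * ((u `^ c)^-1 / c).
  by rewrite powRD ?(gt_eqF u0) ?implybT// powRr1 ?(ltW u0)// powRN mulrA.
move: h; rewrite -(ler_pM2l u0) => h k.
have -> : u * (D - ln u) = D * u + u * (- ln u) by ring.
lra.
Qed.

(** Recovers mass from the potential. Above [tau] the power dominates; below [tau] the logarithm is
    at least [D - ln tau]. A small [tau] makes the coefficient of the barrier small, which matters
    because the summed barrier is only known to be bounded. *)
Lemma barrier_mass D delta L tau u : 0 < delta -> 0 <= u <= L ->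
  ln L + L `^ delta <= D -> 0 < tau -> 0 < D - ln tau ->
  u <= (tau `^ (- delta) + (D - ln tau)^-1) * u `^ (1 + delta)
       + (D - ln tau)^-1 * barrier D delta u.
Proof.
move=> d0 uL LD t0 Dt.
have b0 := barrier_ge0 d0 uL LD.
have /andP[u0 _] := uL.
have Di : 0 <= (D - ln tau)^-1 by rewrite invr_ge0 ltW.
have p0 := powR_ge0 u (1 + delta).
have q0 := powR_ge0 tau (- delta).
have [tu|ut] := leP tau u.
  apply: (@le_trans _ _ (tau `^ (- delta) * u `^ (1 + delta))); last first.
    by rewrite mulrDl -addrA lerDl addr_ge0// mulr_ge0.
  rewrite powR1D// mulrCA ler_peMr// powRN.
  rewrite mulrC ler_pdivlMr ?powR_gt0// mul1r.
  by apply: ge0_ler_powR; rewrite ?nnegrE ?(ltW t0) ?(ltW d0).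
move: u0 p0; rewrite le_eqVlt => /predU1P[<-|u0] p0.
  by rewrite barrier0// mulr0 addr0 mulr_ge0 ?powR_ge0// addr_ge0.
apply: (@le_trans _ _ ((D - ln tau)^-1 * u `^ (1 + delta) + (D - ln tau)^-1 * barrier D delta u)).
  rewrite -mulrDr mulrC ler_pdivlMr// /barrier [leRHS]addrC subrK ler_pM2l// lerB//.
  by rewrite ler_ln ?posrE// ltW.
by rewrite lerD2r ler_wpM2r// lerDr.
Qed.

Section OneStep.
Variables (D delta L p rho m1 mlog md b kappa : R).
Hypothesis delta01 : 0 < delta <= 1.
Hypothesis p_gt0 : 0 < p.
Hypothesis rho_gt0 : 0 < rho.
Hypothesis rhoE : rho = p * m1.
Hypothesis mlog_ge : m1 <= mlog.
Hypothesis kappa_gt0 : 0 < kappa.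
Hypothesis kappaE : kappa = p * md - (1 + delta) * rho.
Hypothesis b_ge0 : 0 <= b.
Hypothesis b_small : p * b * L `^ delta <= kappa / 2.

(** The mean barrier of an echo of size [v], expanded by [ln (xi v) = ln xi + ln v]; the last term
    is the price of the cap. *)
Definition offspring v := m1 * (v * (D - ln v)) - mlog * v - md * v `^ (1 + delta)
  + b * v `^ (1 + 2 * delta).

(** Collects the second order terms [(rho / n)^2] produced by rescaling. In [step_gain], half of
    [kappa] has been spent on the cap, and the power of [1 + rho] converts rescaled values back. *)
Definition step_error := rho ^+ 2 * (1 + (1 + delta) * L `^ delta).
Definition step_gain := kappa / 2 / (1 + rho) `^ (1 + delta).

(** With [s = 1 + rho / n.+1] and [u = s v], the terms in [D] cancel exactly because [rho = p m1].
    The logarithmic terms leave at most [(rho / n.+1)^2 v] since [m1 <= mlog], and the power terms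
    leave [- kappa / n.+1] times [v^(1 + delta)] up to second order; the cap takes half of this. *)
Lemma barrier_step (n : nat) u : 0 <= u <= L ->
  barrier D delta (u / (1 + rho / n.+1%:R)) + p / n.+1%:R * offspring (u / (1 + rho / n.+1%:R))
  <= barrier D delta u - step_gain / n.+1%:R * u `^ (1 + delta)
     + step_error * n.+1%:R `^ (- (1 + 1)) * u.
Proof.
have /andP[d0 d1] := delta01; have r0 := rho_gt0; have p0 := p_gt0.
have N0 : 0 < n.+1%:R :> R by rewrite ltr0n.
have N1 : 1 <= n.+1%:R :> R by rewrite ler1n.
move: (n.+1%:R : R) N0 N1 => N N0 N1; set s := 1 + rho / N.
have rN : 0 < rho / N by rewrite divr_gt0.
have s1 : 1 <= s by rewrite lerDl ltW.
have s0 : 0 < s by lra.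
have sr : s <= 1 + rho by rewrite lerD2l ler_pdivrMr// ler_peMr// ltW.
move=> /andP[]; rewrite le_eqVlt => /predU1P[<-|u0] uL.
  have e1 : 1 + delta != 0 by rewrite gt_eqF//; lra.
  have e2 : 1 + 2 * delta != 0 by rewrite gt_eqF//; lra.
  rewrite mul0r barrier0// /offspring (powR0 e1) (powR0 e2) !(mulr0, mul0r).
  by rewrite !(mulr0, subr0, addr0).
have [v vE] : exists v, v = u / s by exists (u / s).
rewrite -vE; have {}vE : u = s * v by rewrite vE mulrC divfK// gt_eqF.
have v0 : 0 < v by rewrite -(pmulr_rgt0 _ s0) -vE.
have vu : v <= u by rewrite vE ler_peMl// ltW.
have vL : v <= L by exact: le_trans uL.
have v0' := ltW v0.
have L0 : 0 < L by exact: lt_le_trans vL.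
have vd0 := powR_ge0 v (1 + delta).
have Ld0 := powR_ge0 L delta.
have vdL : v `^ delta <= L `^ delta by apply: ge0_ler_powR; rewrite ?nnegrE ?(ltW d0) ?(ltW L0).
have lns : ln s <= rho / N by apply: le_ln1Dx; lra.
have lnu : ln u = ln s + ln v by rewrite vE lnM ?posrE.
have udE : u `^ (1 + delta) = s `^ (1 + delta) * v `^ (1 + delta).
  by rewrite vE powRM ?(ltW s0).
have v2E : v `^ (1 + 2 * delta) = v `^ delta * v `^ (1 + delta).
  by rewrite -powRD ?(gt_eqF v0) ?implybT//; congr powR; ring.
have sd : s `^ (1 + delta) - 1 <= (1 + delta) * (rho / N) + (1 + delta) * (rho / N) ^+ 2.
  have := @powR_tangent R (1 + delta) 1 s _ ler01 s0; rewrite powR1 => /(_ _).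
  have -> : 1 + delta - 1 = delta by ring.
  (* The bound [delta <= 1] enters here, so that the slope is estimated by a polynomial in
     [rho / N]. *)
  have ss : s `^ delta <= s.
    by rewrite -[leRHS]powRr1 ?(ltW s0)//; apply: ler_powR.
  have h : (1 + delta) * s `^ delta * (s - 1) <= (1 + delta) * s * (s - 1).
    by rewrite ler_wpM2r ?subr_ge0// ler_wpM2l//; lra.
  move=> H; have {}H := H ltac:(lra).
  have -> : (1 + delta) * (rho / N) + (1 + delta) * (rho / N) ^+ 2 = (1 + delta) * s * (s - 1).
    by rewrite /s; ring.
  apply: le_trans h; move: H.
  have -> : 1 - s = - (s - 1) by ring.
  rewrite mulrN; lra.
have gain : step_gain / N * u `^ (1 + delta) <= kappa / 2 / N * v `^ (1 + delta).
  rewrite udE /step_gain mulrA ler_wpM2r//.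
  have -> : kappa / 2 / (1 + rho) `^ (1 + delta) / N * s `^ (1 + delta) =
    kappa / 2 / N * (s `^ (1 + delta) / (1 + rho) `^ (1 + delta)) by ring.
  rewrite ler_piMr//; first by rewrite !divr_ge0// ltW.
  rewrite ler_pdivrMr ?mul1r; last by apply: powR_gt0; lra.
  by apply: ge0_ler_powR; rewrite ?nnegrE; lra.
have N2 : N `^ (- (1 + 1)) = N^-1 ^+ 2.
  rewrite powRN powRD; last by rewrite (gt_eqF N0) implybT.
  by rewrite !powRr1 ?(ltW N0)// exprVn.
have bv : p / N * (b * v `^ (1 + 2 * delta)) <= kappa / 2 / N * v `^ (1 + delta).
  rewrite v2E.
  have -> : p / N * (b * (v `^ delta * v `^ (1 + delta))) =
     p * b * v `^ delta * (N^-1 * v `^ (1 + delta)) by ring.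
  have -> : kappa / 2 / N * v `^ (1 + delta) = kappa / 2 * (N^-1 * v `^ (1 + delta)) by ring.
  rewrite ler_wpM2r ?mulr_ge0 ?invr_ge0 ?(ltW N0)//.
  apply: le_trans b_small; rewrite ler_wpM2l ?mulr_ge0// ltW//.
have sls : s * v * ln s - p / N * (mlog * v) <= (rho / N) ^+ 2 * v.
  have h1 : s * v * ln s <= s * v * (rho / N) by rewrite ler_wpM2l// mulr_ge0// ltW.
  have h2 : rho / N * v <= p / N * (mlog * v).
    rewrite rhoE.
    have -> : p * m1 / N * v = p / N * v * m1 by ring.
    have -> : p / N * (mlog * v) = p / N * v * mlog by ring.
    by rewrite ler_wpM2l// mulr_ge0// ltW// divr_gt0.
  have -> : (rho / N) ^+ 2 * v = s * v * (rho / N) - rho / N * v by rewrite /s; ring.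
  lra.
have sds : (s `^ (1 + delta) - 1) * v `^ (1 + delta) - p / N * (md * v `^ (1 + delta)) <=
    (1 + delta) * L `^ delta * (rho / N) ^+ 2 * v - kappa / N * v `^ (1 + delta).
  have h1 : (s `^ (1 + delta) - 1) * v `^ (1 + delta) <=
    ((1 + delta) * (rho / N) + (1 + delta) * (rho / N) ^+ 2) * v `^ (1 + delta).
    by rewrite ler_wpM2r.
  have h2 : (1 + delta) * (rho / N) ^+ 2 * v `^ (1 + delta) <=
    (1 + delta) * L `^ delta * (rho / N) ^+ 2 * v.
    rewrite powR1D//.
    have -> : (1 + delta) * (rho / N) ^+ 2 * (v * v `^ delta) =
      (1 + delta) * (rho / N) ^+ 2 * v * v `^ delta by ring.
    have -> : (1 + delta) * L `^ delta * (rho / N) ^+ 2 * v =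
      (1 + delta) * (rho / N) ^+ 2 * v * L `^ delta by ring.
    by rewrite ler_wpM2l// (mulr_ge0 (mulr_ge0 _ (sqr_ge0 _)) v0')//; lra.
  have h3 : kappa / N * v `^ (1 + delta) =
     p / N * (md * v `^ (1 + delta)) - (1 + delta) * (rho / N) * v `^ (1 + delta).
    by rewrite kappaE; ring.
  rewrite h3; move: h1 h2; rewrite [X in _ <= X -> _]mulrDl.
  move: ((1 + delta) * (rho / N) ^+ 2 * v `^ (1 + delta)) ((1 + delta) * L `^ delta * (rho / N) ^+ 2 * v)
    ((1 + delta) * (rho / N) * v `^ (1 + delta)) (p / N * (md * v `^ (1 + delta)))
    ((s `^ (1 + delta) - 1) * v `^ (1 + delta)) => z1 z2 z3 z4 z5; lra.
have errE : step_error * N `^ (- (1 + 1)) * v <= step_error * N `^ (- (1 + 1)) * u.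
  rewrite ler_wpM2l// mulr_ge0 ?powR_ge0// mulr_ge0 ?sqr_ge0//.
  by rewrite addr_ge0// mulr_ge0//; lra.
apply: le_trans (_ : _ <= barrier D delta u - step_gain / N * u `^ (1 + delta)
   + step_error * N `^ (- (1 + 1)) * v) _; last by rewrite lerD2l.
have errE' : step_error * N `^ (- (1 + 1)) * v = (rho / N) ^+ 2 * v +
   (1 + delta) * L `^ delta * (rho / N) ^+ 2 * v.
  by rewrite N2 /step_error; ring.
rewrite errE'.
have bu : barrier D delta u = s * v * (D - ln s - ln v) - s `^ (1 + delta) * v `^ (1 + delta).
  by rewrite /barrier lnu udE vE; ring.
have key : barrier D delta v + p / N * offspring v - barrier D delta u =
   (s * v * ln s - p / N * (mlog * v))
   + ((s `^ (1 + delta) - 1) * v `^ (1 + delta) - p / N * (md * v `^ (1 + delta)))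
   + p / N * (b * v `^ (1 + 2 * delta)).
  rewrite bu /offspring /barrier /s rhoE; ring.
have half : kappa / N * v `^ (1 + delta) =
  kappa / 2 / N * v `^ (1 + delta) + kappa / 2 / N * v `^ (1 + delta) by field; rewrite gt_eqF.
move: key; move: (barrier D delta v + p / N * offspring v) => z0 key.
have -> : z0 = barrier D delta u + (z0 - barrier D delta u) by rewrite addrC subrK.
rewrite key; move: sls sds bv gain; rewrite half {errE errE'}.
move: (s * v * ln s - p / N * (mlog * v)) (p / N * (b * v `^ (1 + 2 * delta)))
  ((s `^ (1 + delta) - 1) * v `^ (1 + delta) - p / N * (md * v `^ (1 + delta)))
  (kappa / 2 / N * v `^ (1 + delta)) (step_gain / N * u `^ (1 + delta))
  ((rho / N) ^+ 2 * v) ((1 + delta) * L `^ delta * (rho / N) ^+ 2 * v)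
  (barrier D delta u) => z1 z2 z3 z4 z5 z6 z7 z8.
lra.
Qed.

End OneStep.

End Barrier.

(* Otherwise the harmonic series would converge. *)
Lemma small_term (R : realType) (q e t : nat -> R) (kappa : R) : 0 < kappa ->
  (forall n, 0 <= q n) -> (forall n, 0 <= t n) ->
  (forall n, q n.+1 + t n.+1 + kappa / n.+1%:R * e n <= q n + t n) ->
  forall eta m, 0 < eta -> exists2 n, (m <= n)%N & e n <= eta.
Proof.
move=> k0 q0 t0 H eta m eta0.
have [[n mn en]|no] := pselect (exists2 n, (m <= n)%N & e n <= eta); first by exists n.
exfalso.
have big n : (m <= n)%N -> eta <= e n.
  by move=> mn; rewrite leNgt; apply/negP => en; apply: no; exists n => //; exact: ltW.
have ke : 0 < kappa * eta by rewrite mulr_gt0.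
have mono n : (m <= n)%N ->
    q n + t n + kappa * eta * ln n.+1%:R <= q m + t m + kappa * eta * ln m.+1%:R.
  elim: n => [|n IH]; first by rewrite leqn0 => /eqP ->.
  rewrite leq_eqVlt => /predU1P[<-//|]; rewrite ltnS => mn; apply: le_trans (IH mn).
  have N0 : 0 < n.+1%:R :> R by rewrite ltr0n.
  have h1 : kappa / n.+1%:R * eta <= kappa / n.+1%:R * e n.
    by rewrite ler_wpM2l ?big// divr_ge0 ?(ltW k0).
  have h2 : ln n.+2%:R <= ln n.+1%:R + n.+1%:R^-1 :> R.
    have -> : n.+2%:R = n.+1%:R * (1 + n.+1%:R^-1) :> R.
      by rewrite mulrDr mulr1 mulfV ?gt_eqF// natr1.
    have i0 : 0 < n.+1%:R^-1 :> R by rewrite invr_gt0.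
    have p1 : 0 < 1 + n.+1%:R^-1 :> R by rewrite addr_gt0.
    rewrite lnM ?posrE//.
    by rewrite lerD2l; apply: le_ln1Dx; apply: lt_trans i0; rewrite ltrN10.
  have h3 : kappa * eta * ln n.+2%:R <= kappa * eta * ln n.+1%:R + kappa / n.+1%:R * eta.
    have -> : kappa / n.+1%:R * eta = kappa * eta * n.+1%:R^-1 by ring.
    by rewrite -mulrDr ler_pM2l.
  have := H n; move: h1 h3; clear h2 N0.
  move: (kappa / n.+1%:R * e n) (kappa / n.+1%:R * eta) (kappa * eta * ln n.+2%:R)
    (kappa * eta * ln n.+1%:R) => z1 z2 z3 z4; lra.
(* The whole budget divided by the rate at which it would be spent; the logarithm exceeds it once
   [n] passes [exp B]. *)
pose B := (q m + t m + kappa * eta * ln m.+1%:R) / (kappa * eta).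
pose n := maxn m (Num.Def.archi_bound (expR B)).
have nB : expR B < n.+1%:R.
  apply: (@lt_le_trans _ _ (Num.Def.archi_bound (expR B))%:R).
    by apply: archi_boundP; exact: expR_ge0.
  by rewrite ler_nat ltnW// ltnS leq_maxr.
have : B < ln n.+1%:R by rewrite -ltr_expR lnK ?posrE ?ltr0n.
rewrite /B ltr_pdivrMr// mulrC => Bn.
have := mono n (leq_maxl _ _); have := q0 n; have := t0 n; lra.
Qed.

(** * The stopped mass and its potential in the critical case *)

Section Extinction.
Context (d : measure_display) (T : measurableType d) (R : realType).
Variable P : probability T R.
Variables (p : R) (X xi : {RV P >-> R}).
Variables (Xs : nat -> {RV P >-> R}) (eps : nat -> {RV P >-> bool})
  (U : nat -> {RV P >-> nat}) (xis : nat -> {RV P >-> R}).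
Hypothesis inputs : rwes_inputs Xs eps U xis p X xi.
Hypothesis p_gt0 : 0 < p.
Hypothesis p_le1 : p <= 1.
Variable rho : R.
Hypothesis rho_gt1 : 1 < rho.
Hypothesis rhoE : rho = p * Ex P (fun w => `|xi w|).
Hypothesis X_intg : intg P X.
Hypothesis xi_intg : intg P xi.

Local Notation x := (echoed_step Xs eps U xis).
Local Notation known := (known Xs eps U xis).
Local Notation a n := (growth rho n.+1).
Local Notation mart := (mart p X Xs eps U xis rho Num.norm).
Local Notation abs_sum := (abs_sum Xs eps U xis).
Local Notation drift := (drift p X Num.norm).

Definition tail n : R := (rho - 1)^-1 - inv_sum rho n.

(** The second term is the mass that future spins are expected to add. It keeps the process a
    martingale while making it nonnegative, in contrast with [mart], from which it differs by a
    constant. *)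
Definition total_mass n w : R := abs_sum n w / a n + drift * tail n.

Local Notation Z := total_mass.

Lemma drift_ge0 : 0 <= drift.
Proof. by apply: mulr_ge0; [rewrite subr_ge0|apply: Ex_ge0 => w /=]. Qed.

Lemma tail_ge0 n : 0 <= tail n.
Proof. by rewrite subr_ge0; have /andP[] := inv_sum_bound rho_gt1 n. Qed.

Lemma tail_cvg : tail n @[n --> \oo] --> (0 : R).
Proof.
rewrite -(subrr (rho - 1)^-1); apply: cvgB; first exact: cvg_cst.
exact: inv_sum_cvg.
Qed.

Lemma total_massE n w : Z n w = mart n w + drift / (rho - 1).
Proof.
have -> : mart n w = abs_sum n w / a n - drift * inv_sum rho n by [].
by rewrite /total_mass /tail; ring.
Qed.

Lemma abs_sum_total n w : abs_sum n w / a n <= Z n w.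
Proof. by rewrite lerDl mulr_ge0 ?drift_ge0 ?tail_ge0. Qed.

Lemma total_mass_ge0 n w : 0 <= Z n w.
Proof.
apply: le_trans (abs_sum_total n w).
by rewrite divr_ge0 ?abs_sum_ge0// ltW// a_gt0.
Qed.

Let abs_h : (forall y : R, `| `|y| | = `|y|). Proof. by move=> y; rewrite normr_id. Qed.

Lemma total_mass_intg n : intg P (Z n).
Proof.
apply: eq_intg (intgD (intg_mart inputs rho X_intg xi_intg (@normr_measurable R setT) abs_h n)
  (intg_cst P (drift / (rho - 1)))) => w.
by rewrite total_massE.
Qed.

Lemma known_total_mass m n : (m <= n)%N -> known (history n.+1) (Z m).
Proof.
move=> mn; have -> : Z m = (fun w => mart m w + drift / (rho - 1)).
  by apply/funext => w; rewrite total_massE.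
apply: knownD; last exact: known_cst.
exact: known_mart.
Qed.

Lemma total_mass_martingale n (W : T -> R) : known (history n.+1) W ->
  (forall w, `|W w| <= 1) ->
  Ex P (fun w => W w * Z n.+1 w) = Ex P (fun w => W w * Z n w).
Proof.
move=> kW W1.
have Wi : intg P W by apply: (intg_le (known_meas kW) (intg_cst P 1)).
have WZ m : intg P (fun w => W w * Z m w).
  by apply: (intgMb (c := 1)) => //; [exact: total_mass_intg|exact: known_meas kW].
have [[mh mg h0 hg hn] gi gm] := abs_pair rhoE xi_intg.
have Wh i : (1 <= i < n.+2)%N -> intg P (fun w => W w * `|x i w|).
  move=> /andP[i1 _]; apply: (intgMb (c := 1)) => //; last exact: known_meas kW.
  exact: (intg_h_step inputs X_intg xi_intg mh hn).
have [Di DE] := incr_mean0 inputs X_intg mh mg h0 hg hn gi gm kW Wi Wh.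
rewrite -[RHS]addr0 -DE -ExD//; apply: eq_Ex => w.
by rewrite -mulrDr !total_massE (martS p X Xs eps U xis rho_gt1) addrAC.
Qed.

Section Level.
Variable L : R.
Hypothesis L_ge1 : 1 <= L.

Let L_gt0 : 0 < L. Proof. exact: lt_le_trans L_ge1. Qed.

Local Notation A n := (calm Z L 0 n).

Lemma known_calm n : known (history n.+1) (A n).
Proof.
apply: known_prod => i; rewrite mem_index_iota ltnS => /andP[_ ni].
by apply: (known_comp (measurable_below L)); exact: known_total_mass.
Qed.

Lemma calm_norm n w : `|A n w| <= 1.
Proof. by have /andP[A0 A1] := calm01 Z L 0 n w; rewrite ger0_norm. Qed.

Lemma measurable_calm n : measurable_fun setT (A n).
Proof. by apply: (@known_meas _ _ _ _ Xs eps U xis (history n.+1)); exact: known_calm. Qed.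

Lemma intg_A n : intg P (A n).
Proof. by apply: (intg_le (measurable_calm n) (intg_cst P 1)) => w; exact: calm_norm. Qed.

Lemma calm_case n w : A n w = 0 \/ A n w = 1 /\ Z n w < L.
Proof.
have [[k kn Lk]|no] := pselect (exists2 k, (0 <= k <= n)%N & L <= Z k w).
  by left; exact: calm_eq0 Lk.
have H k : (0 <= k <= n)%N -> Z k w < L.
  by move=> kn; rewrite ltNge; apply/negP => Lk; apply: no; exists k.
by right; split; [exact: calm_eq1|apply: H; rewrite leqnn].
Qed.

Lemma step_bound n k b w : (1 <= k < n.+2)%N -> a n <= b -> Z n w < L ->
  0 <= `|x k w| / b < L.
Proof.
move=> kn ab ZL; have a0 := a_gt0 rho_gt1 n; have b0 : 0 < b by exact: lt_le_trans ab.
rewrite divr_ge0 ?(ltW b0)//=; apply: le_lt_trans ZL.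
apply: le_trans (abs_sum_total n w).
apply: (@le_trans _ _ (`|x k w| / a n)).
  by rewrite ler_wpM2l// lef_pV2 ?posrE.
rewrite ler_wpM2r ?invr_ge0 ?(ltW a0)//.
have -> : abs_sum n w = \sum_(1 <= j < n.+2) `|x j w| by [].
by rewrite (bigD1_seq k) ?mem_index_iota ?iota_uniq//= lerDl sumr_ge0.
Qed.

(** Boundedness is asked on [[0, L]] only: on the calm event every rescaled step lies there, and
    elsewhere the weight is zero. *)
Definition tame (f : R -> R) : Prop := measurable_fun setT f /\
  exists B, forall u, 0 <= u <= L -> `|f u| <= B.

Lemma tameD f g : tame f -> tame g -> tame (fun u => f u + g u).
Proof.
move=> [mf [B fB]] [mg [C gC]]; split; first exact: measurable_funD.
by exists (B + C) => u uL; apply: le_trans (ler_normD _ _) _; apply: lerD; [exact: fB|exact: gC].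
Qed.

Lemma tameZ c f : tame f -> tame (fun u => c * f u).
Proof.
move=> [mf [B fB]]; split; first by apply: measurable_funM.
by exists (`|c| * B) => u uL; rewrite normrM ler_wpM2l// fB.
Qed.

Lemma tameB f g : tame f -> tame g -> tame (fun u => f u - g u).
Proof.
move=> tf tg; have := tameD tf (tameZ (-1) tg).
by congr tame; apply/funext => u; rewrite mulN1r.
Qed.

Lemma tame_pow q : 0 < q -> tame (fun u => u `^ q).
Proof.
move=> q0; split; first exact: measurable_powR.
exists (L `^ q) => u /andP[u0 uL]; rewrite ger0_norm ?powR_ge0//.
by apply: ge0_ler_powR; rewrite ?nnegrE ?(ltW q0) ?(ltW L_gt0).
Qed.

Lemma tame_id : tame id.
Proof.
split; first exact: measurable_id.
by exists L => u /andP[u0 uL]; rewrite ger0_norm.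
Qed.

Lemma tame_xlnx : tame (fun u => u * ln u).
Proof.
split; first by apply: measurable_funM; [exact: measurable_id|exact: measurable_ln].
exists (1 + L ^+ 2) => u /andP[].
rewrite le_eqVlt => /predU1P[<-|u0] uL.
  by rewrite mul0r normr0 addr_ge0 ?sqr_ge0.
have h1 := ltW (ln_sublinear u0).
have ui : 0 < u^-1 by rewrite invr_gt0.
have := ltW (ln_sublinear ui); rewrite lnV ?posrE// => h2.
have {}h2 : u * - ln u <= 1 by rewrite -(mulfV (lt0r_neq0 u0)) ler_pM2l.
have h3 : u * ln u <= L ^+ 2.
  rewrite expr2; apply: (@le_trans _ _ (u * u)); first by rewrite ler_pM2l.
  by rewrite ler_pM ?(ltW u0).
have L2 := sqr_ge0 L.
rewrite ler_norml; apply/andP; split; move: h2; rewrite mulrN; lra.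
Qed.

Lemma tame_calm n k b f : tame f -> (1 <= k < n.+2)%N -> a n <= b ->
  known (history n.+1) (fun w => A n w * f (`|x k w| / b)) /\
  intg P (fun w => A n w * f (`|x k w| / b)).
Proof.
move=> [mf [B fB]] kn ab.
have kA : known (history n.+1) (fun w => A n w * f (`|x k w| / b)).
  apply: knownM; first exact: known_calm.
  apply: (@known_comp _ _ _ _ _ _ _ _ _ f) => //.
  have mh : measurable_fun setT (fun y : R => `|y| / b) by apply: measurable_funM.
  by apply: (known_comp mh); apply: known_step.
split => //; apply: (intg_le (known_meas kA) (intg_cst P `|B|)) => w.
have [->|[-> ZL]] := calm_case n w; first by rewrite mul0r normr0.
rewrite mul1r; apply: le_trans (ler_norm B); apply: fB.
by have /andP[u0 /ltW ->] := step_bound kn ab ZL; rewrite u0.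
Qed.

(** The scale [b] is kept separate from [n] because the step estimate evaluates the old steps on the
    new scale [a n.+1]. *)
Definition calm_sum n b f := Ex P (fun w => A n w * \sum_(1 <= k < n.+2) f (`|x k w| / b)).

Lemma calm_sumE n b f : tame f -> a n <= b ->
  intg P (fun w => A n w * \sum_(1 <= k < n.+2) f (`|x k w| / b)) /\
  calm_sum n b f = \sum_(1 <= k < n.+2) Ex P (fun w => A n w * f (`|x k w| / b)).
Proof.
move=> tf ab; have [i E] := @intg_range _ _ _ P (fun k w => A n w * f (`|x k w| / b)) 1 n.+2
  (fun k kn => (tame_calm tf kn ab).2).
have EE : (fun w => \sum_(1 <= k < n.+2) A n w * f (`|x k w| / b)) =1
   (fun w => A n w * \sum_(1 <= k < n.+2) f (`|x k w| / b)).
  by move=> w; rewrite mulr_sumr.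
by split; [exact: eq_intg EE i|rewrite -E; apply: eq_Ex => w; rewrite EE].
Qed.

Lemma calm_sumD n b f g : tame f -> tame g -> a n <= b ->
  calm_sum n b (fun u => f u + g u) = calm_sum n b f + calm_sum n b g.
Proof.
move=> tf tg ab; have [fi _] := calm_sumE tf ab; have [gi _] := calm_sumE tg ab.
rewrite /calm_sum -ExD//; apply: eq_Ex => w; by rewrite big_split/= mulrDr.
Qed.

Lemma calm_sumZ n b c f : tame f -> a n <= b ->
  calm_sum n b (fun u => c * f u) = c * calm_sum n b f.
Proof.
move=> tf ab; have [fi _] := calm_sumE tf ab.
by rewrite /calm_sum -ExZ//; apply: eq_Ex => w; rewrite -mulr_sumr mulrCA.
Qed.

Lemma calm_sum_le n s f g : tame f -> tame g -> 1 <= s ->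
  (forall u, 0 <= u <= L -> f (u / s) <= g u) ->
  calm_sum n (a n * s) f <= calm_sum n (a n) g.
Proof.
move=> tf tg s1 fg; have a0 := a_gt0 rho_gt1 n.
have ab : a n <= a n * s by rewrite ler_peMr// ltW.
have [fi _] := calm_sumE tf ab; have [gi _] := calm_sumE tg (lexx (a n)).
apply: Ex_le => // w; have [->|[-> ZL]] := calm_case n w; first by rewrite !mul0r.
rewrite !mul1r [leLHS]big_nat [leRHS]big_nat; apply: ler_sum => k kn.
rewrite invfM mulrA; apply: fg.
by have /andP[-> /ltW ->] := step_bound kn (lexx (a n)) ZL.
Qed.

Lemma calm_sum_ge0 n b f : a n <= b -> (forall u, 0 <= u <= L -> 0 <= f u) -> 0 <= calm_sum n b f.
Proof.
move=> ab f0; apply: Ex_ge0 => w; have [->|[-> ZL]] := calm_case n w; first by rewrite mul0r.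
rewrite mul1r big_nat; apply: sumr_ge0 => k kn; apply: f0.
by have /andP[-> /ltW ->] := step_bound kn ab ZL.
Qed.

Lemma calm_sum_mass n : calm_sum n (a n) id <= L.
Proof.
have [i _] := calm_sumE tame_id (lexx (a n)).
rewrite -[leRHS](Ex_cst P); apply: Ex_le => //; first exact: intg_cst.
move=> w; have [->|[-> ZL]] := calm_case n w; first by rewrite mul0r ltW.
by rewrite mul1r -mulr_suml; apply: le_trans (abs_sum_total n w) _; exact: ltW.
Qed.

Lemma calm_total n : Ex P (fun w => A n w * Z n w) <= calm_sum n (a n) id + drift * tail n.
Proof.
have [i _] := calm_sumE tame_id (lexx (a n)).
have c0 : 0 <= drift * tail n by rewrite mulr_ge0 ?drift_ge0 ?tail_ge0.
rewrite /calm_sum -[drift * tail n](Ex_cst P) -ExD//; last exact: intg_cst.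
apply: Ex_le.
- apply: (intgMb (c := 1)); [exact: total_mass_intg|exact: measurable_calm|].
  by move=> w; exact: calm_norm.
- by apply: intgD => //; exact: intg_cst.
- move=> w; rewrite -mulr_suml mulrDr lerD2l.
  by have /andP[A0 A1] := calm01 Z L 0 n w; rewrite ler_piMl.
Qed.

Section Potential.
Variable delta : R.
Hypothesis delta01 : 0 < delta <= 1.
Hypothesis xi_delta : intg P (fun w => `|xi w| `^ (1 + 2 * delta)).
Hypothesis critical : Ex P (fun w => `|xi w|) <= Ex P (fun w => `|xi w| * ln `|xi w|).

Let delta_gt0 : 0 < delta. Proof. by have /andP[] := delta01. Qed.

Let m1 := Ex P (fun w => `|xi w|).
Let mlog := Ex P (fun w => `|xi w| * ln `|xi w|).
Let md := Ex P (fun w => `|xi w| `^ (1 + delta)).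
Let m2 := Ex P (fun w => `|xi w| `^ (1 + 2 * delta)).
Let kappa := p * md - (1 + delta) * rho.

Lemma xi_pow : intg P (fun w => `|xi w| `^ (1 + delta)).
Proof.
have d0 := delta_gt0.
apply: (intg_le _ (intgD (intg_cst P 1) xi_delta)) => [|w].
  exact: (measurableT_comp (measurable_norm_powR (1 + delta))).
rewrite ger0_norm ?powR_ge0//; apply: powR_le_1D => //; apply/andP; split; lra.
Qed.

Lemma xi_log : intg P (fun w => `|xi w| * ln `|xi w|).
Proof.
have d0 := delta_gt0.
apply: (intg_le _ (intgD (intg_cst P 1) (intgZ delta^-1 xi_pow))) => [|w].
  apply: measurable_funM; first exact: measurableT_comp.
  by apply: (measurableT_comp (@measurable_ln R)); exact: measurableT_comp.
have := normr_ge0 (xi w); rewrite le_eqVlt => /predU1P[<-|].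
  by rewrite mul0r normr0 addr_ge0// mulr_ge0 ?powR_ge0// invr_ge0 ltW.
move: `|xi w| => u u0.
have h1 : u * ln u <= delta^-1 * u `^ (1 + delta).
  rewrite powR1D ?(ltW u0)// mulrCA ler_pM2l// mulrC; exact: ln_le_powR.
have ui : 0 < u^-1 by rewrite invr_gt0.
have := ltW (ln_sublinear ui); rewrite lnV ?posrE// => h2.
have {}h2 : u * - ln u <= 1 by rewrite -(mulfV (lt0r_neq0 u0)) ler_pM2l.
have h3 : 0 <= delta^-1 * u `^ (1 + delta) by rewrite mulr_ge0 ?powR_ge0// invr_ge0 ltW.
rewrite ler_norml; apply/andP; split; move: h2; rewrite mulrN; lra.
Qed.

(** Integrating [powR_xlnx] and using [mlog >= m1] gives [md >= (1 + delta) m1 + (delta^2 / 4) m1];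
    strictness survives at [mlog = m1]. *)
Lemma kappa_gt0 : 0 < kappa.
Proof.
have d0 := delta_gt0.
have m1_gt0 : 0 < m1.
  by rewrite -(pmulr_rgt0 _ p_gt0) -rhoE (lt_trans _ rho_gt1).
have i1 := intg_norm xi_intg.
have i2 := intgZ delta xi_log.
have i3 := intgZ 2 xi_log.
have i4 := intgZ (delta ^+ 2 / 4) (intgB i3 i1).
have : Ex P (fun w => `|xi w| + delta * (`|xi w| * ln `|xi w|)
    + delta ^+ 2 / 4 * (2 * (`|xi w| * ln `|xi w|) - `|xi w|)) <= md.
  apply: Ex_le; [exact: (intgD (intgD i1 i2) i4)|exact: xi_pow|move=> w].
  exact: powR_xlnx.
rewrite (ExD (intgD i1 i2) i4) (ExD i1 i2) (ExZ _ xi_log) (ExZ _ (intgB i3 i1)) (ExB i3 i1) (ExZ _ xi_log).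
rewrite -/m1 -/mlog => h.
have c : m1 <= mlog := critical.
have d2 : 0 < delta ^+ 2 / 4 by rewrite divr_gt0 ?exprn_gt0.
have h2 : delta ^+ 2 / 4 * m1 <= delta ^+ 2 / 4 * (2 * mlog - m1) by rewrite ler_pM2l//; lra.
have h3 : delta * m1 <= delta * mlog by rewrite ler_pM2l.
have h4 : 0 < delta ^+ 2 / 4 * m1 by rewrite mulr_gt0.
rewrite /kappa rhoE -/m1 mulrCA -mulrBr mulr_gt0//; lra.
Qed.

Variable D : R.
Hypothesis D_gt0 : 0 < D.
Hypothesis D_level : ln L + L `^ delta <= D.

(** The coefficient of [barrier_lower] times the echo moment of order [1 + 2 delta]. *)
Let b := (1 + delta^-1) ^+ 2 / D * m2.

Hypothesis D_small : p * b * L `^ delta <= kappa / 2.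

Local Notation barrier := (barrier D delta).
Local Notation offspring := (offspring D delta m1 mlog md b).

Lemma tame_ulog : tame (fun u => u * (D - ln u)).
Proof.
have := tameB (tameZ D tame_id) tame_xlnx.
by congr tame; apply/funext => u /=; rewrite mulrBr [u * D]mulrC.
Qed.

Lemma tame_barrier : tame barrier.
Proof. by apply: tameB; [exact: tame_ulog|apply: tame_pow; have := delta_gt0; lra]. Qed.

Lemma tame_offspring : tame offspring.
Proof.
have d0 := delta_gt0.
apply: tameD; last by apply: tameZ; apply: tame_pow; lra.
apply: tameB; last by apply: tameZ; apply: tame_pow; lra.
by apply: tameB; apply: tameZ; [exact: tame_ulog|exact: tame_id].
Qed.

(** A new step may land beyond [L], where the barrier can be negative. The cut keeps it nonnegative
    and changes nothing as long as the mass stays below [L]. *)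
Definition capped u := below L u * barrier u.

Lemma capped_ge0 u : 0 <= u -> 0 <= capped u.
Proof.
move=> u0; rewrite /capped /below; case: ltP => uL; last by rewrite mul0r.
by rewrite mul1r; apply: (@barrier_ge0 _ _ _ L) => //; rewrite u0 ltW.
Qed.

Lemma capped_lt u : u < L -> capped u = barrier u.
Proof. by move=> uL; rewrite /capped /below uL mul1r. Qed.

Lemma measurable_capped : measurable_fun setT capped.
Proof. by apply: measurable_funM; [exact: measurable_below|have [] := tame_barrier]. Qed.

Lemma capped_bounded : exists B, forall u, 0 <= u -> `|capped u| <= B.
Proof.
have [_ [B HB]] := tame_barrier; exists `|B| => u u0; rewrite /capped /below.
case: ltP => uL; last by rewrite mul0r normr0.
by rewrite mul1r; apply: le_trans (ler_norm B); apply: HB; rewrite u0 ltW.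
Qed.

Lemma capped_le u : 0 <= u ->
  capped u <= barrier u + (1 + delta^-1) ^+ 2 / D * u `^ (1 + 2 * delta).
Proof.
move=> u0; rewrite /capped /below; case: ltP => uL; last by rewrite mul0r barrier_lower.
by rewrite mul1r lerDl mulr_ge0 ?powR_ge0// divr_ge0 ?sqr_ge0// ltW.
Qed.

Lemma barrierM (z v : R) : 0 <= z -> 0 <= v -> barrier (z * v) =
  v * (D - ln v) * z - v * (z * ln z) - v `^ (1 + delta) * z `^ (1 + delta).
Proof.
move=> z0 v0.
have pd0 : 0 `^ (1 + delta) = 0 :> R by rewrite powR0// gt_eqF//; have := delta_gt0; lra.
have -> : barrier (z * v) = z * v * (D - ln (z * v)) - (z * v) `^ (1 + delta) by [].
rewrite powRM//.
move: z0; rewrite le_eqVlt => /predU1P[<-|z0].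
  by rewrite pd0; ring.
move: v0; rewrite le_eqVlt => /predU1P[<-|v0].
  by rewrite pd0; ring.
by rewrite lnM ?posrE//; ring.
Qed.

(** The cap is first replaced by the barrier plus its penalty; the barrier of a product then splits
    into echo moments times functions of the parent, which independence separates. *)
Lemma echo_offspring n k c : (1 <= k < n.+2)%N -> a n <= c ->
  intg P (fun w => A n w * capped (`|xis n.+2 w * x k w| / c)) /\
  Ex P (fun w => A n w * capped (`|xis n.+2 w * x k w| / c)) <=
  Ex P (fun w => A n w * offspring (`|x k w| / c)).
Proof.
move=> kn ac; have d0 := delta_gt0; have a0 := a_gt0 rho_gt1 n.
have c0 : 0 < c by exact: lt_le_trans ac.
have [B HB] := capped_bounded.
have mx : measurable_fun setT (x k) by case/andP: kn => k1 _; exact: meas_step.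
have mc : measurable_fun setT (fun w => A n w * capped (`|xis n.+2 w * x k w| / c)).
  apply: measurable_funM; first exact: measurable_calm.
  apply: (measurableT_comp measurable_capped); apply: measurable_funM => //.
  by apply: measurableT_comp => //; apply: measurable_funM.
have ci : intg P (fun w => A n w * capped (`|xis n.+2 w * x k w| / c)).
  apply: (intg_le mc (intg_cst P B)) => w; rewrite normrM.
  have u0 : 0 <= `|xis n.+2 w * x k w| / c by rewrite divr_ge0// ltW.
  apply: le_trans (HB _ u0); rewrite ler_piMl//; exact: calm_norm.
split => //.
pose v w := `|x k w| / c.
have [k1 i1] := tame_calm tame_ulog kn ac.
have [k2 i2] := tame_calm tame_id kn ac.
have tp1 : tame (fun u => u `^ (1 + delta)) by apply: tame_pow; lra.
have tp2 : tame (fun u => u `^ (1 + 2 * delta)) by apply: tame_pow; lra.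
have [k3 i3] := tame_calm tp1 kn ac.
have [k4 i4] := tame_calm tp2 kn ac.
have [j1 E1] := echo_product inputs (@normr_measurable R setT) k1 i1 (intg_norm xi_intg).
have mlg : measurable_fun setT (fun y : R => `|y| * ln `|y|).
  apply: measurable_funM => //.
  exact: (measurableT_comp (@measurable_ln R) (@normr_measurable R setT)).
have [j2 E2] := echo_product inputs mlg k2 i2 xi_log.
have [j3 E3] := echo_product inputs (measurable_norm_powR (1 + delta)) k3 i3 xi_pow.
have [j4 E4] := echo_product inputs (measurable_norm_powR (1 + 2 * delta)) k4 i4 xi_delta.
have j4' := intgZ ((1 + delta^-1) ^+ 2 / D) j4.
have j12 := intgB j1 j2; have j123 := intgB j12 j3; have jj := intgD j123 j4'.
apply: (@le_trans _ _ _ _ _ (Ex_le ci jj _)) => [w|]; last first.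
  rewrite (ExD j123 j4') (ExB j12 j3) (ExB j1 j2) (ExZ _ j4) E1 E2 E3 E4.
  have o1 := intgZ m1 i1; have o2 := intgZ mlog i2; have o3 := intgZ md i3; have o4 := intgZ b i4.
  have o12 := intgB o1 o2; have o123 := intgB o12 o3.
  have -> : Ex P (fun w => A n w * offspring (v w)) =
    Ex P (fun w => m1 * (A n w * (v w * (D - ln (v w)))) - mlog * (A n w * v w)
       - md * (A n w * v w `^ (1 + delta)) + b * (A n w * v w `^ (1 + 2 * delta))).
    apply: eq_Ex => w.
    have -> : offspring (v w) = m1 * (v w * (D - ln (v w))) - mlog * v w
      - md * v w `^ (1 + delta) + b * v w `^ (1 + 2 * delta) by [].
    ring.
  rewrite (ExD o123 o4) (ExB o12 o3) (ExB o1 o2) (ExZ _ i1) (ExZ _ i2) (ExZ _ i3) (ExZ _ i4).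
  rewrite /b le_eqVlt; apply/orP; left; apply/eqP.
  rewrite /m1 /mlog /md /m2 /v /=; ring.
have v0 : 0 <= v w by apply: divr_ge0 => //; exact: ltW.
have /andP[A0 A1] := calm01 Z L 0 n w.
have -> : `|xis n.+2 w * x k w| / c = `|xis n.+2 w| * v w by rewrite normrM mulrA.
have z0 := normr_ge0 (xis n.+2 w).
have := capped_le (mulr_ge0 z0 v0); rewrite (barrierM z0 v0) (powRM _ z0 v0) => h.
apply: le_trans (ler_wpM2l A0 h) _; rewrite le_eqVlt; apply/orP; left; apply/eqP.
rewrite /v /=; ring.
Qed.

Local Notation q n := (calm_sum n (a n) barrier).
Local Notation e n := (calm_sum n (a n) (fun u => u `^ (1 + delta))).

Lemma calm_le n w : A n.+1 w <= A n w.
Proof.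
have /andP[A0 A1] := calm01 Z L 0 n w.
rewrite calmS// ler_piMr//.
by have /andP[] := below01 L (Z n.+1 w).
Qed.

(** The potential loses [step_gain / n.+1] times the power sum, up to a rescaling error of order
    [n^-2] and the contribution of a fresh spin. *)
Lemma potential_step n : q n.+1 + step_gain delta rho kappa / n.+1%:R * e n <=
  q n + (step_error delta L rho * n.+1%:R `^ (- (1 + 1)) * L
         + (1 - p) * Ex P (fun w => capped (`|X w| / a n.+1))).
Proof.
have d0 := delta_gt0; have rho0 := rho_gt0 rho_gt1; have L0 := L_gt0.
have a0 := a_gt0 rho_gt1 n; have a1 := a_gt0 rho_gt1 n.+1.
have N0 : 0 < n.+1%:R :> R by rewrite ltr0n.
pose s := 1 + rho / n.+1%:R.
have s1 : 1 <= s by rewrite lerDl divr_ge0 ?(ltW rho0).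
have aS : a n.+1 = a n * s by rewrite growthS.
have ab : a n <= a n.+1 by rewrite aS ler_peMr// ltW.
have tpow : tame (fun u => u `^ (1 + delta)) by apply: tame_pow; lra.
have kA : known (history n.+1) (A n) by exact: known_calm.
have [B HB] := capped_bounded.
have mX : measurable_fun setT (fun y : R => capped (`|y| / a n.+1)).
  by apply: (measurableT_comp measurable_capped); apply: measurable_funM.
have Xi : intg P ((fun y : R => capped (`|y| / a n.+1)) \o X).
  apply: (intg_le _ (intg_cst P B)) => [|w]; first exact: measurableT_comp.
  by apply: HB; rewrite divr_ge0// ltW.
have h0 : capped (`|0 : R| / a n.+1) = 0 by rewrite normr0 mul0r /capped barrier0 ?mulr0.
have [i E] := @one_step_Ex _ _ _ _ _ _ _ _ _ _ _ inputs n (A n)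
  (fun y => capped (`|y| / a n.+1)) mX h0 kA (intg_A n) Xi
  (fun k kn => (echo_offspring kn ab).1).
have [bi _] := calm_sumE tame_barrier ab.
have [bi' _] := calm_sumE (n := n.+1) tame_barrier (lexx (a n.+1)).
have c0 w : 0 <= capped (`|x n.+2 w| / a n.+1).
  by apply: capped_ge0; rewrite divr_ge0// ltW.
(* Stopping at time [n.+1] only discards nonnegative terms; if the mass is still below [L], the cap
   does not act on the new step. *)
have st1 : q n.+1 <= calm_sum n (a n.+1) barrier + Ex P (fun w => A n w * capped (`|x n.+2 w| / a n.+1)).
  rewrite /calm_sum -ExD//; apply: Ex_le => //; first exact: intgD.
  move=> w; have /andP[A0 A1] := calm01 Z L 0 n w.
  have [->|[A1' ZL]] := calm_case n.+1 w.
    rewrite mul0r addr_ge0//; last by rewrite mulr_ge0.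
    have [->|[-> ZL]] := calm_case n w; first by rewrite mul0r.
    rewrite mul1r big_nat; apply: sumr_ge0 => k kn.
    apply: (barrier_ge0 (L := L)) => //.
    by have /andP[-> /ltW ->] := step_bound kn ab ZL.
  have An : A n w = 1.
    have := calm_le n w; rewrite A1' => h; apply/eqP; rewrite eq_le h andbT; exact: A1.
  rewrite A1' An !mul1r big_nat_recr//= lerD2l capped_lt//.
  have kn : (1 <= n.+2 < n.+3)%N by rewrite ltnS leqnn.
  by have /andP[] := step_bound kn (lexx (a n.+1)) ZL.
have A1 : Ex P (A n) <= 1.
  rewrite -[leRHS](Ex_cst P); apply: Ex_le; [exact: intg_A|exact: intg_cst|move=> w].
  by have /andP[] := calm01 Z L 0 n w.
have [oi oE] := calm_sumE tame_offspring ab.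
have st2 : Ex P (fun w => A n w * capped (`|x n.+2 w| / a n.+1)) <=
   (1 - p) * Ex P (fun w => capped (`|X w| / a n.+1)) + p / n.+1%:R * calm_sum n (a n.+1) offspring.
  rewrite E; apply: lerD.
    rewrite -mulrA ler_wpM2l ?subr_ge0// ler_piMl//; apply: Ex_ge0 => w /=.
    by apply: capped_ge0; rewrite divr_ge0// ltW.
  rewrite ler_wpM2l ?divr_ge0 ?(ltW p_gt0)// oE [leLHS]big_nat [leRHS]big_nat.
  by apply: ler_sum => k kn; exact: (echo_offspring kn ab).2.
have tof := tameZ (p / n.+1%:R) tame_offspring.
pose er := step_error delta L rho * n.+1%:R `^ (- (1 + 1)).
have er0 : 0 <= er.
  rewrite mulr_ge0 ?powR_ge0// mulr_ge0 ?sqr_ge0// addr_ge0// mulr_ge0 ?powR_ge0//; lra.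
pose gn := step_gain delta rho kappa / n.+1%:R.
(* The deterministic one-step inequality, applied to every old step at once; the remaining error is
   proportional to the stopped mass, which is at most [L]. *)
have st3 : calm_sum n (a n.+1) barrier + p / n.+1%:R * calm_sum n (a n.+1) offspring <=
    q n - gn * e n + er * L.
  have tg := tameZ gn tpow; have te := tameZ er tame_id.
  pose F u := barrier u + p / n.+1%:R * offspring u.
  pose H0 u := barrier u + (- gn) * u `^ (1 + delta).
  pose H u := H0 u + er * u.
  have tF : tame F := tameD tame_barrier tof.
  have tH0 : tame H0 := tameD tame_barrier (tameZ (- gn) tpow).
  have tH : tame H := tameD tH0 te.
  have c1 : calm_sum n (a n.+1) F =
      calm_sum n (a n.+1) barrier + p / n.+1%:R * calm_sum n (a n.+1) offspring.
    apply: etrans (calm_sumD tame_barrier tof ab) _; congr (_ + _).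
    exact: (calm_sumZ _ tame_offspring ab).
  have c2 z : z = a n * s -> calm_sum n z F <= calm_sum n (a n) H.
    move=> ->; apply: (calm_sum_le n tF tH s1) => u uL; rewrite /H /H0 mulNr.
    have b0 : 0 <= b.
      by rewrite mulr_ge0 ?divr_ge0 ?sqr_ge0 ?(ltW D_gt0)//; apply: Ex_ge0 => w; exact: powR_ge0.
    exact: (@barrier_step R D delta L p rho m1 mlog md b kappa delta01 p_gt0 rho0 rhoE critical
      kappa_gt0 erefl b0 D_small n u uL).
  have c3 : calm_sum n (a n) H = q n - gn * e n + er * calm_sum n (a n) id.
    apply: etrans (calm_sumD tH0 te (lexx _)) _; congr (_ + _); last first.
      exact: (calm_sumZ _ tame_id (lexx _)).
    apply: etrans (calm_sumD tame_barrier (tameZ (- gn) tpow) (lexx _)) _; congr (_ + _).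
    by rewrite -[RHS]mulNr; exact: (calm_sumZ _ tpow (lexx _)).
  have leeq (y z : R) : y = z -> y <= z by move=> ->.
  apply: (le_trans (leeq _ _ (esym c1))); apply: (le_trans (c2 _ aS)).
  apply: (le_trans (leeq _ _ c3)); rewrite lerD2l ler_wpM2l//.
  exact: calm_sum_mass.
rewrite -/gn -/er; move: st1 st2 st3.
move: (Ex P (fun w => A n w * capped (`|x n.+2 w| / a n.+1))) (er * L) (gn * e n)
  (p / n.+1%:R * calm_sum n (a n.+1) offspring) (calm_sum n (a n.+1) barrier) (q n) (q n.+1)
  ((1 - p) * Ex P (fun w => capped (`|X w| / a n.+1))) => z1 z2 z3 z4 z5 z6 z7 z8; lra.
Qed.

(** Chosen so that [rho (1 - c) = (1 + rho) / 2 = 1 + c']: the exponent stays below 1 for the spin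
    and exceeds 1 after rescaling. *)
Let c := (rho - 1) / (2 * rho).
Let c' := (rho - 1) / 2.

(** By [barrier_upper] and the growth bound, a spin rescaled by [a n.+1] contributes at most a
    multiple of [a n.+1] to the power [- (1 - c)], a summable sequence, although only [E|X|] is
    assumed. *)
Lemma spin_potential : exists2 K, 0 <= K &
  forall n, Ex P (fun w => capped (`|X w| / a n.+1)) <= K * n.+2%:R `^ (- (1 + c')).
Proof.
have d0 := delta_gt0; have rho0 := rho_gt0 rho_gt1; have r1 := rho_gt1.
have D0 := ltW D_gt0.
have c_gt0 : 0 < c by rewrite divr_gt0// ?mulr_gt0//; lra.
have c_lt1 : c < 1 by rewrite ltr_pdivrMr ?mulr_gt0//; lra.
have ic0 : 0 <= c^-1 by rewrite invr_ge0 ltW.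
have cE : rho * (1 - c) = 1 + c'.
  by rewrite /c /c'; field; rewrite gt_eqF.
have Xc : intg P (fun w => `|X w| `^ (1 - c)).
  apply: (intg_le _ (intgD (intg_cst P 1) (intg_norm X_intg))) => [|w].
    exact: (measurableT_comp (measurable_norm_powR (1 - c))).
  rewrite ger0_norm ?powR_ge0// -[X in _ <= 1 + X]powRr1//.
  by apply: powR_le_1D => //; apply/andP; split; lra.
pose K0 := D * Ex P (fun w => `|X w|) + c^-1 * Ex P (fun w => `|X w| `^ (1 - c)).
have E0 : 0 <= Ex P (fun w => `|X w|) by apply: Ex_ge0.
have E1 : 0 <= Ex P (fun w => `|X w| `^ (1 - c)) by apply: Ex_ge0 => w; exact: powR_ge0.
have K00 : 0 <= K0 by rewrite addr_ge0// mulr_ge0.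
pose G := Gamma_fun (1 + rho).
have G1 : 1 <= G by apply: Gamma_fun1D_ge1; exact: ltW.
have G0 : 0 < G by lra.
exists (K0 * G `^ (1 - c)) => [|n]; first by rewrite mulr_ge0 ?powR_ge0.
have a1 := a_gt0 rho_gt1 n.+1.
have aN : 1 <= a n.+1 by apply: le_trans (growth_ge_nat n.+1 (ltW rho_gt1)); rewrite ler1n.
have ai : (a n.+1)^-1 <= (a n.+1) `^ (- (1 - c)).
  rewrite -powR_inv1 ?(ltW a1)//; apply: ler_powR => //; lra.
have [B HB] := capped_bounded.
have mX : measurable_fun setT (fun y : R => capped (`|y| / a n.+1)).
  by apply: (measurableT_comp measurable_capped); apply: measurable_funM.
have Xi : intg P (fun w => capped (`|X w| / a n.+1)).
  apply: (intg_le _ (intg_cst P B)) => [|w]; first exact: (measurableT_comp mX).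
  by apply: HB; rewrite divr_ge0// ltW.
have i1 := intgZ D (intg_norm X_intg); have i2 := intgZ c^-1 Xc.
have i3 := intgZ ((a n.+1) `^ (- (1 - c))) (intgD i1 i2).
have st : Ex P (fun w => capped (`|X w| / a n.+1)) <= (a n.+1) `^ (- (1 - c)) * K0.
  rewrite /K0 -(ExZ _ (intg_norm X_intg)) -(ExZ _ Xc) -(ExD i1 i2) -(ExZ _ (intgD i1 i2)).
  apply: Ex_le => // w; set u := `|X w| / a n.+1.
  have u0 : 0 <= u by rewrite divr_ge0// ltW.
  apply: (@le_trans _ _ (D * u + u `^ (1 - c) / c)).
    rewrite /capped /below; case: ltP => _; first by rewrite mul1r barrier_upper.
    by rewrite mul0r addr_ge0// ?(mulr_ge0 D0 u0)// (mulr_ge0 (powR_ge0 _ _) ic0).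
  rewrite mulrDr; apply: lerD.
    by rewrite /u [leRHS]mulrCA (ler_wpM2l D0)// mulrC ler_wpM2r.
  rewrite /u powRM ?invr_ge0 ?(ltW a1)// powR_inv ?(ltW a1)// -powRN.
  by rewrite le_eqVlt; apply/orP; left; apply/eqP; ring.
apply: le_trans st _; rewrite mulrC -mulrA ler_wpM2l//.
have lo := growth_lower n.+1 (ltW rho_gt1).
have n2 : 0 < n.+2%:R :> R by rewrite ltr0n.
have -> : n.+2%:R `^ (- (1 + c')) = ((n.+2%:R `^ rho) `^ (1 - c))^-1 :> R.
  by rewrite -powRrM cE powRN.
rewrite powRN ler_pdivlMr ?powR_gt0// mulrC ler_pdivrMr ?powR_gt0//.
rewrite -powRM ?(ltW G0) ?(ltW a1)//; apply: ge0_ler_powR; rewrite ?nnegrE ?powR_ge0//.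
- lra.
- by rewrite mulr_ge0 ?(ltW G0) ?(ltW a1).
- by move: lo; rewrite ler_pdivrMr// mulrC.
Qed.

(** The stopped mass is split into thirds of [eta]: the deterministic tail, the power sum at a time
    supplied by [small_term], and the bounded potential with the small coefficient of
    [barrier_mass]. *)
Lemma calm_small (eta : R) m : 0 < eta ->
  exists2 n, (m <= n)%N & Ex P (fun w => A n w * Z n w) <= eta.
Proof.
move=> eta0; have d0 := delta_gt0; have rho0 := rho_gt0 rho_gt1; have r1 := rho_gt1.
have D0 := D_gt0; have L0 := L_gt0.
have [K K0 HK] := spin_potential.
have c'0 : 0 < c' by rewrite divr_gt0//; lra.
pose er := step_error delta L rho * L.
have er0 : 0 <= er.
  rewrite mulr_ge0 ?(ltW L0)// mulr_ge0 ?sqr_ge0// addr_ge0// mulr_ge0 ?powR_ge0//; lra.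
(* The factors of [inv_powR_telescope] with exponents 1 and [c'], so that the differences of [t]
   cover the two summable errors. *)
pose k1 := er * (2 `^ (1 + 1) / 1); pose k2 := K * (2 `^ (1 + c') / c').
have k10 : 0 <= k1 by rewrite mulr_ge0// divr_ge0// powR_ge0.
have k20 : 0 <= k2 by rewrite mulr_ge0// divr_ge0 ?powR_ge0// ltW.
pose t (n : nat) := k1 * n.+1%:R `^ (- 1) + k2 * n.+2%:R `^ (- c').
have t0 n : 0 <= t n by rewrite addr_ge0// mulr_ge0 ?powR_ge0.
have q0 n : 0 <= q n.
  by apply: calm_sum_ge0 => // u uL; exact: (barrier_ge0 (L := L)).
have e0 n : 0 <= e n by apply: calm_sum_ge0 => // u _; exact: powR_ge0.
pose g := step_gain delta rho kappa.
have g0 : 0 < g.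
  by rewrite divr_gt0 ?divr_gt0 ?kappa_gt0// powR_gt0//; lra.
have step n : q n.+1 + t n.+1 + g / n.+1%:R * e n <= q n + t n.
  have := potential_step n.
  have h1 := ler_wpM2l er0 (inv_powR_telescope n (ltr01 : 0 < 1 :> R)).
  have h2 := ler_wpM2l K0 (inv_powR_telescope n.+1 c'0).
  have h3 : (1 - p) * Ex P (fun w => capped (`|X w| / a n.+1)) <= K * n.+2%:R `^ (- (1 + c')).
    apply: le_trans (HK n); rewrite ler_piMl//; last by have := p_gt0; lra.
    by apply: Ex_ge0 => w; apply: capped_ge0; rewrite divr_ge0// ltW// a_gt0.
  have e1 : step_error delta L rho * n.+1%:R `^ (- (1 + 1)) * L = er * n.+1%:R `^ (- (1 + 1)).
    by rewrite /er mulrAC.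
  have e2 : er * (2 `^ (1 + 1) / 1 * (n.+1%:R `^ (- 1) - n.+2%:R `^ (- 1))) =
    k1 * n.+1%:R `^ (- 1) - k1 * n.+2%:R `^ (- 1) by rewrite /k1; ring.
  have e3 : K * (2 `^ (1 + c') / c' * (n.+2%:R `^ (- c') - n.+3%:R `^ (- c'))) =
    k2 * n.+2%:R `^ (- c') - k2 * n.+3%:R `^ (- c') by rewrite /k2; ring.
  rewrite e1 -/g /t; move: h1 h2 h3; rewrite e2 e3.
  move: (er * _) (K * _) ((1 - p) * _) (g / _ * _) (k1 * _) (k1 * n.+2%:R `^ (- 1))
    (k2 * n.+2%:R `^ (- c')) (k2 * n.+3%:R `^ (- c')) (q n) (q n.+1) => *; lra.
have Qn n : q n <= q 0%N + t 0%N.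
  have H : q n + t n <= q 0%N + t 0%N.
    elim: n => [//|n IH]; apply: le_trans IH; apply: le_trans (step n).
    by rewrite lerDl mulr_ge0// divr_ge0// ltW.
  by apply: le_trans H; rewrite lerDl.
pose Q := q 0%N + t 0%N.
have Q0 : 0 <= Q by rewrite addr_ge0.
have Y0 : 0 <= 3 * Q / eta by rewrite divr_ge0 ?mulr_ge0// ltW.
(* Then [D - ln tau >= 3 Q / eta], so the bounded potential contributes at most [eta / 3]. *)
pose tau := expR (- (3 * Q / eta)).
have tau0 : 0 < tau by exact: expR_gt0.
have DtE : D - ln tau = D + 3 * Q / eta by rewrite /tau expRK opprK.
have Dt : 0 < D - ln tau by rewrite DtE ltr_wpDr.
pose co := tau `^ (- delta) + (D - ln tau)^-1.
have co0 : 0 < co by rewrite addr_gt0 ?powR_gt0// invr_gt0.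
have eta' : 0 < eta / 3 / co by rewrite !divr_gt0.
have [m1' _ Hm1] : exists2 m1' : nat, True & forall n, (m1' <= n)%N -> drift * tail n <= eta / 3.
  have h : drift * tail n @[n --> \oo] --> (0 : R).
    by rewrite -(mulr0 drift); apply: cvgMl_tmp; exact: tail_cvg.
  have e3 : 0 < eta / 3 by rewrite divr_gt0.
  have /cvgr0Pnorm_le /(_ _ e3) [N _ HN] := h.
  exists N => // n /HN /=; exact: le_trans (ler_norm _).
have [n mn en] := small_term g0 q0 t0 step (maxn m m1') eta'.
exists n; first by apply: leq_trans mn; exact: leq_maxl.
apply: le_trans (calm_total n) _.
have tl := Hm1 n (leq_trans (leq_maxr _ _) mn).
have tpow : tame (fun u => u `^ (1 + delta)) by apply: tame_pow; lra.
have h1 : calm_sum n (a n) id <= co * e n + (D - ln tau)^-1 * q n.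
  have T1 := tameZ co tpow; have T2 := tameZ (D - ln tau)^-1 tame_barrier.
  have c1 : calm_sum n (a n) (fun u => co * u `^ (1 + delta) + (D - ln tau)^-1 * barrier u) =
      co * e n + (D - ln tau)^-1 * q n.
    apply: etrans (calm_sumD T1 T2 (lexx _)) _; congr (_ + _).
      exact: (calm_sumZ _ tpow (lexx _)).
    exact: (calm_sumZ _ tame_barrier (lexx _)).
  (* Scale factor 1: [calm_sum_le] reduces to monotonicity in the test function. *)
  have c2 : calm_sum n (a n * 1) id <=
      calm_sum n (a n) (fun u => co * u `^ (1 + delta) + (D - ln tau)^-1 * barrier u).
    apply: (calm_sum_le n tame_id (tameD T1 T2) (lexx 1)) => u uL.
    by rewrite divr1; exact: (barrier_mass (L := L)).
  by rewrite mulr1 in c2; apply: le_trans c2 _; rewrite c1.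
have h2 : co * e n <= eta / 3 by rewrite mulrC -ler_pdivlMr.
have h3 : (D - ln tau)^-1 * q n <= eta / 3.
  apply: (@le_trans _ _ ((D - ln tau)^-1 * Q)); first by rewrite ler_wpM2l ?invr_ge0 ?(ltW Dt) ?Qn.
  rewrite mulrC ler_pdivrMr// DtE mulrDr.
  have -> : eta / 3 * (3 * Q / eta) = Q by field; rewrite gt_eqF.
  by rewrite lerDr mulr_ge0 ?divr_ge0// ltW.
lra.
Qed.

End Potential.

End Level.

End Extinction.

(** * Almost sure extinction in the critical case *)

Section CriticalLimit.
Context (d : measure_display) (T : measurableType d) (R : realType).
Variable P : probability T R.
Variables (p : R) (X xi : {RV P >-> R}).
Variables (Xs : nat -> {RV P >-> R}) (eps : nat -> {RV P >-> bool})
  (U : nat -> {RV P >-> nat}) (xis : nat -> {RV P >-> R}).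
Hypothesis inputs : rwes_inputs Xs eps U xis p X xi.
Hypothesis p_gt0 : 0 < p.
Hypothesis p_le1 : p <= 1.
Variable rho : R.
Hypothesis rho_gt1 : 1 < rho.
Hypothesis rhoE : rho = p * Ex P (fun w => `|xi w|).
Hypothesis X_intg : intg P X.
Hypothesis xi_intg : intg P xi.
Variable delta : R.
Hypothesis delta01 : 0 < delta <= 1.
Hypothesis xi_delta : intg P (fun w => `|xi w| `^ (1 + 2 * delta)).
Hypothesis critical : Ex P (fun w => `|xi w|) <= Ex P (fun w => `|xi w| * ln `|xi w|).

Local Notation known := (known Xs eps U xis).
Local Notation a n := (growth rho n.+1).
Local Notation Z := (total_mass p X Xs eps U xis rho).

Lemma calm_mass_small L (eta : R) m : 1 <= L -> 0 < eta ->
  exists2 n, (m <= n)%N & Ex P (fun w => calm Z L 0 n w * Z n w) <= eta.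
Proof.
move=> L1 eta0; have k0 := kappa_gt0 p_gt0 rho_gt1 rhoE xi_intg delta01 xi_delta critical.
have d0 : 0 < delta by case/andP: delta01.
pose s := p * (1 + delta^-1) ^+ 2 * Ex P (fun w => `|xi w| `^ (1 + 2 * delta)) * L `^ delta.
have s0 : 0 <= s.
  have E0 : 0 <= Ex P (fun w => `|xi w| `^ (1 + 2 * delta)).
    by apply: Ex_ge0 => w; exact: powR_ge0.
  by rewrite mulr_ge0 ?powR_ge0// mulr_ge0// mulr_ge0 ?sqr_ge0// ltW.
set kappa := _ - _ in k0.
(* The three summands provide positivity, the level condition of [barrier_ge0], and
   [s / D <= kappa / 2]. *)
pose D := 1 + `|ln L + L `^ delta| + 2 * s / kappa.
have sk : 0 <= 2 * s / kappa by apply: divr_ge0; [exact: mulr_ge0|exact: ltW].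
have lD : ln L + L `^ delta <= D.
  apply: le_trans (ler_norm _) _; rewrite /D addrAC lerDr addr_ge0//.
have D0 : 0 < D by rewrite /D -addrA ltr_pwDl// addr_ge0.
apply: (calm_small inputs p_gt0 p_le1 rho_gt1 rhoE X_intg xi_intg L1 delta01 xi_delta critical D0 lD) => //.
rewrite -/kappa.
have -> : p * ((1 + delta^-1) ^+ 2 / D * Ex P (fun w => `|xi w| `^ (1 + 2 * delta))) * L `^ delta = s / D.
  by rewrite /s; ring.
rewrite ler_pdivrMr// (_ : s = kappa / 2 * (2 * s / kappa)); last by field; rewrite gt_eqF.
by rewrite ler_wpM2l ?divr_ge0 ?(ltW k0)// /D lerDr addr_ge0.
Qed.

(** Two uses of the supermartingale inequality: a high level [L] is crossed with small probability,
    and from a time at which the stopped mass is small, even a low level is rarely reached again. *)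
Lemma total_mass_cvg0 : {ae P, forall w, Z n w @[n --> \oo] --> (0 : R)}.
Proof.
have Z0 := total_mass_ge0 X Xs eps U xis p_le1 rho_gt1.
have Zi := total_mass_intg inputs rho X_intg xi_intg.
have mZ k := intg_meas (Zi k).
have mart := total_mass_martingale inputs rho_gt1 rhoE X_intg xi_intg.
pose lam (j : nat) : R := j.+1%:R^-1.
have lam0 j : 0 < lam j by rewrite invr_gt0 ltr0n.
pose E j m := \bigcup_(k >= m) [set w | lam j <= Z k w].
have mE j m : measurable (E j m).
  apply: bigcup_measurable => k _; rewrite -[X in measurable X]setTI.
  exact: (measurable_fun_le measurableT (measurable_cst (lam j)) (mZ k)).
have bnd j (e : R) : 0 < e -> exists m, (P (E j m) <= e%:E)%E.
  move=> e0; have EZ : 0 <= Ex P (Z 0%N) by apply: Ex_ge0 => w; exact: Z0.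
  (* Makes the probability of ever reaching [L] at most [e / 2]. *)
  pose L := 1 + 2 * Ex P (Z 0%N) / e.
  have Lt0 : 0 <= 2 * Ex P (Z 0%N) / e by rewrite divr_ge0 ?mulr_ge0// ltW.
  have L1 : 1 <= L by rewrite lerDl.
  have L0 : 0 < L by exact: lt_le_trans L1.
  have le0 : 0 < lam j * (e / 2) by rewrite mulr_gt0 ?divr_gt0.
  have [m _ small] := calm_mass_small 0 L1 le0; exists m.
  pose A w := calm Z L 0 m w.
  have kA n : (m <= n)%N -> known (history n.+1) A.
    move=> mn; apply: (known_sub (@history_le m.+1 n.+1 mn)).
    exact: known_calm.
  have A01 w : 0 <= A w <= 1 by exact: calm01.
  have A1 w : `|A w| <= 1 by have /andP[A0 A1] := A01 w; rewrite ger0_norm.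
  have mA : measurable_fun setT A by exact: measurable_calm.
  have Ai : intg P A by apply: (intg_le mA (intg_cst P 1)).
  have cA : Ex P (fun w => 1 - A w) <= e / 2.
    have : L * Ex P (fun w => 1 - A w) <= Ex P (Z 0%N).
      apply: (supermartingale_maximal mZ Zi Z0 (leq0n m)) => k _.
      rewrite le_eqVlt; apply/orP; left; apply/eqP; apply: mart; first exact: known_calm.
      by move=> w; exact: calm_norm.
    rewrite mulrC -ler_pdivlMr// => h; apply: le_trans h _.
    rewrite ler_pdivrMr// /L mulrDr.
    have -> : e / 2 * (2 * Ex P (Z 0%N) / e) = Ex P (Z 0%N) by field; rewrite gt_eqF.
    by rewrite lerDr mulr_ge0 ?divr_ge0// ltW.
  (* Stopped at [lam j] once [A] fails, the mass dominates the event. *)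
  pose V k w := A w * Z k w + lam j * (1 - A w).
  have AZi k : intg P (fun w => A w * Z k w) by exact: (intgMb (Zi k) mA A1).
  have cAi : intg P (fun w => 1 - A w) by apply: intgB => //; exact: intg_cst.
  have lAi := intgZ (lam j) cAi.
  have Vi k : intg P (V k) by exact: intgD.
  have V0 k w : 0 <= V k w.
    have /andP[A0 A1'] := A01 w.
    by rewrite addr_ge0 ?mulr_ge0 ?subr_ge0// ltW.
  have mV k := intg_meas (Vi k).
  have kV k : (m <= k)%N -> known (history k.+1) (V k).
    move=> mk; apply: knownD; first by apply: knownM; [exact: kA|exact: known_total_mass].
    apply: knownM; first exact: known_cst.
    by apply: knownB; [exact: known_cst|exact: kA].
  have [|_ H] := @maximal_event _ _ _ P V (lam j) m (lam0 j) mV (Ex P (V m)).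
    move=> n mn; apply: (supermartingale_maximal mV Vi V0 mn) => k mk.
    pose C w := calm V (lam j) m k w.
    have kC : known (history k.+1) C.
      apply: known_prod => i; rewrite mem_index_iota ltnS => /andP[mi ik].
      apply: (known_comp (measurable_below (lam j))).
      by apply: (known_sub (@history_le i.+1 k.+1 ik)); exact: kV.
    have C01 w : 0 <= C w <= 1 by exact: calm01.
    have kCA : known (history k.+1) (fun w => C w * A w) by apply: knownM => //; exact: kA.
    have CA1 w : `|C w * A w| <= 1.
      have /andP[A0 A1'] := A01 w; have /andP[C0 C1'] := C01 w.
      by rewrite ger0_norm ?mulr_ge0// mulr_ile1.
    have mC : measurable_fun setT C by exact: (known_meas kC).
    have C1 w : `|C w| <= 1 by have /andP[C0 C1'] := C01 w; rewrite ger0_norm.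
    have CVi n' : intg P (fun w => C w * A w * Z n' w).
      by apply: (intgMb (Zi n') _ CA1); exact: (known_meas kCA).
    have ClA := intgMb lAi mC C1.
    have VE n' : Ex P (fun w => C w * V n' w) =
        Ex P (fun w => C w * A w * Z n' w) + Ex P (fun w => C w * (lam j * (1 - A w))).
      by rewrite -ExD//; apply: eq_Ex => w; rewrite /V mulrDr mulrA.
    by rewrite !VE (mart _ _ kCA CA1).
  apply: (@le_trans _ _ (P (\bigcup_(k >= m) [set w | (lam j <= V k w)%R]))).
    apply: le_measure; rewrite ?inE//.
      apply: bigcup_measurable => k _; rewrite -[X in measurable X]setTI.
      exact: (measurable_fun_le measurableT (measurable_cst (lam j)) (mV k)).
    move=> w [k mk /= lk]; exists k => //=; rewrite /V /A.
    have [->|[-> _]] := calm_case p X Xs eps U xis rho L m w.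
      by rewrite mul0r add0r subr0 mulr1.
    by rewrite mul1r subrr mulr0 addr0.
  (* The initial mean of [V] is at most [lam j * e / 2] from the stopped mass plus as much from the
     failure of [A]. *)
  apply: le_trans H _; rewrite lee_fin ler_pdivrMr// /V ExD// ExZ//.
  have -> : e * lam j = lam j * (e / 2) + lam j * (e / 2) by field.
  by apply: lerD => //; rewrite ler_pM2l.
apply: filterS (ae_exists_notin mE bnd) => w Hw.
apply/cvgr0Pnorm_le => e e0.
pose j := Num.Def.archi_bound e^-1.
have lj : lam j <= e.
  rewrite /lam -[leRHS]invrK lef_pV2 ?posrE ?invr_gt0 ?ltr0n//.
  apply: ltW; apply: lt_trans (_ : j%:R < _); last by rewrite ltr_nat.
  by apply: archi_boundP; rewrite invr_ge0 ltW.
have [m nE] := Hw j; exists m => // k /= mk; rewrite ger0_norm//.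
apply: le_trans lj; apply: ltW; rewrite ltNge; apply/negP => lz; apply: nE; by exists k.
Qed.

Lemma walk_extinct : {ae P, forall w, rwes Xs eps U xis n w / n%:R `^ rho
   @[n --> \oo] --> (0 : R)}.
Proof.
apply: filterS total_mass_cvg0 => w Zw.
rewrite -(@cvg_shiftS _ (fun n => rwes Xs eps U xis n w / n%:R `^ rho)).
apply/cvgr0Pnorm_le.
have : scale_seq rho n * Z n w @[n --> \oo] --> (0 : R).
  by rewrite -(mulr0 (scale_lim rho)); apply: cvgM => //; exact: scale_cvg.
move=> /cvgr0Pnorm_le H e /H [m _ Hm]; exists m => // n /Hm /=.
apply: le_trans; have a0 := a_gt0 rho_gt1 n.
have Np : 0 < n.+1%:R `^ rho :> R by rewrite powR_gt0.
have Zn := total_mass_ge0 X Xs eps U xis p_le1 rho_gt1.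
rewrite /scale_seq [leRHS]ger0_norm; last by apply: mulr_ge0 => //; apply: divr_ge0; exact: ltW.
rewrite normrM normfV (gtr0_norm Np) mulrAC ler_wpM2r ?invr_ge0 ?(ltW Np)//.
have := abs_sum_total X Xs eps U xis p_le1 rho_gt1 n w.
rewrite ler_pdivrMr// mulrC; apply: le_trans.
exact: ler_norm_sum.
Qed.

End CriticalLimit.

(** * Choice of the exponent *)

(** With [y = s ln u], the remainder [exp y - 1 - y] is at most [y^2 (1 + exp y)]. For [u <= 1] one
    has [u (ln u)^2 <= 4], whence the 8; for [u > 1] three factors [u^delta] appear, whence
    [2 / delta^2] and the exponent [1 + 3 delta]. *)
Lemma powR_second_order (R : realType) (delta s u : R) : 0 < s <= delta -> 0 <= u ->
  u `^ (1 + s) <= u + s * (u * ln u)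
    + s ^+ 2 * ((8 + 2 / delta ^+ 2) * (1 + u `^ (1 + 3 * delta))).
Proof.
move=> /andP[s0 sd]; have d0 : 0 < delta by exact: lt_le_trans sd.
have d2 : 0 <= 2 / delta ^+ 2 by rewrite divr_ge0 ?sqr_ge0.
have s2 := sqr_ge0 s.
rewrite le_eqVlt => /predU1P[<-|u0].
  rewrite powR0 ?gt_eqF ?addr_gt0// !(mul0r, mulr0) !add0r.
  by rewrite mulr_ge0// mulr_ge0 ?addr_ge0 ?powR_ge0.
have u0' := ltW u0; have us0 : 0 < u `^ s by exact: powR_gt0.
pose y := s * ln u.
have usE : u `^ s = expR y by rewrite /powR gt_eqF.
have e1 : u `^ s - 1 - y <= y * (u `^ s - 1).
  have : 1 - y <= (u `^ s)^-1 by rewrite usE -expRN; exact: expR_ge1Dx.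
  rewrite -(ler_pM2l us0) mulfV ?gt_eqF// mulrBr; lra.
have e2 : y * (u `^ s - 1) <= y ^+ 2 * (1 + u `^ s).
  have y2 := sqr_ge0 y.
  have [y0|y0] := leP 0 y.
    have h : u `^ s - 1 <= y * u `^ s.
      have : 1 - y <= (u `^ s)^-1 by rewrite usE -expRN; exact: expR_ge1Dx.
      rewrite -(ler_pM2l us0) mulfV ?gt_eqF// mulrBr; lra.
    apply: le_trans (ler_wpM2l y0 h) _.
    by rewrite mulrA -expr2 ler_wpM2l// lerDr.
  have h : y <= u `^ s - 1 by have := expR_ge1Dx y; rewrite -usE; lra.
  apply: (@le_trans _ _ (y * y)); first by rewrite ler_nM2l.
  by rewrite -expr2 ler_peMr// lerDl ltW.
have e3 : u * ln u ^+ 2 * (1 + u `^ s) <= (8 + 2 / delta ^+ 2) * (1 + u `^ (1 + 3 * delta)).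
  have p0 := powR_ge0 u (1 + 3 * delta).
  have [u1|u1] := leP u 1.
    have us1 : u `^ s <= 1.
      have : u `^ s <= 1 `^ s by apply: ge0_ler_powR; rewrite ?nnegrE ?(ltW s0).
      by rewrite powR1.
    have l0 : ln u <= 0 by rewrite -ln1 ler_ln ?posrE.
    have h0 : 0 < 2^-1 :> R by rewrite invr_gt0.
    have ui : 0 < u^-1 by rewrite invr_gt0.
    have := ln_le_powR h0 ui; rewrite lnV ?posrE// invrK powR_inv// => h.
    have h' : ln u ^+ 2 <= 4 * u^-1.
      have -> : 4 * u^-1 = ((u `^ 2^-1)^-1 * 2) ^+ 2.
        rewrite exprMn exprVn expr2 -powRD ?(gt_eqF u0) ?implybT//.
        have -> : 2^-1 + 2^-1 = 1 :> R by field.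
        by rewrite powRr1// expr2 mulrC; congr (_ * _); ring.
      rewrite -sqrrN ler_sqr ?nnegrE ?oppr_ge0// mulr_ge0// invr_ge0 powR_ge0//.
    have h4 : u * ln u ^+ 2 <= 4.
      by rewrite -[leRHS](mulfVK (lt0r_neq0 u0)) mulrC ler_pM2r.
    have h5 : u * ln u ^+ 2 * (1 + u `^ s) <= 4 * 2.
      by apply: ler_pM; rewrite ?(mulr_ge0 u0' (sqr_ge0 _)) ?addr_ge0 ?(ltW us0)//; lra.
    have h6 : 0 <= 2 / delta ^+ 2 * (1 + u `^ (1 + 3 * delta)) by rewrite mulr_ge0// addr_ge0.
    rewrite mulrDl; lra.
  have usd : u `^ s <= u `^ delta by apply: ler_powR => //; exact: ltW.
  have ud1 : 1 <= u `^ delta.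
    by rewrite -(powRr0 u); apply: ler_powR; rewrite ?(ltW u1) ?(ltW d0).
  have l0 : 0 <= ln u by apply: ln_ge0; exact: ltW.
  have h := ln_le_powR d0 u0.
  have h' : ln u ^+ 2 <= (u `^ delta / delta) ^+ 2.
    by rewrite ler_sqr ?nnegrE// divr_ge0 ?powR_ge0 ?(ltW d0).
  have h5 : u * ln u ^+ 2 * (1 + u `^ s) <= u * (u `^ delta / delta) ^+ 2 * (2 * u `^ delta).
    apply: ler_pM; rewrite ?(mulr_ge0 u0' (sqr_ge0 _)) ?addr_ge0 ?(ltW us0)//.
      by rewrite ler_pM2l.
    lra.
  have h6 : u * (u `^ delta / delta) ^+ 2 * (2 * u `^ delta) = 2 / delta ^+ 2 * u `^ (1 + 3 * delta).
    have -> : u `^ (1 + 3 * delta) = u * u `^ delta ^+ 3.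
      rewrite powRD ?(gt_eqF u0) ?implybT// powRr1//; congr (_ * _).
      rewrite (_ : 3 * delta = delta + (delta + delta)); last by ring.
      by rewrite !powRD ?(gt_eqF u0) ?implybT// !exprS expr0 mulr1.
    by field; rewrite gt_eqF.
  apply: le_trans h5 _; rewrite h6; apply: ler_pM => //; lra.
have -> : u `^ (1 + s) = u * u `^ s by exact: powR1D.
have e4 : u * u `^ s <= u * (1 + y + y ^+ 2 * (1 + u `^ s)) by rewrite ler_pM2l//; lra.
apply: le_trans e4 _.
have -> : u * (1 + y + y ^+ 2 * (1 + u `^ s)) =
  u + s * (u * ln u) + s ^+ 2 * (u * ln u ^+ 2 * (1 + u `^ s)) by rewrite /y; ring.
by rewrite lerD2l ler_wpM2l.
Qed.

Section Exponents.
Context (d : measure_display) (T : measurableType d) (R : realType).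
Variable P : probability T R.

Lemma intg_pow_le (f : T -> R) r s : 0 <= r <= s -> measurable_fun setT f ->
  intg P (fun w => `|f w| `^ s) -> intg P (fun w => `|f w| `^ r).
Proof.
move=> rs mf fs; apply: (intg_le _ (intgD (intg_cst P 1) fs)) => [|w].
  exact: (measurableT_comp (measurable_norm_powR r)).
by rewrite ger0_norm ?powR_ge0//; exact: powR_le_1D.
Qed.

Lemma intg_pow1 (f : T -> R) r : 1 <= r -> measurable_fun setT f ->
  intg P (fun w => `|f w| `^ r) -> intg P f.
Proof.
move=> r1 mf fr; apply: intg_normP => //.
have r01 : (0 : R) <= (1 : R) <= r by rewrite ler01.
by apply: eq_intg (intg_pow_le r01 mf fr) => w; rewrite powRr1.
Qed.

(** The expansion gives at most [m + s l + s^2 K] for the moment of order [1 + s]; this is below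
    [(1 + s) m] as soon as [s K < m - l]. *)
Lemma exists_subcritical (f : T -> R) alpha : 1 < alpha -> measurable_fun setT f ->
  intg P (fun w => `|f w| `^ alpha) -> intg P (fun w => `|f w| * ln `|f w|) ->
  Ex P (fun w => `|f w| * ln `|f w|) < Ex P (fun w => `|f w|) ->
  exists2 r, 1 < r <= alpha & Ex P (fun w => `|f w| `^ r) < r * Ex P (fun w => `|f w|).
Proof.
move=> a1 mf fa fl sub.
have fi : intg P (fun w => `|f w|) by apply: intg_norm; exact: (intg_pow1 (ltW a1) mf fa).
(* The remainder of [powR_second_order] then has exactly the exponent [alpha]. *)
pose delta := (alpha - 1) / 3.
have d0 : 0 < delta by rewrite divr_gt0//; lra.
have aE : alpha = 1 + 3 * delta by rewrite /delta; field.
set l := Ex P _ in sub; set m := Ex P _ in sub *.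
pose K := (8 + 2 / delta ^+ 2) * (1 + Ex P (fun w => `|f w| `^ alpha)).
have E0 : 0 <= Ex P (fun w => `|f w| `^ alpha) by apply: Ex_ge0 => w; exact: powR_ge0.
have K0 : 0 < K.
  have d2 : 0 <= 2 / delta ^+ 2 by rewrite divr_ge0 ?sqr_ge0.
  by apply: mulr_gt0; lra.
pose s := Num.min delta ((m - l) / (2 * K)).
have ml : 0 < m - l by rewrite subr_gt0.
have ml0 : 0 < (m - l) / (2 * K) by apply: divr_gt0 => //; exact: mulr_gt0.
have s0 : 0 < s by rewrite lt_min d0.
have sd : s <= delta by rewrite ge_min lexx.
have sK : s * K <= (m - l) / 2.
  have gen (k z : R) : 0 < k -> z <= (m - l) / (2 * k) -> z * k <= (m - l) / 2.
    by move=> k0; rewrite ler_pdivlMr ?mulr_gt0//; lra.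
  by apply: gen => //; rewrite ge_min lexx orbT.
exists (1 + s); first by rewrite aE; apply/andP; split; lra.
have fs : intg P (fun w => `|f w| `^ (1 + s)).
  by apply: (intg_pow_le _ mf fa); rewrite aE; apply/andP; split; lra.
have i1 := intgZ s fl.
have i2 := intgZ (8 + 2 / delta ^+ 2) (intgD (intg_cst P 1) fa).
have i3 := intgZ (s ^+ 2) i2.
have : Ex P (fun w => `|f w| `^ (1 + s)) <= m + s * l + s ^+ 2 * K.
  rewrite /K -[X in X + Ex P (fun w => `|f w| `^ alpha)](Ex_cst P).
  rewrite -(ExD (intg_cst P 1) fa) -(ExZ _ (intgD (intg_cst P 1) fa)) -(ExZ _ i2).
  rewrite -(ExZ _ fl) -(ExD fi i1) -(ExD (intgD fi i1) i3).
  apply: Ex_le => //; first by apply: intgD => //; exact: intgD.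
  by move=> w; rewrite aE; apply: powR_second_order => //; rewrite s0.
have h : s ^+ 2 * K <= s * ((m - l) / 2) by rewrite expr2 -mulrA ler_pM2l.
have h2 : 0 < s * (m - l) by exact: mulr_gt0.
move: h2 h; rewrite mulrA mulrBr mulrDl mul1r; lra.
Qed.

End Exponents.

(** * From extended-real moments of the echo to real expectations *)

Section Moments.
Context (d : measure_display) (T : measurableType d) (R : realType).
Variable P : probability T R.

Lemma expectationE (f : T -> R) : 'E_P[f]%E = (\int[P]_w (f w)%:E)%E.
Proof. by rewrite unlock. Qed.

Lemma expectation_Ex (f : T -> R) : intg P f -> 'E_P[f]%E = (Ex P f)%:E.
Proof. by move=> fi; rewrite expectationE ExE. Qed.

Lemma ae_eq_expectation (f g : T -> R) : measurable_fun setT f -> measurable_fun setT g ->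
  {ae P, forall w, f w = g w} -> 'E_P[f]%E = 'E_P[g]%E.
Proof.
move=> mf mg fg; rewrite !expectationE; apply: ae_eq_integral => //; try exact/measurable_EFinP.
by apply: filterS fg => w -> _.
Qed.

Variable xi : {RV P >-> R}.
Hypothesis xi_ge0 : {ae P, forall w, 0 <= xi w}.

Lemma moment_norm gamma : moment P xi gamma = 'E_P[fun w => (`|xi w| `^ gamma)%R]%E.
Proof.
apply: ae_eq_expectation.
- exact: (measurableT_comp (measurable_powR gamma)).
- exact: (measurableT_comp (measurable_norm_powR gamma)).
- by apply: filterS xi_ge0 => w w0; rewrite ger0_norm.
Qed.

Lemma mean_xlogx_norm : mean_xlogx P xi = 'E_P[fun w => (`|xi w| * ln `|xi w|)%R]%E.
Proof.
have mn : measurable_fun setT (fun w => `|xi w|) by exact: measurableT_comp.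
apply: ae_eq_expectation.
- by apply: measurable_funM => //; exact: (measurableT_comp (@measurable_ln R)).
- by apply: measurable_funM => //; exact: (measurableT_comp (@measurable_ln R)).
- by apply: filterS xi_ge0 => w w0; rewrite ger0_norm.
Qed.

Lemma moment1 : intg P xi -> moment P xi 1 = (Ex P (fun w => `|xi w|))%:E.
Proof.
move=> xii; rewrite moment_norm -expectation_Ex; last exact: intg_norm.
by congr expectation; apply/funext => w; rewrite powRr1.
Qed.

Lemma Ex_norm_echo : Ex P (fun w => `|xi w|) = Ex P xi.
Proof.
apply: ae_eq_Ex => //; first exact: measurableT_comp.
by apply: filterS xi_ge0 => w w0; rewrite ger0_norm.
Qed.

(** The strict moment inequality of [Lambda] has a finite right-hand side, so it also yields
    integrability of the echo power. *)
Lemma Lambda_good_exponent (p : R) (X : {RV P >-> R}) gamma : 0 < p -> intg P xi ->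
  Lambda P X xi gamma ->
  good_exponent p X xi (p * Ex P (fun w => `|xi w|)) gamma.
Proof.
move=> p0 xii [g1 Xg]; rewrite moment1// moment_norm => xig.
have Xi : intg P (fun w => `|X w| `^ gamma).
  apply: ge0_intg => [|w|]; [|exact: powR_ge0|by rewrite -expectationE].
  exact: (measurableT_comp (measurable_norm_powR gamma)).
have xigi : intg P (fun w => `|xi w| `^ gamma).
  apply: ge0_intg => [|w|]; [|exact: powR_ge0|].
    exact: (measurableT_comp (measurable_norm_powR gamma)).
  by rewrite -expectationE; apply: lt_trans xig _; rewrite -EFinM ltry.
split => //.
move: xig; rewrite expectation_Ex// -EFinM lte_fin => xig.
by rewrite mulrCA ltr_pM2l.
Qed.

End Moments.
Theorem theorem1p1 (R : realType) (d : measure_display) (T : measurableType d)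
    (P : probability T R) (p : R) (X xi : {RV P >-> R})
    (Xs : nat -> {RV P >-> R}) (eps : nat -> {RV P >-> bool})
    (U : nat -> {RV P >-> nat}) (xis : nat -> {RV P >-> R})
    (p_gt0 : 0 < p) (p_le1 : p <= 1)
    (X_nonzero : (P [set w | X w = 0%R] < 1)%E)
    (xi_nonzero : (P [set w | xi w = 0%R] < 1)%E)
    (xi_ge0 : {ae P, forall w, 0 <= xi w})
    (X_xi_Lalpha : exists alpha : R, [/\ 1 < alpha,
       (X : T -> R) \in Lfun P alpha%:E & (xi : T -> R) \in Lfun P alpha%:E])
    (inputs : rwes_inputs Xs eps U xis p X xi)
    (supercritical : 1 < p * mean_echo P xi) :
  exists M : {RV P >-> R},
    [/\ (M : T -> R) \in Lfun P 1%E,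
        {ae P, forall w,
          rwes Xs eps U xis n w / n%:R `^ (p * mean_echo P xi)
            @[n --> \oo] --> M w},
        (mean_xlogx P xi < (mean_echo P xi)%:E)%E ->
          [/\ forall gamma : R, Lambda P X xi gamma ->
                converges_in_Lp P gamma
                  (fun n w => rwes Xs eps U xis n w
                                / n%:R `^ (p * mean_echo P xi)) M,
              nondegenerate_rv P M
            & 'E_P[M]%E = (fine 'E_P[X]%E / Gamma_fun (1 + p * mean_echo P xi)
                 * (1 + (1 - p) / (p * mean_echo P xi - 1)))%:E]
      & ((mean_echo P xi)%:E <= mean_xlogx P xi)%E ->
          {ae P, forall w, M w = 0}].
Proof.
have [alpha [a1 XL xiL]] := X_xi_Lalpha.
have [mX Xa] := intg_Lfun (ltW a1) XL; have [mxi xia] := intg_Lfun (ltW a1) xiL.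
have X_intg := intg_pow1 (ltW a1) mX Xa; have xi_intg := intg_pow1 (ltW a1) mxi xia.
have m1E : mean_echo P xi = Ex P (fun w => `|xi w|) by rewrite /mean_echo moment1.
(* Keeps [1 + 2 delta <= alpha], the moment of the echo used by the critical argument, and
   [delta <= 1]. *)
pose delta := Num.min 1 ((alpha - 1) / 2).
have d0 : 0 < delta by rewrite lt_min ltr01 divr_gt0 ?subr_gt0.
have d1 : delta <= 1 by rewrite ge_min lexx.
have delta01 : 0 < delta <= 1 by rewrite d0.
have da : delta <= (alpha - 1) / 2 by rewrite ge_min lexx orbT.
have xi_delta : intg P (fun w => `|xi w| `^ (1 + 2 * delta)).
  by apply: (intg_pow_le _ mxi xia); apply/andP; split; lra.
have xlog_intg := xi_log delta01 xi_delta.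
have xlogE : mean_xlogx P xi = (Ex P (fun w => `|xi w| * ln `|xi w|))%:E.
  by rewrite mean_xlogx_norm// expectation_Ex.
rewrite xlogE !m1E.
move: supercritical; rewrite m1E; set rho := p * _ => rho_gt1.
have rhoE : rho = p * Ex P (fun w => `|xi w|) by [].
have rho_xi : rho = p * Ex P xi by rewrite /rho Ex_norm_echo.
have toRV (f : T -> R) : measurable_fun setT f -> exists M : {RV P >-> R}, (M : T -> R) = f.
  by move=> mf; exists (mfun_Sub (mem_set mf)).
have [sub|crit] := ltP (Ex P (fun w => `|xi w| * ln `|xi w|)) (Ex P (fun w => `|xi w|)); last first.
  (* Critical case: the limit is the zero variable, and the hypothesis of the subcritical clause is
     contradictory. *)
  have [M ME] := toRV (fun=> 0) (measurable_cst _); exists M.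
  split.
  - by rewrite ME; apply: (Lfun_intg ltr01); [exact: measurable_cst|exact: intg_cst].
  - rewrite ME.
    exact: (walk_extinct inputs p_gt0 p_le1 rho_gt1 rhoE X_intg xi_intg delta01 xi_delta crit).
  - by rewrite lte_fin ltNge crit.
  - by move=> _; apply: aeW => w; rewrite ME.
have [r /andP[r1 ra] rm] := exists_subcritical a1 mxi xia xlog_intg sub.
have r0a : 0 <= r <= alpha by apply/andP; split; lra.
have good : good_exponent p X xi rho r.
  split => //; [exact: intg_pow_le Xa|exact: intg_pow_le xia|].
  by rewrite rhoE mulrCA ltr_pM2l.
have [g mg Mg] := ae_limit (fun n => M_meas p X Xs eps U xis rho n)
  (M_cvg inputs p_gt0 p_le1 rho_gt1 rhoE rho_xi X_intg xi_intg good).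
have [M ME] := toRV _ (measurable_walk_limit p X rho mg); exists M; rewrite ME.
have Mi := walk_limit_intg inputs p_gt0 p_le1 rho_gt1 rhoE rho_xi X_intg xi_intg mg Mg good.
split.
- apply: (Lfun_intg ltr01); first exact: measurable_walk_limit.
  by apply: eq_intg (intg_norm Mi) => w; rewrite powRr1.
- exact: (walk_cvg rho_gt1 Mg).
- move=> _; split.
  (* The limit was constructed with the exponent [r]; any other exponent of [Lambda] is good in its
     own right and shares the same almost sure limit. *)
  + move=> gamma Lg.
    apply: (walk_Lr inputs p_gt0 p_le1 rho_gt1 rhoE rho_xi X_intg xi_intg mg Mg).
    exact: Lambda_good_exponent.
  + exact: (walk_limit_nondegenerate inputs p_gt0 p_le1 rho_gt1 rhoE rho_xi X_intg xi_intg mg Mg good).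
  + rewrite expectation_Ex// expectation_Ex//=.
    by rewrite (walk_limit_mean inputs p_gt0 p_le1 rho_gt1 rhoE rho_xi X_intg xi_intg mg Mg good).
- by rewrite lee_fin leNgt sub.
Qed.
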